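(* Let $d\ge1$, $\alpha\in(0,2)$, $m\ge0$, and let $V:\mathbb{R}^d\to\mathbb{R}$ be a potential (measurable function). For any $\delta>0$ and $x\in\mathbb{R}^d$ define $${}_\delta\mathcal{I}_\alpha V(x)=\begin{cases}\displaystyle\int_{|x-y|<\delta}\frac{|V(y)|}{|x-y|^{d-\alpha}}\,dy & \alpha<d,\\[2mm] \displaystyle\int_{|x-y|<\delta}\log\Big(1+\frac{1}{|x-y|}\Big)|V(y)|\,dy & \alpha=d=1,\\[2mm] \displaystyle\int_{|x-y|<\delta}|V(y)|\,dy & \alpha>d=1.\end{cases}$$ Then $V\in\mathcal{K}_{d,\alpha}$ holds if and only if $\lim_{\delta\downarrow0}\sup_{x\in\mathbb{R}^d}{}_\delta\mathcal{I}_\alpha V(x)=0$.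
   Context: For $\alpha\in(0,2)$, $m\ge0$, $L_{m,\alpha}=(-\Delta+m^{2/\alpha})^{\alpha/2}-m$ on $L^2(\mathbb{R}^d)$ is the operator with Fourier multiplier $(|y|^2+m^{2/\alpha})^{\alpha/2}-m$ (for $m=0$: $|y|^\alpha$). $p^m_t(x-y)$ is the integral kernel of $e^{-tL_{m,\alpha}}$, and $R^m_1(x)=\int_0^\infty e^{-t}p^m_t(x)\,dt$ is the resolvent kernel at $\lambda=1$. A potential $V$ is in relativistic Kato-class $\mathcal{K}_{d,\alpha}$ if $$\lim_{\delta\downarrow0}\sup_{x\in\mathbb{R}^d}\int_{|x-y|<\delta}R^m_1(x-y)|V(y)|\,dy=0 .$$ *)

(* Defs.v *)
From HB Require Import structures.
From mathcomp Require Import all_boot all_order all_algebra.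
From mathcomp Require Import all_classical all_reals all_analysis.
From mathcomp Require Import complex.

Set Implicit Arguments.
Unset Strict Implicit.
Unset Printing Implicit Defensive.

Import Order.TTheory GRing.Theory Num.Theory numFieldNormedType.Exports.
Local Open Scope classical_set_scope.
Local Open Scope ring_scope.
Local Open Scope complex_scope.

(** R^d is the type 'rV[R]_d of row vectors. The library equips it with its
    usual topology, but with the sup norm and with no sigma-algebra or measure:
    the Borel sigma-algebra (generated by the coordinates), the Lebesgue measure
    and the Euclidean norm are defined here. *)

Fact rowvec_display : measure_display.
Proof. exact: default_measure_display. Qed.

Section measurable_rowvec.
Context (R : realType) (n : nat).

Let coors : 'I_n -> 'rV[R]_n -> measurableTypeR R := fun i v => v ord0 i.

Let rowvec_set0 : g_sigma_preimage coors set0.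
Proof. exact: sigma_algebra0. Qed.

Let rowvec_setC A : g_sigma_preimage coors A -> g_sigma_preimage coors (~` A).
Proof. exact: sigma_algebraC. Qed.

Let rowvec_bigcup (F : _^nat) : (forall i, g_sigma_preimage coors (F i)) ->
  g_sigma_preimage coors (\bigcup_i (F i)).
Proof. exact: sigma_algebra_bigcup. Qed.

HB.instance Definition _ := @isMeasurable.Build
  rowvec_display 'rV[R]_n (g_sigma_preimage coors) rowvec_set0 rowvec_setC rowvec_bigcup.

Lemma measurable_coord (i : 'I_n) :
  measurable_fun [set: 'rV[R]_n] (fun v => v ord0 i : measurableTypeR R).
Proof.
move=> _ Y mY; rewrite setTI; apply: sub_sigma_algebra => /=.
rewrite -bigcup_seq/=; exists i => /=; first by rewrite mem_index_enum.
by exists Y => //; rewrite setTI.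
Qed.

Lemma measurable_fun_coordP d (T : measurableType d) (f : T -> 'rV[R]_n) :
  (forall i, measurable_fun [set: T] (fun x => f x ord0 i : measurableTypeR R)) ->
  measurable_fun [set: T] f.
Proof.
move=> mf.
apply: (measurability (\big[setU/set0]_(i < n)
  preimage_set_system setT (coors i) measurable)) => //.
rewrite -bigcup_seq => _ [_ [i _ [B mB <-]] <-].
rewrite !setTI -comp_preimage -[X in measurable X]setTI.
exact: mf.
Qed.

End measurable_rowvec.

Section lebesgue_measure_rowvec.
Context (R : realType).

(* R^(n+1) = R x R^n *)
Definition row_cons n (p : measurableTypeR R * 'rV[R]_n) : 'rV[R]_n.+1 :=
  row_mx (p.1%:M : 'rV[R]_1) p.2.

Lemma measurable_row_cons n :
  measurable_fun [set: measurableTypeR R * 'rV[R]_n] (@row_cons n).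
Proof.
apply: measurable_fun_coordP => i.
case: (split_ordP (i : 'I_(1 + n))) => j ->.
  rewrite (_ : (fun _ => _) = fst); first exact: measurable_fst.
  apply/funext => p; rewrite /row_cons; etransitivity.
    exact: (row_mxEl (p.1%:M : 'rV[R]_1) p.2).
  by rewrite !ord1 mxE eqxx mulr1n.
rewrite (_ : (fun _ => _) = (fun v : 'rV[R]_n => v ord0 j) \o snd).
  exact: measurableT_comp (measurable_coord j) measurable_snd.
by apply/funext => p; exact: (row_mxEr (p.1%:M : 'rV[R]_1) p.2).
Qed.

Definition row_uncons n (v : 'rV[R]_n.+1) : measurableTypeR R * 'rV[R]_n :=
  (v ord0 ord0, \row_i v ord0 (lift ord0 i)).

Lemma row_consK n : cancel (@row_cons n) (@row_uncons n).
Proof.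
move=> [x v]; rewrite /row_uncons /row_cons; congr (_, _).
  rewrite (_ : ord0 = lshift n (ord0 : 'I_1)); last exact/val_inj.
  etransitivity; first exact: (row_mxEl (x%:M : 'rV[R]_1) v).
  by rewrite mxE eqxx mulr1n.
apply/rowP => i; rewrite mxE.
rewrite (_ : lift ord0 i = rshift 1 i); last exact/val_inj.
exact: (row_mxEr (x%:M : 'rV[R]_1) v).
Qed.

Lemma measurable_row_uncons n :
  measurable_fun [set: 'rV[R]_n.+1] (@row_uncons n).
Proof.
apply/measurable_fun_pairP; split; first exact: (measurable_coord ord0).
apply: measurable_fun_coordP => i.
rewrite (_ : (fun _ => _) = (fun v : 'rV[R]_n.+1 => v ord0 (lift ord0 i))).
  exact: measurable_coord.
by apply/funext => v; rewrite mxE.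
Qed.

Section step.
Context (n : nat) (mu : {sigma_finite_measure set 'rV[R]_n -> \bar R}).

Definition leb_cons : set 'rV[R]_n.+1 -> \bar R :=
  pushforward ((@lebesgue_measure R) \x mu)%E (@row_cons n).

Let leb_cons0 : leb_cons set0 = 0%E.
Proof. by rewrite /leb_cons/pushforward preimage_set0 measure0. Qed.

Let leb_cons_ge0 A : (0 <= leb_cons A)%E.
Proof. by rewrite /leb_cons /pushforward; exact: measure_ge0. Qed.

Let leb_cons_sigma_additive : semi_sigma_additive leb_cons.
Proof.
have mf := @measurable_row_cons n.
move=> F mF tF mUF; rewrite /leb_cons /pushforward preimage_bigcup.
apply: measure_semi_sigma_additive.
- by move=> k; rewrite -[X in measurable X]setTI; exact: mf.
- apply/trivIsetP => /= i j _ _ ij; rewrite -preimage_setI.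
  by move/trivIsetP : tF => /(_ _ _ _ _ ij) ->//; rewrite preimage_set0.
- by rewrite -preimage_bigcup -[X in measurable X]setTI; exact: mf.
Qed.

HB.instance Definition _ := isMeasure.Build _ _ _ leb_cons
  leb_cons0 leb_cons_ge0 leb_cons_sigma_additive.

Let leb_cons_sigma_finite : sigma_finite setT leb_cons.
Proof.
have muncons := @measurable_row_uncons n.
have /sigma_finiteP[F [TF ndF Foo]] := sigma_finiteT (@lebesgue_measure R).
have /sigma_finiteP[G [TG ndG Goo]] := sigma_finiteT mu.
exists (fun k => @row_uncons n @^-1` (F k `*` G k)).
  apply/esym; rewrite -subTset => v _.
  have [k _ Fk] : (\bigcup_i F i) (row_uncons v).1 by rewrite -TF.
  have [l _ Gl] : (\bigcup_i G i) (row_uncons v).2 by rewrite -TG.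
  exists (maxn k l) => //; split.
    by move: Fk; exact/subsetPset/ndF/leq_maxl.
  by move: Gl; exact/subsetPset/ndG/leq_maxr.
move=> k; have [mF Fk] := Foo k; have [mG Gk] := Goo k.
have mFG : measurable (F k `*` G k) by exact: measurableX.
split; first by rewrite -[X in measurable X]setTI; exact: muncons.
rewrite /leb_cons /pushforward -comp_preimage.
rewrite (_ : @row_uncons n \o @row_cons n = id) ?preimage_id//.
  by rewrite product_measure1E// lte_mul_pinfty// ge0_fin_numE.
by apply/funext => p /=; rewrite row_consK.
Qed.

HB.instance Definition _ := Measure_isSigmaFinite.Build _ _ _ leb_cons
  leb_cons_sigma_finite.

End step.

(* R^0 is a point, of measure 1 *)
Fixpoint lebesgue n : {sigma_finite_measure set 'rV[R]_n -> \bar R} :=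
  match n with
  | 0 => dirac (0 : 'rV[R]_0)
  | n'.+1 => leb_cons (lebesgue n')
  end.

End lebesgue_measure_rowvec.

Arguments lebesgue {R n}.

Section euclidean.
Context (R : realType) (d : nat).
Implicit Types x y : 'rV[R]_d.

Definition dotp x y : R := \sum_(i < d) x ord0 i * y ord0 i.

(* not the library's `|x|, which is the sup norm *)
Definition enorm x : R := Num.sqrt (dotp x x).

Definition eball x (delta : R) : set 'rV[R]_d :=
  [set y | enorm (x - y) < delta].

End euclidean.

Section fourier.
Context (R : realType) (d : nat).
Implicit Types (f g phi : 'rV[R]_d -> R[i]) (x y xi : 'rV[R]_d).

Definition cis (theta : R) : R[i] := cos theta +i* sin theta.

Definition cintegrable f : Prop :=
  lebesgue.-integrable setT (fun x => (complex.Re (f x))%:E) /\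
  lebesgue.-integrable setT (fun x => (complex.Im (f x))%:E).

Definition cintegral f : R[i] :=
  Rintegral lebesgue setT (fun x => complex.Re (f x)) +i*
  Rintegral lebesgue setT (fun x => complex.Im (f x)).

Definition L1L2 f : Prop :=
  cintegrable f /\
  lebesgue.-integrable setT
    (fun x => (complex.Re (f x) ^+ 2 + complex.Im (f x) ^+ 2)%:E).

Definition fourier f xi : R[i] := cintegral (fun y => cis (- dotp xi y) * f y).

Definition inverse_fourier g x : R[i] :=
  ((2 * pi) ^- d)%:C * cintegral (fun xi => cis (dotp xi x) * g xi).

(* The operator with multiplier phi, on the f for which both integrals converge;
   when phi is in L^2 this holds for every f in L1L2. *)
Definition fourier_multiplier phi f : 'rV[R]_d -> R[i] :=
  inverse_fourier (fun xi => phi xi * fourier f xi).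

End fourier.

Section relativistic_kato.
Context (R : realType) (d : nat) (m alpha : R).
Implicit Types (x y : 'rV[R]_d) (p : 'rV[R]_d -> R) (V : 'rV[R]_d -> R).

(* the multiplier of L_{m,alpha} *)
Definition symbol (y : 'rV[R]_d) : R :=
  (enorm y ^+ 2 + m `^ (2 / alpha)) `^ (alpha / 2) - m.

(* e^{-tL} is, by functional calculus, the operator with multiplier e^{-t symbol} *)
Definition semigroup (t : R) : ('rV[R]_d -> R[i]) -> 'rV[R]_d -> R[i] :=
  fourier_multiplier (fun y => (expR (- t * symbol y))%:C).

(* p (x - y) is the integral kernel of e^{-tL}. As L1L2 is dense in L^2 and
   e^{-tL} is bounded, testing on L1L2 determines the operator; it determines p
   only up to a null set, and continuity selects the representative. *)
Definition is_heat_kernel (t : R) p : Prop :=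
  continuous p /\
  forall f, L1L2 f -> {ae lebesgue, forall x,
    cintegrable (fun y => (p (x - y))%:C * f y) /\
    cintegral (fun y => (p (x - y))%:C * f y) = semigroup t f x}.

(* for t > 0, the unique p such that is_heat_kernel t p *)
Definition heat_kernel (t : R) : 'rV[R]_d -> R :=
  xget (fun=> 0) [set p | is_heat_kernel t p].

(* resolvent kernel at lambda = 1; possibly +oo at x = 0 *)
Definition resolvent_kernel x : \bar R :=
  (\int[@lebesgue_measure R]_(t in `]0%R, +oo[) (expR (- t) * heat_kernel t x)%:E)%E.

Definition kato_class V : Prop :=
  ereal_sup [set (\int[lebesgue]_(y in eball x delta)
      (resolvent_kernel (x - y) * `|V y|%:E))%E | x in [set: 'rV[R]_d]]
    @[delta --> 0^'+] --> 0%E.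

(* The value of the integrand at the single point y = x, where the quotients are
   divisions by 0, is irrelevant. *)
Definition local_potential (delta : R) V x : \bar R :=
  if alpha < d%:R then
    (\int[lebesgue]_(y in eball x delta) (`|V y| / enorm (x - y) `^ (d%:R - alpha))%:E)%E
  else if alpha == d%:R then
    (\int[lebesgue]_(y in eball x delta) (ln (1 + 1 / enorm (x - y)) * `|V y|)%:E)%E
  else
    (\int[lebesgue]_(y in eball x delta) `|V y|%:E)%E.

End relativistic_kato.

(* Main.v *)
Require Import Defs.
From mathcomp Require Import all_boot all_order all_algebra.
From mathcomp Require Import all_classical all_reals all_analysis.
From mathcomp Require Import measurable_realfun.
From mathcomp Require Import complex ring lra.

Set Implicit Arguments.
Unset Strict Implicit.
Unset Printing Implicit Defensive.

Import Order.TTheory GRing.Theory Num.Theory numFieldNormedType.Exports.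
Local Open Scope classical_set_scope.
Local Open Scope ring_scope.

(** Two-sided bounds for the heat kernel p_t in short time, integrated in t, show
    that near the origin the resolvent kernel is comparable to the kernel K of the
    local potential (|x|^(alpha-d), log(1 + 1/|x|) or 1); the two local integrals are
    then comparable uniformly in x.

    The kernel is identified as the inverse Fourier transform of exp(-t psi), psi
    being the symbol. From the exponential decay of exp(-t psi) one gets
    p_t <= C t^(-d/alpha), and a lower bound c t^(-d/alpha) on |x| <= A t^(1/alpha)
    follows from 1 - cos u <= u^2/2. The bound 0 <= |x|^d p_t(x) <= C comes from
    subordination: exp(-t psi) is a pointwise limit of positive combinations of
    Gaussians exp(-s|.|^2), whose transforms satisfy it with a constant
    independent of s. *)

(** * Lebesgue integration on row vectors *)

(** The bound |x|^d p_t(x) <= C is weaker than the true decay in x but has the right order: over the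
    times t <= |x|^alpha it integrates to |x|^(alpha-d), which is what the times near |x|^alpha
    contribute anyway. For Gaussians it is invariant under scaling, so one constant serves all of
    them and survives positive combinations and limits. This is why subordination takes the form of
    a closure property instead of an integral against a law on the half-line: exp(-t l^b), with l =
    |v|^2 + m^(2/alpha) and b = alpha/2, is reached from the Poisson exponents c (1 - exp(-s l)) by
    products and pointwise limits. The mass m costs a factor exp(t m), bounded for t <= 1; for t >=
    1 the nonnegativity of the symbol takes over.

    The heat kernel is a choice among continuous functions satisfying an almost everywhere identity,
    so both existence and uniqueness have to be proved before any estimate applies to it. The
    resolvent kernel is handled without a measurability statement: integrals against it are compared
    by monotonicity. *)

Section rowvec_integral.
Context {R : realType}.
Local Notation mu := (@lebesgue_measure R).

Lemma measurable_dotp d (n : nat) (T : measurableType d) (f g : T -> 'rV[R]_n) :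
  measurable_fun setT f -> measurable_fun setT g ->
  measurable_fun setT (fun x => dotp (f x) (g x)).
Proof.
move=> mf mg; rewrite /dotp; apply: measurable_sum => i.
apply: measurable_funM.
- exact: (measurableT_comp (measurable_coord i) mf).
- exact: (measurableT_comp (measurable_coord i) mg).
Qed.

Lemma measurable_enorm d (n : nat) (T : measurableType d) (f : T -> 'rV[R]_n) :
  measurable_fun setT f -> measurable_fun setT (fun x => enorm (f x)).
Proof.
move=> mf; apply: (@measurableT_comp _ _ _ _ _ _ (@Num.sqrt R)).
  by apply: continuous_measurable_fun; exact: sqrt_continuous.
exact: measurable_dotp.
Qed.

Lemma measurable_rowB d (n : nat) (T : measurableType d) (f g : T -> 'rV[R]_n) :
  measurable_fun setT f -> measurable_fun setT g ->
  measurable_fun setT (fun x => f x - g x).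
Proof.
move=> mf mg; apply: measurable_fun_coordP => i.
under eq_fun do rewrite !mxE.
apply: measurable_funB.
- exact: (measurableT_comp (measurable_coord i) mf).
- exact: (measurableT_comp (measurable_coord i) mg).
Qed.

Lemma measurable_eball n (x : 'rV[R]_n) r : measurable (eball x r).
Proof.
have -> : eball x r = (fun y => enorm (x - y)) @^-1` `]-oo, r[.
  by apply/seteqP; split => y; rewrite /eball/= in_itv.
rewrite -[X in measurable X]setTI.
apply: (measurable_enorm (measurable_rowB (measurable_cst _) _)) => //.
Qed.

Lemma row_cons0 n (p : measurableTypeR R * 'rV[R]_n) : row_cons p ord0 ord0 = p.1.
Proof. exact: (congr1 fst (row_consK p)). Qed.

Lemma row_consS n (p : measurableTypeR R * 'rV[R]_n) i :
  row_cons p ord0 (lift ord0 i) = p.2 ord0 i.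
Proof.
by rewrite -[in RHS](row_consK p) /= mxE.
Qed.

Lemma dotp_row_cons n (p q : measurableTypeR R * 'rV[R]_n) :
  dotp (row_cons p) (row_cons q) = p.1 * q.1 + dotp p.2 q.2.
Proof.
rewrite /dotp big_ord_recl !row_cons0; congr (_ + _).
by apply: eq_bigr => i _; rewrite !row_consS.
Qed.

Lemma row_unconsK n : cancel (@row_uncons R n) (@row_cons R n).
Proof.
move=> v; apply/rowP => i; case: (unliftP ord0 i) => [j ->|->].
  by rewrite row_consS mxE.
by rewrite row_cons0.
Qed.

(** In dimension n+1 the Lebesgue measure is by construction the image of a product, so this is
    Tonelli after a change of variables. It and its signed version [integral_rowS] reduce the
    multidimensional integrals below to one variable at a time. *)
Lemma ge0_integral_rowS n (f : 'rV[R]_n.+1 -> \bar R) :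
  measurable_fun setT f -> (forall v, 0 <= f v)%E ->
  (\int[lebesgue]_v f v = \int[mu]_x \int[lebesgue]_v f (row_cons (x, v)))%E.
Proof.
move=> mf f0.
have mrc := @measurable_row_cons R n.
transitivity (\int[pushforward (mu \x lebesgue)%E (@row_cons R n)]_v f v)%E.
  exact: eq_measure_integral.
rewrite ge0_integral_pushforward//.
rewrite preimage_setT fubini_tonelli1//; first exact: measurableT_comp.
by move=> p /=.
Qed.

Lemma integrable_rowS n (f : 'rV[R]_n.+1 -> \bar R) :
  (@lebesgue R n.+1).-integrable setT f ->
  (mu \x @lebesgue R n)%E.-integrable setT (f \o @row_cons R n).
Proof.
have mrc := @measurable_row_cons R n.
move=> /integrableP[mf If]; apply/integrableP; split.
  exact: measurableT_comp.
rewrite fubini_tonelli1//; last exact/measurableT_comp/measurableT_comp.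
by have := If; rewrite ge0_integral_rowS//; exact: measurableT_comp.
Qed.

Lemma integral_rowS n (f : 'rV[R]_n.+1 -> \bar R) :
  (@lebesgue R n.+1).-integrable setT f ->
  (\int[lebesgue]_v f v = \int[mu]_x \int[lebesgue]_v f (row_cons (x, v)))%E.
Proof.
move=> If; have mrc := @measurable_row_cons R n.
transitivity (\int[pushforward (mu \x lebesgue)%E (@row_cons R n)]_v f v)%E.
  exact: eq_measure_integral.
rewrite integral_pushforward//; last 2 first.
  by case/integrableP : If.
  by rewrite preimage_setT; exact: integrable_rowS.
rewrite preimage_setT -integral12_prod_meas1//.
exact: integrable_rowS.
Qed.

(** Serves for the volumes of cubes and for the integral of the product weight [cauchy_weight]. *)
Lemma ge0_integral_prod n (f : 'I_n -> R -> R) (c : 'I_n -> R) :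
  (forall i, measurable_fun setT (f i)) -> (forall i x, 0 <= f i x) ->
  (forall i, \int[mu]_x (f i x)%:E = (c i)%:E)%E ->
  (\int[lebesgue]_v (\prod_(i < n) f i (v ord0 i))%:E = (\prod_(i < n) c i)%:E)%E.
Proof.
move=> mf f0 fc.
have m_prod k (g : 'I_k -> R -> R) : (forall i, measurable_fun setT (g i)) ->
  measurable_fun setT (fun v : 'rV[R]_k => \prod_(i < k) g i (v ord0 i)).
  move=> mg; apply: measurable_prod => i _.
  exact: (measurableT_comp (mg i) (measurable_coord i)).
elim: n f c mf f0 fc => [|n IH] f c mf f0 fc.
  under eq_integral do rewrite big_ord0.
  by rewrite big_ord0 integral_dirac// diracT mul1e.
rewrite ge0_integral_rowS//; last 2 first.
  by apply/measurable_EFinP; exact: m_prod.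
  by move=> v; rewrite lee_fin prodr_ge0.
under eq_integral => x _.
  under eq_integral => v _.
    rewrite big_ord_recl row_cons0 EFinM.
    under eq_bigr do rewrite row_consS.
    over.
  rewrite /= ge0_integralZl//; last 3 first.
    apply/measurable_EFinP.
    exact: (m_prod _ (fun i => f (lift ord0 i))).
    by move=> v _; rewrite lee_fin prodr_ge0.
    by rewrite lee_fin.
  rewrite (IH (fun i => f (lift ord0 i)) (fun i => c (lift ord0 i)))//.
  over.
rewrite /= ge0_integralZr//=; last 3 first.
  by apply/measurable_EFinP; exact: mf.
  by move=> x _; rewrite lee_fin.
  rewrite lee_fin prodr_ge0// => i _; rewrite -lee_fin -fc.
  by apply: integral_ge0 => x _; rewrite lee_fin.
by rewrite fc big_ord_recl EFinM.
Qed.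

Lemma integral_indic_itv (a b : R) : a < b ->
  (\int[mu]_x (\1_(`]a, b[%classic : set R) x)%:E = (b - a)%:E)%E.
Proof.
move=> ab.
have mI : measurable (`]a, b[%classic : set (measurableTypeR R)) by exact: measurable_itv.
rewrite integral_indic// setIT.
by have := lebesgue_measure_itv `]a, b[; rewrite /= lte_fin ab => h; exact: h.
Qed.

Lemma ge0_integral_opp (f : R -> \bar R) :
  measurable_fun setT f -> (forall x, 0 <= f x)%E ->
  (\int[mu]_x f (- x)%R = \int[mu]_x f x)%E.
Proof.
move=> mf f0.
have mN : measurable_fun setT (-%R : measurableTypeR R -> measurableTypeR R).
  by apply: continuous_measurable_fun; exact: opp_continuous.
transitivity (\int[pushforward mu (-%R : measurableTypeR R -> measurableTypeR R)]_x f x)%E.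
  by rewrite ge0_integral_pushforward// preimage_setT.
by apply: eq_measure_integral => A mA _; exact: lebesgue_measureN.
Qed.

(** Reflects the positive and the negative part separately. Its use is that odd integrands have
    integral zero. *)
Lemma integral_opp (f : R -> \bar R) : measurable_fun setT f ->
  (\int[mu]_x f (- x)%R = \int[mu]_x f x)%E.
Proof.
move=> mf; rewrite integralE [RHS]integralE; congr (_ - _)%E.
- have h := ge0_integral_opp (measurable_funepos mf) (funepos_ge0 f).
  by rewrite -h; apply: eq_integral => v _; rewrite !funeposE.
- have h := ge0_integral_opp (measurable_funeneg mf) (funeneg_ge0 f).
  by rewrite -h; apply: eq_integral => v _; rewrite !funenegE.
Qed.

Lemma measurable_rowN n : measurable_fun setT (fun v : 'rV[R]_n => - v).
Proof.
apply: measurable_fun_coordP => i; under eq_fun do rewrite mxE.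
exact: measurable_funN (measurable_coord i).
Qed.

(** By induction on the dimension: the first coordinate is reflected on the line, the others by the
    induction hypothesis. *)
Lemma ge0_integral_rowN n (f : 'rV[R]_n -> \bar R) :
  measurable_fun setT f -> (forall v, 0 <= f v)%E ->
  (\int[lebesgue]_v f (- v)%R = \int[lebesgue]_v f v)%E.
Proof.
elim: n f => [|n IH] f mf f0.
  by apply: eq_integral => v _; congr f; apply/rowP => -[].
have mrc := @measurable_row_cons R n.
rewrite [RHS](ge0_integral_rowS mf f0).
rewrite [LHS](ge0_integral_rowS (measurableT_comp mf (@measurable_rowN _)) (fun v => f0 _)).
rewrite -[RHS]ge0_integral_opp; last 2 first.
  have := @measurable_fun_fubini_tonelli_F _ _ (measurableTypeR R) _ R lebesgue
    (f \o @row_cons R n) (measurableT_comp mf mrc) (fun p => f0 _).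
  by apply.
  by move=> x; apply: integral_ge0.
apply: eq_integral => x _.
rewrite -[RHS]IH//; last first.
  apply: (measurableT_comp mf); apply: (measurableT_comp mrc).
  exact: (@measurable_pair1 _ _ (measurableTypeR R)).
apply: eq_integral => v _; congr f.
apply/rowP => i; case: (unliftP ord0 i) => [j ->|->]; rewrite mxE.
  by rewrite !row_consS mxE.
by rewrite !row_cons0.
Qed.

Lemma integral_rowN n (f : 'rV[R]_n -> \bar R) : measurable_fun setT f ->
  (\int[lebesgue]_v f (- v)%R = \int[lebesgue]_v f v)%E.
Proof.
move=> mf; rewrite integralE [RHS]integralE; congr (_ - _)%E.
- have h := ge0_integral_rowN (measurable_funepos mf) (funepos_ge0 f).
  by rewrite -h; apply: eq_integral => v _; rewrite !funeposE.
- have h := ge0_integral_rowN (measurable_funeneg mf) (funeneg_ge0 f).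
  by rewrite -h; apply: eq_integral => v _; rewrite !funenegE.
Qed.

Lemma enorm_ge0 n (v : 'rV[R]_n) : 0 <= enorm v.
Proof. exact: sqrtr_ge0. Qed.

Lemma dotpp_ge0 n (v : 'rV[R]_n) : 0 <= dotp v v.
Proof. by apply: sumr_ge0 => i _; rewrite -expr2 sqr_ge0. Qed.

Lemma enorm_sqr n (v : 'rV[R]_n) : enorm v ^+ 2 = dotp v v.
Proof. by rewrite sqr_sqrtr// dotpp_ge0. Qed.

Lemma coord_le_enorm n (v : 'rV[R]_n) i : `|v ord0 i| <= enorm v.
Proof.
rewrite -ler_sqr ?nnegrE ?enorm_ge0// enorm_sqr real_normK ?num_real//.
rewrite /dotp (bigD1 i)//= expr2 lerDl.
by apply: sumr_ge0 => j _; rewrite -expr2 sqr_ge0.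
Qed.

Lemma enorm_le_sum n (v : 'rV[R]_n) r :
  (forall i, `|v ord0 i| <= r) -> enorm v ^+ 2 <= n%:R * r ^+ 2.
Proof.
move=> h; rewrite enorm_sqr /dotp mulr_natl.
have -> : r ^+ 2 *+ n = \sum_(i < n) r ^+ 2 by rewrite sumr_const card_ord.
apply: ler_sum => i _; rewrite -expr2 -[leLHS]real_normK ?num_real//.
by rewrite lerXn2r// nnegrE// (le_trans _ (h i)).
Qed.

(** A coordinatewise substitute for Cauchy-Schwarz: each coordinate is at most the norm, at the
    price of the factor n. *)
Lemma dotp_le n (x v : 'rV[R]_n) : `|dotp x v| <= n%:R * enorm x * enorm v.
Proof.
rewrite (le_trans (ler_norm_sum _ _ _))// -mulrA mulr_natl.
have -> : (enorm x * enorm v) *+ n = \sum_(i < n) (enorm x * enorm v).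
  by rewrite sumr_const card_ord.
by apply: ler_sum => i _; rewrite normrM ler_pM ?coord_le_enorm.
Qed.

Lemma dotp0l n (v : 'rV[R]_n) : dotp 0 v = 0.
Proof. by apply: big1 => i _; rewrite mxE mul0r. Qed.

Lemma dotpC n (x v : 'rV[R]_n) : dotp x v = dotp v x.
Proof. by apply: eq_bigr => i _; rewrite mulrC. Qed.

Lemma dotpBl n (x y v : 'rV[R]_n) : dotp (x - y) v = dotp x v - dotp y v.
Proof. by rewrite -sumrB; apply: eq_bigr => i _; rewrite !mxE mulrBl. Qed.

Lemma dotpNr n (x v : 'rV[R]_n) : dotp x (- v) = - dotp x v.
Proof. by rewrite -sumrN; apply: eq_bigr => i _; rewrite mxE mulrN. Qed.

Lemma enorm0 n : enorm (0 : 'rV[R]_n) = 0.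
Proof. by rewrite /enorm dotp0l sqrtr0. Qed.

Lemma enormN n (v : 'rV[R]_n) : enorm (- v) = enorm v.
Proof.
by congr Num.sqrt; apply: eq_bigr => i _; rewrite mxE mulrNN.
Qed.

Lemma enorm_eq0 n (v : 'rV[R]_n) : (enorm v == 0) = (v == 0).
Proof.
apply/eqP/eqP => [h|->]; last exact: enorm0.
apply/rowP => i; rewrite mxE; apply/eqP; rewrite -normr_le0 -h.
exact: coord_le_enorm.
Qed.

Lemma Rintegral_dominated_cvg d (T : measurableType d) (nu : {measure set T -> \bar R})
    (f_ : nat -> T -> R) (f g : T -> R) :
  (forall n, measurable_fun setT (f_ n)) ->
  (forall x, f_ n x @[n --> \oo] --> f x) ->
  nu.-integrable setT (EFin \o g) -> (forall n x, `|f_ n x| <= g x) ->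
  \int[nu]_x f_ n x @[n --> \oo] --> \int[nu]_x f x.
Proof.
move=> mf_ f_f ig fg.
have mf : measurable_fun setT f.
  by apply: (@measurable_fun_cvg _ _ _ _ f_) => // x _; exact: f_f.
have int_ (h : T -> R) : measurable_fun setT h -> (forall x, `|h x| <= g x) ->
    nu.-integrable setT (EFin \o h).
  move=> mh hg; apply: le_integrable ig => //; first exact/measurable_EFinP.
  by move=> x _; rewrite /= lee_fin (le_trans (hg x))// ler_norm.
have fg' x : `|f x| <= g x.
  have h : `|f_ n x| @[n --> \oo] --> `|f x| by apply: cvg_norm; exact: f_f.
  have <- := cvg_lim (@Rhausdorff R) h.
  by apply: limr_le; first (by apply/cvg_ex; exists (`|f x|)); exact: nearW.
apply: fine_cvg; rewrite fineK; last first.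
  by apply: (integrable_fin_num measurableT); exact: int_.
apply: (@dominated_cvg _ _ _ nu setT measurableT (fun n x => (f_ n x)%:E) _ (EFin \o g)) => //.
- by move=> n; exact/measurable_EFinP.
- by move=> x _; apply: cvg_EFin; [exact: nearW|exact: f_f].
- by move=> n x _; rewrite lee_fin.
Qed.

End rowvec_integral.

(** * Calculus on the real line and the one-dimensional Gaussian transform *)

Section real_line.
Context {R : realType}.
Local Notation mu := (@lebesgue_measure R).

Lemma is_derive_cst_mul (f : R -> R) (x c df : R) :
  is_derive x 1 f df -> is_derive x 1 (fun y => c * f y) (c * df).
Proof.
move=> hf; have := @is_deriveM _ _ (cst c) f x 1 0 df (is_derive_cst _ _ _) hf.
by move/is_derive_eq; apply; rewrite /= scaler0 addr0.
Qed.

Lemma is_derive_mul (f g : R -> R) (x df dg : R) :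
  is_derive x 1 f df -> is_derive x 1 g dg ->
  is_derive x 1 (fun y => f y * g y) (df * g x + f x * dg).
Proof.
move=> hf hg; have := @is_deriveM _ _ f g x 1 df dg hf hg.
by move/is_derive_eq; apply; rewrite /= addrC [g x *: _]mulrC.
Qed.

Lemma is_derive_compose (f g : R -> R) (x a b : R) :
  is_derive (g x) 1 f a -> is_derive x 1 g b ->
  is_derive x 1 (fun y => f (g y)) (a * b).
Proof. exact: is_derive1_comp. Qed.

Lemma is_derive_continuous (f : R -> R) (x df : R) :
  is_derive x 1 f df -> {for x, continuous f}.
Proof. by move=> [/derivable1_diffP/differentiable_continuous]. Qed.

Lemma FTC2_is_derive (f F : R -> R) (a b : R) : a < b ->
  (forall x, a <= x <= b -> {for x, continuous f}) ->
  (forall x, a <= x <= b -> is_derive x 1 F (f x)) ->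
  (\int[mu]_(x in `[a, b]) (f x)%:E = (F b - F a)%:E)%E.
Proof.
move=> ab cf dF.
have cF x : a <= x <= b -> {for x, continuous F}.
  by move=> /dF; exact: is_derive_continuous.
rewrite (@continuous_FTC2 _ f F)//.
- apply: continuous_in_subspaceT => x; rewrite inE/= in_itv/=; exact: cf.
- split.
  + move=> x; rewrite in_itv/= => /andP[ax xb].
    have /= [] : is_derive x 1 F (f x) by apply: dF; rewrite !ltW.
    by [].
  + by apply: cvg_at_right_filter; apply: cF; rewrite lexx ltW.
  + by apply: cvg_at_left_filter; apply: cF; rewrite lexx ltW.
- move=> x; rewrite in_itv/= => /andP[ax xb].
  rewrite derive1E; have /= [_ ->] : is_derive x 1 F (f x) by apply: dF; rewrite !ltW.
  by [].
Qed.

(** Over a symmetric interval the integral is a difference of boundary values of [F], which tends to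
    0; integrability of [f] identifies the limit with the full integral. This is the integration by
    parts behind the Gaussian transform. *)
Lemma integral_derive_eq0 (f F : R -> R) : continuous f ->
  (forall x : R, is_derive x (1 : R) F (f x)) -> mu.-integrable setT (EFin \o f) ->
  F n%:R @[n --> \oo] --> 0 -> F (- n%:R) @[n --> \oo] --> 0 ->
  \int[mu]_x f x = 0.
Proof.
move=> cf dF fi F1 F2.
(* [n.+1] keeps the interval nondegenerate, as [FTC2_is_derive] requires. *)
pose g n x : \bar R := ((f x)%:E * (\1_(`[- n.+1%:R, n.+1%:R]%classic : set R) x)%:E)%E.
have mf : measurable_fun setT f by exact: continuous_measurable_fun.
have gE n : (\int[mu]_x g n x = (F n.+1%:R - F (- n.+1%:R))%:E)%E.
  rewrite -(@FTC2_is_derive f)//; last 2 first.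
    by rewrite (@lt_trans _ _ 0)// oppr_lt0.
    by move=> x _; exact: cf.
  rewrite [RHS]integral_mkcond; apply: eq_integral => x _.
  by rewrite /g patchE indicE; case: ifPn => _; rewrite ?mule1 ?mule0.
have /cvg_lim h1 : (\int[mu]_x g n x @[n --> \oo] --> \int[mu]_x (f x)%:E)%E.
  apply: (@dominated_cvg _ _ _ mu setT measurableT g (EFin \o f)
     (abse \o (EFin \o f))) => //.
  - move=> n; apply: emeasurable_funM; first exact/measurable_EFinP.
    by apply/measurable_EFinP; exact: measurable_indic.
  - move=> x _; apply: cvg_near_cst.
    near=> n; rewrite /g indicE mem_set ?mule1// /= in_itv/= -ler_norml.
    rewrite (@le_trans _ _ n%:R)// ?ler_nat//.
    by near: n; exact: nbhs_infty_ger.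
  - exact: integrable_abse.
  - move=> n x _; rewrite /g /= lee_fin indicE.
    by case: (_ \in _); rewrite ?mulr1 ?mulr0 ?normr0.
rewrite /Rintegral -h1//.
rewrite (_ : (fun n => _) = (fun n => (F n.+1%:R - F (- n.+1%:R))%:E)); last exact/funext.
rewrite (_ : limn _ = 0%:E)//; apply/cvg_lim => //.
apply: cvg_EFin; first exact: nearW.
rewrite -[X in _ --> X](subr0 0).
apply: cvgB.
  by rewrite -(@cvg_shiftS _ (fun n => F n%:R)) in F1.
by rewrite -(@cvg_shiftS _ (fun n => F (- n%:R))) in F2.
Unshelve. all: end_near. Qed.

(** The inequality exp w >= 1 + w at w = u / N gives 1 + u <= (N + 1) exp(u / N), which is then
    raised to the power N. *)
Lemma pow_expR_le (N : nat) : exists2 C : R, 0 < C &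
  forall u : R, 0 <= u -> (1 + u) ^+ N <= C * expR u.
Proof.
exists (N.+1%:R ^+ N) => [|u u0]; first by rewrite exprn_gt0.
case: N => [|N]; first by rewrite !expr0 mul1r -expR0 ler_expR.
have h : 1 + u <= N.+2%:R * expR (u / N.+1%:R).
  have := expR_ge1Dx (u / N.+1%:R).
  have : 0 <= u / N.+1%:R by rewrite divr_ge0.
  have : u = u / N.+1%:R * N.+1%:R by rewrite divfK.
  set w := u / _ => -> w0 hw; rewrite (@le_trans _ _ (N.+2%:R * (1 + w)))//.
    rewrite -[N.+2]addn1 [_ * (1 + w)]mulrDr mulr1 lerD//.
      by rewrite natrD lerDr.
    by rewrite mulrC ler_wpM2r// ler_nat leq_addr.
  by rewrite ler_wpM2l.
have := @lerXn2r _ N.+1 _ _ _ _ h.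
rewrite exprMn -expRM_natl mulrCA divff// mulr1; apply.
  by rewrite nnegrE addr_ge0.
by rewrite nnegrE mulr_ge0// expR_ge0.
Qed.

(** With w = u^alpha one has u^2 = w^(2/alpha) <= (1 + w)^K for any integer K >= 2/alpha, so the
    claim reduces to polynomial growth in w against exp w. *)
Lemma pow_expR_powR_le (alpha : R) (N : nat) : 0 < alpha ->
  exists2 C : R, 0 < C &
  forall u : R, 0 <= u -> (1 + u ^+ 2) ^+ N * expR (- (u `^ alpha)) <= C.
Proof.
move=> a0; have [K hK] : exists K : nat, 2 / alpha <= K%:R.
  exists (Num.bound (2 / alpha)); apply/ltW.
  by have := archi_boundP (_ : 0 <= 2 / alpha); apply; rewrite divr_ge0// ltW.
have [C C0 hC] := pow_expR_le (K * N).
exists (2 ^+ N * C) => [|u u0]; first by rewrite mulr_gt0// exprn_gt0.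
rewrite expRN ler_pdivrMr ?expR_gt0// -mulrA.
have w0 : 0 <= u `^ alpha by exact: powR_ge0.
apply: (@le_trans _ _ (2 ^+ N * (1 + u `^ alpha) ^+ (K * N))); last first.
  by rewrite ler_wpM2l ?exprn_ge0// hC.
rewrite exprM -exprMn lerXn2r ?nnegrE ?addr_ge0 ?mulr_ge0 ?exprn_ge0 ?addr_ge0 ?sqr_ge0//.
have h1 : 1 <= (1 + u `^ alpha) ^+ K by rewrite exprn_ege1// lerDl.
suff : u ^+ 2 <= (1 + u `^ alpha) ^+ K by lra.
rewrite (_ : u ^+ 2 = (u `^ alpha) `^ (2 / alpha)); last first.
  by rewrite -powRrM mulrCA divff ?gt_eqF// mulr1 powR_mulrn.
apply: (@le_trans _ _ ((1 + u `^ alpha) `^ (2 / alpha))).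
  by rewrite ge0_ler_powR ?nnegrE ?divr_ge0 ?addr_ge0 ?(ltW a0)// lerDr.
by rewrite -powR_mulrn ?addr_ge0// ler_powR// lerDl.
Qed.

Lemma continuous_cauchy (r : R) : continuous (fun x : R => (1 + (r * x) ^+ 2)^-1).
Proof.
move=> x; apply: cvgV; first by rewrite gt_eqF// ltr_pwDl// sqr_ge0.
apply: cvgD; first exact: cvg_cst.
by under eq_fun do rewrite expr2; apply: cvgM;
  (apply: cvgM; [exact: cvg_cst|exact: cvg_id]).
Qed.

(** The antiderivative is arctan(r x) / r. The exact dependence on r is what later produces the
    factor t^(-n/alpha), with r = t^(1/alpha). *)
Lemma integral_cauchy : exists2 C : R, 0 < C & forall r : R, 0 < r ->
  (\int[mu]_x ((1 + (r * x) ^+ 2)^-1)%:E = (C / r)%:E)%E.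
Proof.
exists pi => [|r r0]; first exact: pi_gt0.
have dF (x : R) : is_derive x (1 : R) (fun x => r^-1 * atan (r * x)) ((1 + (r * x) ^+ 2)^-1).
  have h : is_derive x 1 (fun x => r * x) r.
    by rewrite -[X in is_derive _ _ _ X]mulr1; apply: is_derive_cst_mul.
  have := is_derive_cst_mul r^-1 (is_derive_compose (is_derive1_atan (r * x)) h).
  by move/is_derive_eq; apply; rewrite mulrCA mulVf ?mulr1// gt_eqF.
have den0 x : 0 < 1 + (r * x) ^+ 2 by rewrite ltr_pwDl// sqr_ge0.
have f0 x : 0 <= (1 + (r * x) ^+ 2)^-1 by rewrite invr_ge0 ltW.
have cf := @continuous_cauchy r.
rewrite ge0_symfun_integralT//; last by move=> x /=; rewrite mulrN sqrrN.
rewrite -set_itvcy (@ge0_continuous_FTC2y _ _ (fun x => r^-1 * atan (r * x)) _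
  (r^-1 * (pi / 2)))//.
- rewrite mulr0 atan0 mulr0 sube0 -EFinM; congr EFin.
  by field; rewrite gt_eqF.
- by apply: continuous_subspaceT.
- apply: cvgM; first exact: cvg_cst.
  apply: (cvg_comp _ _ _ (@cvgy_atan R)).
  exact: gt0_cvgMry.
- by apply: cvg_at_right_filter; exact: (is_derive_continuous (dF 0)).
- by move=> x _; rewrite derive1E; have [_ ->] := dF x.
Qed.

(** The extra factor on the left makes the bound cover y exp(-s y^2) as well, which appears on
    differentiating in the frequency. *)
Lemma gauss_le_cauchy : exists2 C : R, 0 < C & forall (s y : R), 0 < s ->
  (1 + Num.sqrt s * `|y|) * expR (- s * y ^+ 2) <=
  C * (1 + (Num.sqrt s * y) ^+ 2)^-1.
Proof.
(* Of the two powers of 1 + u^2 in this bound, one absorbs 1 + u and the other becomes the Cauchy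
   weight. *)
have [C C0 hC] := @pow_expR_powR_le 2 2 (ltr0n _ 2).
exists (2 * C) => [|s y s0]; first by rewrite mulr_gt0.
pose u := Num.sqrt s * `|y|.
have u0 : 0 <= u by rewrite mulr_ge0// sqrtr_ge0.
have u2 : u ^+ 2 = s * y ^+ 2 by rewrite exprMn sqr_sqrtr ?ltW// real_normK ?num_real.
have -> : (Num.sqrt s * y) ^+ 2 = u ^+ 2 by rewrite u2 exprMn sqr_sqrtr ?ltW.
rewrite -/u mulNr -u2 ler_pdivlMr ?ltr_pwDl ?sqr_ge0//.
have := hC _ u0; rewrite powR_mulrn// => h.
have : 1 + u <= 2 * (1 + u ^+ 2) by nra.
have E0 := expR_ge0 (- u ^+ 2); have v0 := sqr_ge0 u.
move: h E0; set E := expR _ => h E0 h2.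
apply: (@le_trans _ _ (2 * ((1 + u ^+ 2) ^+ 2 * E))); last by rewrite ler_pM2l.
move: (u ^+ 2) v0 h2 {h} => v v0 h2.
rewrite [X in X <= _](_ : _ = (1 + u) * ((1 + v) * E)); last by ring.
rewrite [X in _ <= X](_ : _ = 2 * (1 + v) * ((1 + v) * E)); last by ring.
by rewrite ler_wpM2r// mulr_ge0// addr_ge0.
Qed.

Lemma integrable_cauchy (r : R) : 0 < r ->
  mu.-integrable setT (fun x => ((1 + (r * x) ^+ 2)^-1)%:E).
Proof.
move=> r0; have [C C0 hC] := integral_cauchy.
apply/integrableP; split.
  by apply/measurable_EFinP; apply: continuous_measurable_fun; exact: continuous_cauchy.
under eq_integral => x _.
  rewrite gee0_abs; last by rewrite lee_fin invr_ge0 addr_ge0// sqr_ge0.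
  over.
by rewrite hC// ltry.
Qed.

(** The Fourier transform of a one-dimensional Gaussian; it is real because the Gaussian is even. *)
Definition gaussF (s x : R) : R := \int[mu]_y (cos (x * y) * expR (- s * y ^+ 2)).

Lemma continuous_gaussian (s : R) : continuous (fun y : R => expR (- s * y ^+ 2)).
Proof.
move=> y; apply: continuous_comp; last exact: continuous_expR.
by apply: cvgM; [exact: cvg_cst|under eq_fun do rewrite expr2; apply: cvgM; exact: cvg_id].
Qed.

Lemma continuous_scale (x : R) : continuous (fun y : R => x * y).
Proof. by move=> y; apply: cvgM; [exact: cvg_cst|exact: cvg_id]. Qed.

(** [k = 0] is for the transform itself, [k = 1] for its derivative in the frequency. *)
Lemma integrable_trig_gauss (s : R) (k : nat) (h : R -> R) : 0 < s -> (k <= 1)%N ->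
  continuous h -> (forall y, `|h y| <= 1) ->
  mu.-integrable setT (fun y => (h y * (y ^+ k * expR (- s * y ^+ 2)))%:E).
Proof.
move=> s0 k1 ch h1; have [C C0 hC] := gauss_le_cauchy.
have r0 : 0 < Num.sqrt s by rewrite sqrtr_gt0.
pose D := C * (1 + (Num.sqrt s)^-1).
have iD : mu.-integrable setT (fun x => (D * (1 + (Num.sqrt s * x) ^+ 2)^-1)%:E).
  under eq_fun do rewrite EFinM.
  by apply: integrableZl => //; exact: integrable_cauchy.
apply: le_integrable iD => //.
  apply/measurable_EFinP; apply: measurable_funM.
    exact: continuous_measurable_fun.
  apply: measurable_funM; first exact: measurable_funX.
  by apply: continuous_measurable_fun; exact: continuous_gaussian.
move=> y _; rewrite /= lee_fin 2!normrM [leRHS]normrM.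
rewrite [`|D|]ger0_norm; last by rewrite mulr_ge0 ?addr_ge0 ?invr_ge0 ?ltW.
rewrite [`|_^-1|]ger0_norm ?invr_ge0 ?addr_ge0 ?sqr_ge0//.
rewrite (ger0_norm (expR_ge0 _)).
apply: (@le_trans _ _ ((1 + (Num.sqrt s)^-1) *
    ((1 + Num.sqrt s * `|y|) * expR (- s * y ^+ 2)))); last first.
  by rewrite /D [C * _]mulrC -[leRHS]mulrA ler_wpM2l ?hC// addr_ge0// invr_ge0 ltW.
rewrite -[leLHS]mul1r !mulrA ler_wpM2r ?expR_ge0// mul1r.
apply: (@le_trans _ _ (1 * `|y ^+ k|)); first by rewrite ler_wpM2r.
rewrite mul1r; case: k k1 => [|[|//]] _.
  rewrite expr0 normr1 -[leLHS]mulr1 ler_pM ?lerDl ?invr_ge0 ?mulr_ge0 ?(ltW r0)//.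
rewrite expr1 mulrDl mul1r [in leRHS]mulrDr mulr1 mulrA mulVf ?gt_eqF// mul1r.
have := normr_ge0 y; have := mulr_ge0 (ltW r0) (normr_ge0 y).
have : 0 <= (Num.sqrt s)^-1 by rewrite invr_ge0 ltW.
lra.
Qed.

(** Differentiating under the integral sign gives minus the integral of y sin(x y) exp(-s y^2);
    integration by parts turns this back into a multiple of the transform, that is, into a linear
    differential equation. *)
Lemma is_derive_gaussF (s x : R) : 0 < s ->
  is_derive x (1 : R) (gaussF s) (- (x / (2 * s)) * gaussF s x).
Proof.
move=> s0.
pose f (x y : R) := cos (x * y) * expR (- s * y ^+ 2).
pose f1 (x y : R) := - (sin (x * y) * (y ^+ 1 * expR (- s * y ^+ 2))).
have ccos (z : R) : continuous (fun y => cos (z * y)).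
  by move=> y; apply: continuous_comp; [exact: continuous_scale|exact: continuous_cos].
have csin (z : R) : continuous (fun y => sin (z * y)).
  by move=> y; apply: continuous_comp; [exact: continuous_scale|exact: continuous_sin].
have intf z : mu.-integrable setT (EFin \o f z).
  have := @integrable_trig_gauss s 0 _ s0 isT (ccos z) (fun y => cos_max _).
  by apply: eq_integrable => // y _; rewrite /f /= expr0 mul1r.
have df (z y : R) : is_derive z (1 : R) (f ^~ y) (f1 z y).
  have h : is_derive z (1 : R) (fun z => y * z) y.
    by rewrite -[X in is_derive _ _ _ X]mulr1; apply: is_derive_cst_mul.
  have := is_derive_cst_mul (expR (- s * y ^+ 2)) (is_derive_compose (is_derive_cos (y * z)) h).
  rewrite (_ : (fun _ => _) = f ^~ y); last by apply/funext => w; rewrite /f mulrC [y * w]mulrC.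
  by move/is_derive_eq; apply; rewrite /f1 [y * z]mulrC; ring.
(* This is |y| exp(-s y^2), a majorant independent of the frequency; the factor cos 0 = 1 gives it
   the shape of [integrable_trig_gauss]. *)
pose G (y : R) := `|cos (0 * y) * (y ^+ 1 * expR (- s * y ^+ 2))|.
have iG : mu.-integrable setT (EFin \o G).
  apply: integrable_norm.
  exact: (@integrable_trig_gauss s 1 _ s0 isT (ccos 0) (fun y => cos_max _)).
have xI : `]x - 1, x + 1[%classic x by rewrite /= in_itv/=; apply/andP; split; lra.
have dfd (z y : R) : `]x - 1, x + 1[%classic z -> setT y -> derivable (f ^~ y) z 1.
  by move=> _ _; have [] := df z y.
have p1 z y : partial1of2 f z y = f1 z y.
  by rewrite partial1of2E; have [_ ->] := df z y.
have G_ub (z y : R) : `]x - 1, x + 1[%classic z -> setT y -> `|partial1of2 f z y| <= G y.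
  move=> _ _; rewrite p1 /f1 /G normrN !normrM ler_wpM2r ?mulr_ge0//.
  by rewrite mul0r cos0 normr1 sin_max.
have H1 := @differentiation_under_integral R _ _ mu f setT measurableT x _ _ xI
  (fun z _ => intf z) dfd G (fun y => normr_ge0 _) iG G_ub.
have H2 := @derivable_under_integral R _ _ mu f setT measurableT x _ _ xI
  (fun z _ => intf z) dfd G (fun y => normr_ge0 _) iG G_ub.
have if1 : mu.-integrable setT (EFin \o f1 x).
  rewrite (_ : _ \o _ = \- (fun y => (sin (x * y) * (y ^+ 1 * expR (- s * y ^+ 2)))%:E))%E; last exact/funext.
  apply: integrableN.
  exact: (@integrable_trig_gauss s 1 _ s0 isT (csin x) (fun y => sin_max _)).
have parts : \int[mu]_y (f1 x y + (x / (2 * s)) * f x y) = 0.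
  (* An antiderivative of the integrand that vanishes at both infinities. *)
  pose F (y : R) := (2 * s)^-1 * (sin (x * y) * expR (- s * y ^+ 2)).
  have F0 : F n%:R @[n --> \oo] --> 0 /\ F (- n%:R) @[n --> \oo] --> 0.
    have bnd (y : R) : `|F y| <= (2 * s)^-1 * (1 / (1 + s * y ^+ 2)).
      rewrite /F normrM ger0_norm ?invr_ge0 ?mulr_ge0 ?(ltW s0)//.
      rewrite ler_wpM2l ?invr_ge0 ?mulr_ge0 ?(ltW s0)// normrM.
      rewrite ler_pM// ?sin_max// ger0_norm ?expR_ge0// mulNr expRN.
      rewrite lef_pV2 ?posrE ?expR_gt0// ?expR_ge1Dx//.
      by rewrite ltr_pwDl// mulr_ge0 ?sqr_ge0 ?ltW.
    have lim0 : (2 * s)^-1 * (1 / (1 + s * n%:R ^+ 2)) @[n --> \oo] --> (0 : R).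
      rewrite -[X in _ --> X](mulr0 (2 * s)^-1); apply: cvgM; first exact: cvg_cst.
      rewrite -[X in _ --> X](mulr0 (s^-1)).
      (* For n > 0, [harmonic n.-1] is 1 / n, and 1 + s n^2 >= s n. *)
      apply: (@squeeze_cvgr _ _ _ _ (cst 0) (fun n => s^-1 * harmonic n.-1)).
      - near=> n; rewrite divr_ge0 ?addr_ge0 ?mulr_ge0 ?sqr_ge0 ?(ltW s0)//=.
        have n0 : (0 < n)%N by near: n; exists 1%N.
        rewrite prednK// div1r -invfM lef_pV2 ?posrE ?mulr_gt0 ?ltr_pwDl ?mulr_ge0 ?sqr_ge0 ?(ltW s0) ?ltr0n//.
        rewrite -[leLHS]add0r lerD// ler_pM2l// expr2 -natrM ler_nat leq_pmulr//.
      - by rewrite mulr0; exact: cvg_cst.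
      - apply: cvgM; first exact: cvg_cst.
        by rewrite -cvg_shiftS; exact: cvg_harmonic.
    split; apply/norm_cvg0P; apply: (squeeze_cvgr _ (cvg_cst 0) lim0).
      by apply: nearW => n; rewrite normr_ge0 bnd.
    by apply: nearW => n; rewrite normr_ge0 -[n%:R ^+ 2]sqrrN bnd.
  apply: (@integral_derive_eq0 _ F).
  - move=> y; apply: cvgD; last first.
      apply: cvgM; first exact: cvg_cst.
      by apply: cvgM; [exact: ccos|exact: continuous_gaussian].
    apply: cvgN; apply: cvgM; first exact: csin.
    apply: cvgM; first by under eq_fun do rewrite expr1; exact: cvg_id.
    exact: continuous_gaussian.
  - move=> y.
    have h z : is_derive y (1 : R) (fun y => z * y) z.
      by rewrite -[X in is_derive _ _ _ X]mulr1; apply: is_derive_cst_mul.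
    have h2 : is_derive y (1 : R) (fun y => - s * y ^+ 2) (- s * (2 * y)).
      apply: is_derive_cst_mul; under eq_fun do rewrite expr2.
      by have := is_derive_mul (is_derive_id y 1) (is_derive_id y 1); move/is_derive_eq; apply; ring.
    have := is_derive_mul (is_derive_compose (is_derive_sin (x * y)) (h x))
      (is_derive_compose (is_derive_expR _) h2).
    move/(is_derive_cst_mul (2 * s)^-1).
    move/is_derive_eq; apply; rewrite /f1 /f; field.
    by rewrite gt_eqF.
  - rewrite (_ : EFin \o _ = (EFin \o f1 x) \+ (fun y => (x / (2 * s))%:E * (EFin \o f x) y)%E); last exact/funext.
    by apply: integrableD => //; apply: integrableZl.
  - exact: F0.1.
  - exact: F0.2.
have val : \int[mu]_y f1 x y = - (x / (2 * s)) * gaussF s x.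
  move: parts; rewrite RintegralD//; last first.
    rewrite (_ : EFin \o _ = (fun y => (x / (2 * s))%:E * (EFin \o f x) y)%E); last exact/funext.
    exact: integrableZl.
  rewrite RintegralZl// => /eqP; rewrite addr_eq0 => /eqP ->.
  by rewrite mulNr.
split; first exact: H2.
rewrite -derive1E; rewrite [LHS]H1 -val.
by apply: eq_Rintegral => y _; rewrite p1.
Unshelve. all: end_near. Qed.

(** By the differential equation, the transform times exp(x^2 / (4 s)) has zero derivative. *)
Lemma gaussFE (s x : R) : 0 < s -> gaussF s x = gaussF s 0 * expR (- (x ^+ 2 / (4 * s))).
Proof.
move=> s0.
have h : forall x : R, is_derive x (1 : R) (fun x => gaussF s x * expR ((4 * s)^-1 * (x * x))) 0.
  move=> y; have h2 : is_derive y (1 : R) (fun y => (4 * s)^-1 * (y * y)) ((4 * s)^-1 * (2 * y)).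
    apply: is_derive_cst_mul.
    by have := is_derive_mul (is_derive_id y 1) (is_derive_id y 1); move/is_derive_eq; apply; ring.
  have := is_derive_mul (is_derive_gaussF y s0) (is_derive_compose (is_derive_expR _) h2).
  by move/is_derive_eq; apply; field; rewrite gt_eqF.
have := is_derive_0_is_cst x 0 h.
rewrite !mulr0 expR0 mulr1 => <-.
rewrite -mulrA -expRD (_ : _ + _ = 0) ?expR0 ?mulr1//.
by rewrite expr2 mulrC subrr.
Qed.

End real_line.

(** * Fourier transform of Gaussians *)

Section fourier_gaussian.
Context {R : realType} {n : nat}.
Local Notation mu := (@lebesgue_measure R).
Implicit Types v x : 'rV[R]_n.

(** The integrable majorant for all multipliers: being a product, it is integrated coordinate by
    coordinate, and its integral scales exactly like r^(-n). *)
Definition cauchy_weight (r : R) v : R := \prod_(i < n) (1 + (r * v ord0 i) ^+ 2)^-1.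

Lemma cauchy_weight_ge0 r v : 0 <= cauchy_weight r v.
Proof. by apply: prodr_ge0 => i _; rewrite invr_ge0 addr_ge0// sqr_ge0. Qed.

Lemma measurable_cauchy_weight r : measurable_fun setT (cauchy_weight r).
Proof.
apply: measurable_prod => i _.
apply: (@measurableT_comp _ _ _ _ _ _ (fun y : R => (1 + (r * y) ^+ 2)^-1)).
  by apply: continuous_measurable_fun; exact: continuous_cauchy.
exact: measurable_coord.
Qed.

Lemma integral_cauchy_weight : exists2 C : R, 0 < C & forall r : R, 0 < r ->
  (\int[lebesgue]_v (cauchy_weight r v)%:E = (C / r ^+ n)%:E)%E.
Proof.
have [C C0 hC] := @integral_cauchy R.
exists (C ^+ n) => [|r r0]; first by rewrite exprn_gt0.
rewrite (@ge0_integral_prod _ _ (fun _ (y : R) => (1 + (r * y) ^+ 2)^-1) (fun=> C / r)).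
- by rewrite prodr_const card_ord expr_div_n.
- by move=> _; apply: continuous_measurable_fun; exact: continuous_cauchy.
- by move=> _ x; rewrite invr_ge0 addr_ge0// sqr_ge0.
- by move=> _; exact: hC.
Qed.

Lemma integrable_cauchy_weight r : 0 < r ->
  lebesgue.-integrable setT (EFin \o cauchy_weight r).
Proof.
move=> r0; have [C C0 hC] := integral_cauchy_weight.
apply/integrableP; split; first by apply/measurable_EFinP; exact: measurable_cauchy_weight.
under eq_integral do rewrite gee0_abs ?lee_fin ?cauchy_weight_ge0//.
by rewrite hC// ltry.
Qed.

(** Trades radial decay for product decay: every factor 1 + (r v_i)^2 is at most 1 + (r |v|)^2. *)
Lemma cauchy_weight_ge r v : 0 <= r ->
  1 <= (1 + (r * enorm v) ^+ 2) ^+ n * cauchy_weight r v.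
Proof.
move=> r0; rewrite /cauchy_weight prodfV.
have P0 : 0 < \prod_(i < n) (1 + (r * v ord0 i) ^+ 2).
  by apply: prodr_gt0 => i _; rewrite ltr_pwDl// sqr_ge0.
rewrite ler_pdivlMr// mul1r.
have -> : (1 + (r * enorm v) ^+ 2) ^+ n = \prod_(i < n) (1 + (r * enorm v) ^+ 2).
  by rewrite prodr_const card_ord.
apply: ler_prod => i _; rewrite addr_ge0 ?sqr_ge0//= lerD2l.
rewrite -[leLHS]real_normK ?num_real// lerXn2r ?nnegrE ?mulr_ge0 ?enorm_ge0//.
by rewrite normrM ger0_norm// ler_wpM2l// coord_le_enorm.
Qed.

(** The exponential absorbs n + 1 powers of 1 + (r |v|)^2: n of them pay for the product weight, and
    the last one is kept on the left to control second moments. *)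
Lemma expR_powR_le_cauchy_weight (alpha : R) : 0 < alpha ->
  exists2 C : R, 0 < C & forall (r : R) v, 0 <= r ->
  (1 + (r * enorm v) ^+ 2) * expR (- ((r * enorm v) `^ alpha)) <= C * cauchy_weight r v.
Proof.
move=> a0; have [C C0 hC] := pow_expR_powR_le n.+1 a0.
exists C => // r v r0.
have u0 : 0 <= r * enorm v by rewrite mulr_ge0 ?enorm_ge0.
have := hC _ u0; have := cauchy_weight_ge v r0.
have := cauchy_weight_ge0 r v; have := expR_ge0 (- ((r * enorm v) `^ alpha)).
set u := (r * enorm v) in u0 *; set E := expR _; set W := cauchy_weight _ _.
rewrite [_ ^+ n.+1]exprS => E0 W0 h1 h2.
apply: (@le_trans _ _ ((1 + u ^+ 2) * E * ((1 + u ^+ 2) ^+ n * W))).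
  by rewrite ler_peMr// mulr_ge0// addr_ge0// sqr_ge0.
rewrite (_ : _ * _ * _ = (1 + u ^+ 2) * (1 + u ^+ 2) ^+ n * E * W); last by ring.
by rewrite ler_wpM2r.
Qed.

Lemma measurable_gauss (s : R) :
  measurable_fun setT (fun v : 'rV[R]_n => expR (- s * enorm v ^+ 2)).
Proof.
apply: (@measurableT_comp _ _ _ _ _ _ (@expR R)); first exact: measurable_expR.
by apply: measurable_funM => //; apply: measurable_funX; exact: measurable_enorm.
Qed.

Lemma integrable_gauss (s : R) : 0 < s ->
  lebesgue.-integrable setT (fun v : 'rV[R]_n => (expR (- s * enorm v ^+ 2))%:E).
Proof.
move=> s0; have [C C0 hC] := @expR_powR_le_cauchy_weight 2 (ltr0n _ 2).
have r0 : 0 < Num.sqrt s by rewrite sqrtr_gt0.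
have : lebesgue.-integrable setT (fun v => (C%:E * (cauchy_weight (Num.sqrt s) v)%:E)%E).
  by apply: integrableZl => //; exact: integrable_cauchy_weight.
apply: le_integrable => //.
  by apply/measurable_EFinP; exact: measurable_gauss.
move=> v _; rewrite -EFinM /= lee_fin !ger0_norm ?expR_ge0//; last first.
  by rewrite mulr_ge0 ?cauchy_weight_ge0 ?ltW.
apply: le_trans (hC _ v (ltW r0)).
rewrite powR_mulrn ?mulr_ge0 ?enorm_ge0 ?(ltW r0)// exprMn [Num.sqrt s ^+ 2]sqr_sqrtr ?(ltW s0)//.
by rewrite mulNr ler_peMl ?expR_ge0// lerDl mulr_ge0 ?(ltW s0)// sqr_ge0.
Qed.

Lemma integrable_bounded_gauss (s : R) (h : 'rV[R]_n -> R) (B : R) : 0 < s ->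
  measurable_fun setT h -> (forall v, `|h v| <= B) ->
  lebesgue.-integrable setT (fun v => (h v * expR (- s * enorm v ^+ 2))%:E).
Proof.
move=> s0 mh hB.
have : lebesgue.-integrable setT (fun v : 'rV[R]_n => (B%:E * (expR (- s * enorm v ^+ 2))%:E)%E).
  by apply: integrableZl => //; exact: integrable_gauss.
apply: le_integrable => //.
  by apply/measurable_EFinP; apply: measurable_funM => //; exact: measurable_gauss.
move=> v _; rewrite -EFinM /= lee_fin !normrM ler_wpM2r// (le_trans (hB v))// ler_norm//.
Qed.

Lemma measurable_cos_dotp a x : measurable_fun setT (fun v => cos (a + dotp x v)).
Proof.
apply: (@measurableT_comp _ _ _ _ _ _ (@cos R)).
  by apply: continuous_measurable_fun; exact: continuous_cos.
by apply: measurable_funD => //; exact: measurable_dotp.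
Qed.

Lemma measurable_sin_dotp a x : measurable_fun setT (fun v => sin (a + dotp x v)).
Proof.
apply: (@measurableT_comp _ _ _ _ _ _ (@sin R)).
  by apply: continuous_measurable_fun; exact: continuous_sin.
by apply: measurable_funD => //; exact: measurable_dotp.
Qed.

End fourier_gaussian.

Section fourier_gaussian_value.
Context {R : realType}.
Local Notation mu := (@lebesgue_measure R).

Lemma integrable_gauss1 (s : R) : 0 < s ->
  mu.-integrable setT (fun y : R => (expR (- s * y ^+ 2))%:E).
Proof.
move=> s0; have : mu.-integrable setT (fun y : R => (1 * (y ^+ 0 * expR (- s * y ^+ 2)))%:E).
  apply: (@integrable_trig_gauss _ s 0 (cst 1)) => //; first by move=> y; exact: cvg_cst.
  by move=> y; rewrite normr1.
by apply: eq_integrable => // y _; rewrite expr0 !mul1r.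
Qed.

(** After expanding the cosine of the sum, the sine term is odd and integrates to zero. *)
Lemma integral_cos_gauss1 (s x a : R) : 0 < s ->
  (\int[mu]_y (cos (a + x * y) * expR (- s * y ^+ 2))%:E = (cos a * gaussF s x)%:E)%E.
Proof.
move=> s0.
have ccos : continuous (fun y => cos (x * y)).
  by move=> y; apply: continuous_comp; [exact: continuous_scale|exact: continuous_cos].
have csin : continuous (fun y => sin (x * y)).
  by move=> y; apply: continuous_comp; [exact: continuous_scale|exact: continuous_sin].
have ic := @integrable_trig_gauss _ s 0 _ s0 isT ccos (fun y => cos_max _).
have is' := @integrable_trig_gauss _ s 0 _ s0 isT csin (fun y => sin_max _).
have {}ic : mu.-integrable setT (fun y => (cos (x * y) * expR (- s * y ^+ 2))%:E).
  by apply: eq_integrable ic => // y _; rewrite expr0 mul1r.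
have {}is' : mu.-integrable setT (fun y => (sin (x * y) * expR (- s * y ^+ 2))%:E).
  by apply: eq_integrable is' => // y _; rewrite expr0 mul1r.
have s_0 : (\int[mu]_y (sin (x * y) * expR (- s * y ^+ 2))%:E = 0)%E.
  have h := integral_opp (measurable_int _ is').
  have /= e : (\int[mu]_y (sin (x * - y) * expR (- s * (- y) ^+ 2))%:E =
      - \int[mu]_y (sin (x * y) * expR (- s * y ^+ 2))%:E)%E.
    rewrite -integralN; last exact: fin_num_adde_defr (integrable_pos_fin_num measurableT is').
    by apply: eq_integral => y _; rewrite sqrrN mulrN sinN mulNr.
  rewrite /= e in h.
  have f := integrable_fin_num measurableT is'.
  move: h; rewrite -(fineK f) -EFinN => -[] h.
  by congr EFin; lra.
transitivity ((cos a)%:E * \int[mu]_y (cos (x * y) * expR (- s * y ^+ 2))%:E -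
    (sin a)%:E * \int[mu]_y (sin (x * y) * expR (- s * y ^+ 2))%:E)%E.
  rewrite -!integralZl// -integralB//; [|exact: integrableZl|exact: integrableZl].
  by apply: eq_integral => y _; rewrite cosD mulrBl EFinB -!mulrA !EFinM.
rewrite s_0 mule0 sube0 EFinM; congr (_ * _)%E.
by rewrite /gaussF /Rintegral fineK//; exact: integrable_fin_num.
Qed.

(** The phase [a] carries the induction: the first coordinate is absorbed into it while the others
    are integrated out. It plays the part that complex exponentials play in the usual
    factorisation. *)
Lemma integral_cos_gauss n (s a : R) (x : 'rV[R]_n) : 0 < s ->
  (\int[lebesgue]_v (cos (a + dotp x v) * expR (- s * enorm v ^+ 2))%:E =
   (cos a * \prod_(i < n) gaussF s (x ord0 i))%:E)%E.
Proof.
move=> s0; elim: n a x => [|n IH] a x.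
  rewrite integral_dirac//; last first.
    by apply/measurable_EFinP; apply: measurable_funM;
      [exact: measurable_cos_dotp|exact: measurable_gauss].
  by rewrite diracT mul1e dotpC dotp0l enorm0 expr0n mulr0 expR0 addr0 big_ord0.
rewrite integral_rowS; last first.
  apply: (@integrable_bounded_gauss _ _ _ _ 1) => //; first exact: measurable_cos_dotp.
  by move=> v; exact: cos_max.
rewrite -(row_unconsK x) /row_uncons.
set x0 := x ord0 ord0; set x' := \row_i _.
under eq_integral => y _.
  under eq_integral => v _.
    rewrite dotp_row_cons enorm_sqr dotp_row_cons /= -enorm_sqr.
    rewrite addrA -expr2 mulrDr expRD mulrCA EFinM.
    over.
  rewrite /= integralZl//; last first.
    apply: (@integrable_bounded_gauss _ _ _ _ 1) => //; first exact: measurable_cos_dotp.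
    by move=> v; exact: cos_max.
  rewrite IH -EFinM mulrA [expR _ * _]mulrC EFinM.
  over.
rewrite /= integralZr//; last first.
  have := integrable_gauss1 s0.
  apply: le_integrable => //.
  - apply/measurable_EFinP/measurable_funM; last first.
      by apply: continuous_measurable_fun; exact: continuous_gaussian.
    apply: continuous_measurable_fun => y; apply: continuous_comp; last exact: continuous_cos.
    by apply: cvgD; [exact: cvg_cst|exact: continuous_scale].
  - by move=> y _; rewrite /= lee_fin normrM ler_piMl ?cos_max.
rewrite integral_cos_gauss1// -EFinM -mulrA; congr (_ * _)%:E.
rewrite big_ord_recl row_cons0; congr (_ * _).
by apply: eq_bigr => i _; rewrite row_consS.
Qed.

Lemma gaussF0_bound : exists2 C : R, 0 < C &
  forall s : R, 0 < s -> 0 <= gaussF s 0 <= C / Num.sqrt s.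
Proof.
have [C C0 hC] := @gauss_le_cauchy R; have [K K0 hK] := @integral_cauchy R.
exists (C * K) => [|s s0]; first by rewrite mulr_gt0.
have r0 : 0 < Num.sqrt s by rewrite sqrtr_gt0.
apply/andP; split.
  by apply: Rintegral_ge0 => y _; rewrite mul0r cos0 mul1r expR_ge0.
have -> : C * K / Num.sqrt s = \int[mu]_y (C * (1 + (Num.sqrt s * y) ^+ 2)^-1).
  rewrite RintegralZl//; last exact: integrable_cauchy.
  by rewrite /Rintegral hK//= mulrA.
apply: le_Rintegral => //.
- apply: eq_integrable (integrable_gauss1 s0) => // y _.
  by rewrite /= mul0r cos0 mul1r.
- rewrite (_ : EFin \o _ = (fun y => (C%:E * ((1 + (Num.sqrt s * y) ^+ 2)^-1)%:E)%E)); last exact/funext.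
  by apply: integrableZl => //; exact: integrable_cauchy.
- move=> y _; apply: le_trans (hC s y s0); rewrite mul0r cos0 mul1r.
  by rewrite ler_peMl ?expR_ge0// lerDl mulr_ge0// ltW.
Qed.

(** The transform is at most a constant times s^(-n/2) exp(-u^2) with u = |x| / (2 sqrt s). As |x|^n
    s^(-n/2) = (2 u)^n, the parameter s disappears and the exponential absorbs the power of u. *)
Lemma fourier_gauss_bound n : exists2 C : R, 0 < C &
  forall (s : R) (x : 'rV[R]_n), 0 < s ->
  0 <= \int[lebesgue]_v (cos (dotp x v) * expR (- s * enorm v ^+ 2)) /\
  enorm x ^+ n * \int[lebesgue]_v (cos (dotp x v) * expR (- s * enorm v ^+ 2)) <= C.
Proof.
have [C C0 hC] := gaussF0_bound.
have [K K0 hK] := pow_expR_powR_le n (ltr0n R 2).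
exists ((2 * C) ^+ n * K) => [|s x s0]; first by rewrite mulr_gt0// exprn_gt0// mulr_gt0.
have [g0 gC] := andP (hC s s0).
have r0 : 0 < Num.sqrt s by rewrite sqrtr_gt0.
have -> : \int[lebesgue]_v (cos (dotp x v) * expR (- s * enorm v ^+ 2)) =
    gaussF s 0 ^+ n * expR (- (enorm x / (2 * Num.sqrt s)) ^+ 2).
  rewrite /Rintegral; under eq_integral do rewrite -[dotp _ _]add0r.
  rewrite integral_cos_gauss//= cos0 mul1r.
  under eq_bigr do rewrite gaussFE//.
  rewrite big_split/= prodr_const card_ord; congr (_ * _).
  rewrite -expR_sum sumrN -mulr_suml expr_div_n enorm_sqr exprMn sqr_sqrtr ?ltW//.
  congr (expR (- (_ / _))); last by rewrite expr2 -natrM.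
split; first by rewrite mulr_ge0 ?expR_ge0 ?exprn_ge0.
set u := enorm x / (2 * Num.sqrt s).
have u0 : 0 <= u by rewrite divr_ge0 ?enorm_ge0// mulr_ge0 ?ltW.
have xu : enorm x = u * (2 * Num.sqrt s) by rewrite divfK// gt_eqF// mulr_gt0.
rewrite mulrA -exprMn.
have := hK u u0; rewrite powR_mulrn// => hu.
apply: (@le_trans _ _ ((2 * C) ^+ n * ((1 + u ^+ 2) ^+ n * expR (- u ^+ 2)))); last first.
  by rewrite ler_wpM2l// exprn_ge0// mulr_ge0// ltW.
rewrite [leRHS]mulrA -exprMn ler_wpM2r ?expR_ge0// lerXn2r ?nnegrE ?mulr_ge0 ?enorm_ge0 ?addr_ge0 ?sqr_ge0 ?(ltW C0)//.
have uu : u <= 1 + u ^+ 2 by nra.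
rewrite xu; apply: (@le_trans _ _ (u * (2 * C))).
  rewrite -mulrA ler_wpM2l// -mulrA ler_wpM2l// mulrC.
  by rewrite -ler_pdivlMr.
by rewrite mulrC ler_wpM2l// mulr_ge0// ltW.
Qed.

End fourier_gaussian_value.

(** * Mixtures of Gaussians *)

Lemma cvg_seq_expR (R : realType) (u : nat -> R) (l : R) :
  u k @[k --> \oo] --> l -> expR (u k) @[k --> \oo] --> expR l.
Proof. by move=> ul; exact: (cvg_comp _ _ ul (@continuous_expR R l)). Qed.

Section gauss_mixture.
Context {R : realType} {n : nat}.
Implicit Types f g h : 'rV[R]_n -> R.

(** Stands for the mixtures of exp(-s |v|^2) against a finite measure in s; the limit clause
    replaces integration against that measure. The value s = 0 brings in the nonnegative
    constants. *)
Inductive gauss_mixture : ('rV[R]_n -> R) -> Prop :=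
| gauss_mixture_gauss s : 0 <= s -> gauss_mixture (fun v => expR (- s * enorm v ^+ 2))
| gauss_mixtureD f g : gauss_mixture f -> gauss_mixture g ->
    gauss_mixture (fun v => f v + g v)
| gauss_mixtureZ c f : 0 <= c -> gauss_mixture f -> gauss_mixture (fun v => c * f v)
| gauss_mixture_lim (f_ : nat -> 'rV[R]_n -> R) f : (forall k, gauss_mixture (f_ k)) ->
    (forall v, f_ k v @[k --> \oo] --> f v) -> gauss_mixture f.

(** Makes pointwise limits dominated: if f_k(0) converges, the f_k are uniformly bounded. *)
Lemma gauss_mixture_bound f : gauss_mixture f -> forall v, 0 <= f v <= f 0.
Proof.
elim=> {f} [s s0|f g _ IHf _ IHg|c f c0 _ IHf|f_ f _ IH f_f] v.
- rewrite enorm0 expr0n mulr0 expR0 expR_ge0 -expR0 ler_expR.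
  by rewrite mulNr oppr_le0 mulr_ge0// sqr_ge0.
- by have := IHf v; have := IHg v; move=> /andP[? ?] /andP[? ?]; rewrite addr_ge0//= lerD.
- by have /andP[? ?] := IHf v; rewrite mulr_ge0//= ler_wpM2l.
- apply/andP; split.
    rewrite -(cvg_lim (@Rhausdorff R) (f_f v)); apply: limr_ge.
      by apply/cvg_ex; exists (f v).
    by apply: nearW => k; have /andP[] := IH k v.
  rewrite -(cvg_lim (@Rhausdorff R) (f_f v)) -(cvg_lim (@Rhausdorff R) (f_f 0)).
  apply: ler_lim; [by apply/cvg_ex; exists (f v)|by apply/cvg_ex; exists (f 0)|].
  by apply: nearW => k; have /andP[] := IH k v.
Qed.

Lemma measurable_gauss_mixture f : gauss_mixture f -> measurable_fun setT f.
Proof.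
elim=> {f} [s s0|f g _ IHf _ IHg|c f c0 _ IHf|f_ f _ IH f_f].
- exact: measurable_gauss.
- exact: measurable_funD.
- exact: measurable_funM.
- by apply: (@measurable_fun_cvg _ _ _ _ f_) => // x _; exact: f_f.
Qed.

Lemma gauss_mixture_ext f g : gauss_mixture f -> f =1 g -> gauss_mixture g.
Proof. by move=> mf fg; rewrite -(funext fg). Qed.

Lemma gauss_mixture_cst c : 0 <= c -> gauss_mixture (fun=> c).
Proof.
move=> c0; have := gauss_mixtureZ c0 (gauss_mixture_gauss (lexx 0)).
by move/gauss_mixture_ext; apply => v; rewrite oppr0 mul0r expR0 mulr1.
Qed.

(** Two nested inductions reduce to a product of two Gaussians, whose parameters add. *)
Lemma gauss_mixtureM f g : gauss_mixture f -> gauss_mixture g ->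
  gauss_mixture (fun v => f v * g v).
Proof.
move=> mf; elim=> {g} [s s0|g h _ IHg _ IHh|c g c0 _ IHg|g_ g _ IH g_g].
- elim: mf => {f} [t t0|f g _ IHf _ IHg|c f c0 _ IHf|f_ f _ IH f_f].
  + apply: (gauss_mixture_ext (gauss_mixture_gauss (addr_ge0 t0 s0))) => v.
    by rewrite -expRD opprD mulrDl.
  + by apply: (gauss_mixture_ext (gauss_mixtureD IHf IHg)) => v; rewrite mulrDl.
  + by apply: (gauss_mixture_ext (gauss_mixtureZ c0 IHf)) => v; rewrite mulrA.
  + by apply: (gauss_mixture_lim IH) => v; apply: cvgM; [exact: f_f|exact: cvg_cst].
- by apply: (gauss_mixture_ext (gauss_mixtureD IHg IHh)) => v; rewrite mulrDr.
- by apply: (gauss_mixture_ext (gauss_mixtureZ c0 IHg)) => v; rewrite mulrCA.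
- by apply: (gauss_mixture_lim IH) => v; apply: cvgM; [exact: cvg_cst|exact: g_g].
Qed.

(** The exponential series has nonnegative coefficients, so its partial sums are mixtures. *)
Lemma gauss_mixture_expR f : gauss_mixture f -> gauss_mixture (fun v => expR (f v)).
Proof.
move=> mf; apply: (@gauss_mixture_lim (fun k v => series (exp_coeff (f v)) k)).
  elim=> [|k IH].
    apply: (gauss_mixture_ext (gauss_mixture_cst (lexx 0))) => v.
    by rewrite /series/= big_geq.
  have mX : gauss_mixture (fun v => f v ^+ k).
    elim: k {IH} => [|k IH]; first exact: gauss_mixture_cst.
    by apply: (gauss_mixture_ext (gauss_mixtureM mf IH)) => v; rewrite exprS.
  have k0 : 0 <= (k`!%:R^-1 : R) by rewrite invr_ge0.
  apply: (gauss_mixture_ext (gauss_mixtureD IH (gauss_mixtureZ k0 mX))) => v.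
  by rewrite /series/= big_nat_recr//= /exp_coeff/= [in RHS]mulrC.
by move=> v; exact: is_cvg_series_exp_coeff.
Qed.

(** The Laplace exponent of a Poisson process with jumps of size s: the function is exp(-c) times
    the exponential of a multiple of a Gaussian. *)
Lemma gauss_mixture_poisson (c s M : R) : 0 <= c -> 0 <= s ->
  gauss_mixture (fun v => expR (- (c * (1 - expR (- s * (enorm v ^+ 2 + M)))))).
Proof.
move=> c0 s0.
have h0 : 0 <= c * expR (- s * M) by rewrite mulr_ge0// expR_ge0.
have := gauss_mixture_expR (gauss_mixtureZ h0 (gauss_mixture_gauss s0)).
move/(gauss_mixtureZ (expR_ge0 (- c))); move/gauss_mixture_ext; apply => v.
rewrite -expRD; congr expR; rewrite -mulrA -expRD mulrDr [X in expR X]addrC.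
by rewrite -[- s * _ + _]mulrDr; ring.
Qed.

(** A mixture need not be integrable, hence the Gaussian regulariser, which also keeps the parameter
    s + e positive when s = 0. Both inequalities are linear in f, with a constant valid for every
    Gaussian, so they pass through sums, multiples and dominated limits. *)
Lemma gauss_mixture_fourier : exists2 C : R, 0 < C &
  forall f, gauss_mixture f -> forall (e : R) (x : 'rV[R]_n), 0 < e ->
  0 <= \int[lebesgue]_v (cos (dotp x v) * f v * expR (- e * enorm v ^+ 2)) /\
  enorm x ^+ n * \int[lebesgue]_v (cos (dotp x v) * f v * expR (- e * enorm v ^+ 2))
    <= C * f 0.
Proof.
have [C C0 hC] := @fourier_gauss_bound R n.
exists C => // f mf e x e0.
have mcos : measurable_fun setT (fun v => cos (dotp x v)).
  by have := @measurable_cos_dotp R n 0 x; under eq_fun do rewrite add0r.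
have int_ g : gauss_mixture g ->
    lebesgue.-integrable setT (EFin \o (fun v => cos (dotp x v) * g v * expR (- e * enorm v ^+ 2))).
  move=> mg; apply: (@integrable_bounded_gauss _ _ _ (fun v => cos (dotp x v) * g v) (g 0)) => //.
    by apply: measurable_funM => //; exact: measurable_gauss_mixture.
  move=> v; rewrite normrM -[leRHS]mul1r ler_pM ?cos_max//.
  by have /andP[g0 gle] := gauss_mixture_bound mg v; rewrite ger0_norm.
elim: mf => {f} [s s0|f g mf [IHf IHf'] mg [IHg IHg']|c f c0 mf [IHf IHf']|f_ f mf_ IH f_f].
- have se : 0 < s + e by rewrite ltr_wpDl.
  have [h1 h2] := hC _ x se.
  under eq_Rintegral do rewrite -mulrA -expRD -mulrDl -opprD.
  by split => //; rewrite enorm0 expr0n mulr0 expR0 mulr1.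
- have -> : \int[lebesgue]_v (cos (dotp x v) * (f v + g v) * expR (- e * enorm v ^+ 2)) =
     \int[lebesgue]_v (cos (dotp x v) * f v * expR (- e * enorm v ^+ 2)) +
     \int[lebesgue]_v (cos (dotp x v) * g v * expR (- e * enorm v ^+ 2)).
    rewrite -RintegralD//; [|exact: int_|exact: int_].
    by apply: eq_Rintegral => v _; rewrite mulrDr mulrDl.
  by split; [exact: addr_ge0|rewrite !mulrDr lerD].
- have -> : \int[lebesgue]_v (cos (dotp x v) * (c * f v) * expR (- e * enorm v ^+ 2)) =
     c * \int[lebesgue]_v (cos (dotp x v) * f v * expR (- e * enorm v ^+ 2)).
    rewrite -RintegralZl//; last exact: int_.
    by apply: eq_Rintegral => v _; rewrite mulrCA !mulrA.
  by split; [exact: mulr_ge0|rewrite mulrCA [leRHS]mulrCA ler_wpM2l].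
- have [B hB] : exists B, forall k, f_ k 0 <= B.
    have [B [_ hB]] := cvg_seq_bounded (cvgP _ (f_f 0)).
    exists (B + 1) => k; rewrite (le_trans (ler_norm _))//.
    by apply: hB => //; rewrite ltrDl.
  have lim : \int[lebesgue]_v (cos (dotp x v) * f_ k v * expR (- e * enorm v ^+ 2)) @[k --> \oo] -->
      \int[lebesgue]_v (cos (dotp x v) * f v * expR (- e * enorm v ^+ 2)).
    apply: (@Rintegral_dominated_cvg _ _ _ _ _ _ (fun v => B * expR (- e * enorm v ^+ 2))).
    + move=> k; apply: measurable_funM; last exact: measurable_gauss.
      by apply: measurable_funM => //; exact: measurable_gauss_mixture.
    + by move=> v; apply: cvgM; [apply: cvgM; [exact: cvg_cst|exact: f_f]|exact: cvg_cst].
    + apply: (@integrable_bounded_gauss _ _ _ (fun=> B) `|B|) => //.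
    + move=> k v; rewrite !normrM (ger0_norm (expR_ge0 _)) ler_wpM2r ?expR_ge0//.
      rewrite -[leRHS]mul1r ler_pM ?cos_max//.
      have /andP[g0 gle] := gauss_mixture_bound (mf_ k) v; rewrite ger0_norm//.
      by rewrite (le_trans gle).
  split.
    rewrite -(cvg_lim (@Rhausdorff R) lim); apply: limr_ge; first exact: (cvgP _ lim).
    by apply: nearW => k; have [] := IH k.
  have lim1 : enorm x ^+ n * \int[lebesgue]_v (cos (dotp x v) * f_ k v * expR (- e * enorm v ^+ 2))
      @[k --> \oo] --> enorm x ^+ n *
      \int[lebesgue]_v (cos (dotp x v) * f v * expR (- e * enorm v ^+ 2)).
    by apply: cvgM; [exact: cvg_cst|exact: lim].
  have lim2 : C * f_ k 0 @[k --> \oo] --> C * f 0.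
    by apply: cvgM; [exact: cvg_cst|exact: f_f].
  have /= := cvg_lim (@Rhausdorff R) lim1; have /= := cvg_lim (@Rhausdorff R) lim2.
  move=> <- <-; apply: ler_lim; [exact: (cvgP _ lim1)|exact: (cvgP _ lim2)|].
  by apply: nearW => k; have [] := IH k.
Qed.

End gauss_mixture.

(* Discretising the Levy integral of [l `^ b] along a geometric progression of
   ratio [expR h] gives a function which is exactly homogeneous for scalings by
   [expR h]; being monotone, it is then squeezed onto [l `^ b] as [h] tends to 0. *)
Section power_as_bernstein_limit.
Context {R : realType} (b : R).
Hypotheses (b0 : 0 < b) (b1 : b < 1).

(** With s = exp tau this is s^(-b) (1 - exp(-s l)): the integrand of the Levy formula for l^b in
    the variable tau = log s, where s^(-b-1) ds = s^(-b) d tau. *)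
Definition jump (tau l : R) : R := expR (- (tau * b)) * (1 - expR (- expR tau * l)).

(** The nodes are j h for -K <= j < K. The mesh factor h is left out, since only ratios of these
    sums are used. *)
Definition jump_sum (h : R) (K : nat) (l : R) : R :=
  \sum_(0 <= k < K) (jump (k%:R * h) l + jump (- (k.+1%:R * h)) l).

Lemma jump_sumS h K l : jump_sum h K.+1 l =
  jump_sum h K l + (jump (K%:R * h) l + jump (- (K.+1%:R * h)) l).
Proof. by rewrite /jump_sum big_nat_recr. Qed.

Lemma jump_ge0 tau l : 0 <= l -> 0 <= jump tau l.
Proof.
move=> l0; rewrite mulr_ge0 ?expR_ge0// subr_ge0 -expR0 ler_expR mulNr oppr_le0.
by rewrite mulr_ge0 ?expR_ge0.
Qed.

Lemma jump_mono tau l l' : l <= l' -> jump tau l <= jump tau l'.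
Proof.
move=> ll; rewrite ler_wpM2l ?expR_ge0// lerD2l lerN2 ler_expR !mulNr lerN2.
by rewrite ler_wpM2l ?expR_ge0.
Qed.

Lemma jump_scale tau h l : jump tau (expR h * l) = expR (h * b) * jump (tau + h) l.
Proof.
rewrite /jump (_ : expR (- (tau * b)) = expR (h * b) * expR (- ((tau + h) * b))).
  by rewrite [expR (tau + h)]expRD -!mulrA !mulNr !mulrA.
by rewrite -expRD; congr expR; ring.
Qed.

Lemma jump_le1 tau l : jump tau l <= expR (- (tau * b)).
Proof. by rewrite ler_piMr ?expR_ge0// gerBl expR_ge0. Qed.

Lemma jump_le_linear tau l : jump tau l <= l * expR (tau * (1 - b)).
Proof.
have -> : l * expR (tau * (1 - b)) = expR (- (tau * b)) * (expR tau * l).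
  by rewrite [RHS]mulrA -expRD [RHS]mulrC; congr (_ * expR _); ring.
rewrite ler_wpM2l ?expR_ge0//.
have := expR_ge1Dx (- expR tau * l); rewrite mulNr; lra.
Qed.

(** Both tails are dominated by geometric series: nodes going to +oo because b > 0, nodes going to
    -oo because b < 1. *)
Lemma cvg_jump_sum h l : 0 < h -> 0 <= l -> cvgn (jump_sum h ^~ l).
Proof.
move=> h0 l0.
have geo (q : R) : 0 < q -> cvgn (series (fun k => expR (- q) ^+ k)).
  move=> q0; have e1 : `|expR (- q)| < 1.
    by rewrite ger0_norm ?expR_ge0// -[ltRHS]expR0 ltr_expR oppr_lt0.
  rewrite (_ : (fun k => expR (- q) ^+ k) = geometric 1 (expR (- q))).
    exact: is_cvg_geometric_series.
  by apply/funext => k; rewrite /geometric/= mul1r.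
have c1 : cvgn (series (fun k => jump (k%:R * h) l)).
  apply: (series_le_cvg _ _ _ (geo (h * b) (mulr_gt0 h0 b0))).
  - by move=> k; exact: jump_ge0.
  - by move=> k; rewrite exprn_ge0// expR_ge0.
  - move=> k; rewrite (le_trans (jump_le1 _ _))// -expRM_natl ler_expR.
    by rewrite mulrN mulrA.
have c2 : cvgn (series (fun k => jump (- (k.+1%:R * h)) l)).
  have b1' : 0 < 1 - b by rewrite subr_gt0.
  have := is_cvg_seriesZ (k := l) (geo (h * (1 - b)) (mulr_gt0 h0 b1')).
  apply: series_le_cvg.
  - by move=> k; exact: jump_ge0.
  - by move=> k; rewrite mulr_ge0// exprn_ge0// expR_ge0.
  - move=> k; rewrite (le_trans (jump_le_linear _ _))// ler_wpM2l//.
    rewrite -expRM_natl ler_expR mulNr mulrN lerN2 mulrA ler_wpM2r ?(ltW b1')//.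
    by rewrite ler_wpM2r ?(ltW h0)// ler_nat.
have e : jump_sum h ^~ l =
    series (fun k => jump (k%:R * h) l) \+ series (fun k => jump (- (k.+1%:R * h)) l).
  by apply/funext => K; rewrite /jump_sum big_split.
by rewrite e; exact: (is_cvgD c1 c2).
Qed.

Definition jump_series (h l : R) : R := limn (jump_sum h ^~ l).

Lemma jump_sum_mono h K l l' : l <= l' -> jump_sum h K l <= jump_sum h K l'.
Proof. by move=> ll; apply: ler_sum => k _; rewrite lerD// jump_mono. Qed.

Lemma jump_series_mono h l l' : 0 < h -> 0 <= l -> l <= l' ->
  jump_series h l <= jump_series h l'.
Proof.
move=> h0 l0 ll; apply: ler_lim; [exact: cvg_jump_sum| |].
  by apply: cvg_jump_sum => //; exact: le_trans ll.
by apply: nearW => K; exact: jump_sum_mono.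
Qed.

(** Scaling by exp h shifts every node by h, so the sum gains the node K h and loses the node -K h.
    These boundary terms vanish in the limit, which gives exact homogeneity of the series. *)
Lemma jump_sum_scale h K l : jump_sum h K (expR h * l) =
  expR (h * b) * (jump_sum h K l + jump (K%:R * h) l - jump (- (K%:R * h)) l).
Proof.
elim: K => [|K IH]; first by rewrite /jump_sum !big_geq// mul0r oppr0 add0r subrr mulr0.
rewrite !jump_sumS IH !jump_scale -!mulrDr; congr (_ * _).
have -> : K%:R * h + h = K.+1%:R * h by rewrite -addn1 natrD mulrDl mul1r.
have -> : - (K.+1%:R * h) + h = - (K%:R * h) by rewrite -addn1 natrD mulrDl mul1r opprD addrNK.
move: (jump _ _) (jump _ _) (jump _ _) (jump _ _) (jump_sum _ _ _) => j1 j2 j3 j4 j5.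
by ring.
Qed.

Lemma jump_series_scale h l : 0 < h -> 0 <= l ->
  jump_series h (expR h * l) = expR (h * b) * jump_series h l.
Proof.
move=> h0 l0; apply/cvg_lim; first exact: Rhausdorff.
under eq_fun do rewrite jump_sum_scale.
apply: cvgM; first exact: cvg_cst.
rewrite -[X in _ --> X]addr0 -[X in _ --> X]subr0.
have to0 (q : R) : 0 < q -> expR (- q) ^+ k @[k --> \oo] --> 0.
  by move=> q0; apply: cvg_expr; rewrite ger0_norm ?expR_ge0// -expR0 ltr_expR oppr_lt0.
apply: cvgB; [apply: cvgD; first exact: cvg_jump_sum|].
- apply: (squeeze_cvgr _ (cvg_cst 0) (to0 (h * b) (mulr_gt0 h0 b0))).
  apply: nearW => k; rewrite jump_ge0//= (le_trans (jump_le1 _ _))//.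
  by rewrite -expRM_natl ler_expR mulrN mulrA.
- have b1' : 0 < 1 - b by rewrite subr_gt0.
  have h1 : l * expR (- (h * (1 - b))) ^+ k @[k --> \oo] --> 0.
    rewrite -[X in _ --> X](mulr0 l); apply: cvgM; first exact: cvg_cst.
    by apply: to0; rewrite mulr_gt0.
  apply: (squeeze_cvgr _ (cvg_cst 0) h1).
  apply: nearW => k; rewrite jump_ge0//= (le_trans (jump_le_linear _ _))//.
  by rewrite -expRM_natl ler_wpM2l// ler_expR mulrN mulNr mulrA.
Qed.

Lemma jump_series_expR h (k : int) : 0 < h ->
  jump_series h (expR (k%:~R * h)) = expR (k%:~R * h * b) * jump_series h 1.
Proof.
move=> h0.
have natE (j : nat) l : 0 <= l ->
    jump_series h (expR (j%:R * h) * l) = expR (j%:R * h * b) * jump_series h l.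
  move=> l0; elim: j => [|j IH]; first by rewrite !mul0r expR0 !mul1r.
  rewrite -addn1 natrD !mulrDl !mul1r [_ + h]addrC expRD -mulrA jump_series_scale//; last first.
    by rewrite mulr_ge0// expR_ge0.
  by rewrite IH mulrA -expRD addrC.
case: k => j; first by have := natE j 1 ler01; rewrite mulr1 -pmulrn.
(* A negative exponent is reached by scaling from exp(-(j+1) h) up to 1. *)
have := natE j.+1 (expR (- (j.+1%:R * h))) (expR_ge0 _).
rewrite -expRD subrr expR0 => ->.
rewrite NegzE mulrNz -pmulrn mulNr mulrA -expRD mulNr addNr expR0 mul1r//.
Qed.

(** The node 0 alone contributes 1 - exp(-1). *)
Lemma jump_series1_gt0 h : 0 < h -> 0 < jump_series h 1.
Proof.
move=> h0; apply: (@lt_le_trans _ _ (1 - expR (- 1))).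
  by rewrite subr_gt0 -[ltRHS]expR0 ltr_expR oppr_lt0.
apply: limr_ge; first exact: cvg_jump_sum.
near=> K.
have K0 : (0 < K)%N by near: K; exists 1%N.
rewrite -(prednK K0) /jump_sum big_nat_recl//= mul0r.
have -> : jump 0 1 = 1 - expR (- 1) by rewrite /jump mul0r oppr0 expR0 mul1r mulr1.
rewrite -addrA lerDl addr_ge0 ?jump_ge0// sumr_ge0// => k _.
by rewrite addr_ge0// jump_ge0.
Unshelve. all: end_near. Qed.

(** Homogeneity gives the exact value at the points exp(k h); ln l lies between two consecutive k h,
    and monotonicity then costs at most a factor exp(h b). *)
Lemma jump_series_bounds h l : 0 < h -> 0 < l ->
  expR (- (h * b)) * l `^ b <= jump_series h l / jump_series h 1 <= expR (h * b) * l `^ b.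
Proof.
move=> h0 l0; have J0 := jump_series1_gt0 h0.
pose k := Num.floor (ln l / h).
have k1 : k%:~R * h <= ln l by rewrite -ler_pdivlMr// floor_le_tmp.
have k2 : ln l < (k + 1)%:~R * h by rewrite -ltr_pdivrMr// floorD1_gt.
have lE : expR (ln l) = l by rewrite lnK.
have lb : l `^ b = expR (b * ln l) by rewrite /powR gt_eqF.
rewrite ler_pdivlMr// ler_pdivrMr// lb -!expRD; apply/andP; split.
- apply: le_trans (_ : jump_series h (expR (k%:~R * h)) <= _); last first.
    by apply: jump_series_mono; rewrite ?expR_ge0// -[leRHS]lE ler_expR.
  rewrite jump_series_expR// ler_wpM2r ?(ltW J0)// ler_expR.
  rewrite intrD mulrDl mul1r in k2.
  rewrite -subr_ge0 (_ : _ - _ = b * (k%:~R * h + h - ln l)); last by ring.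
  by rewrite mulr_ge0 ?(ltW b0)// subr_ge0 ltW.
- apply: le_trans (_ : _ <= jump_series h (expR ((k + 1)%:~R * h))) _.
    by apply: jump_series_mono; rewrite ?(ltW l0)// -[leLHS]lE ler_expR ltW.
  rewrite jump_series_expR// ler_wpM2r ?(ltW J0)// ler_expR.
  rewrite intrD mulrDl mul1r.
  rewrite -subr_ge0 (_ : _ - _ = b * (ln l - k%:~R * h)); last by ring.
  by rewrite mulr_ge0 ?(ltW b0)// subr_ge0.
Qed.

Lemma cvg_jump_series_ratio l : 0 <= l ->
  jump_series k.+1%:R^-1 l / jump_series k.+1%:R^-1 1 @[k --> \oo] --> l `^ b.
Proof.
rewrite le_eqVlt => /predU1P[<-|l0].
  rewrite powR0 ?gt_eqF// (_ : (fun k => _) = fun=> 0); first exact: cvg_cst.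
  apply/funext => k; rewrite /jump_series (_ : jump_sum _ ^~ 0 = fun=> 0).
    by rewrite lim_cst// mul0r.
  apply/funext => K; rewrite /jump_sum big1// => i _.
  by rewrite /jump !mulr0 expR0 subrr !mulr0 addr0.
have hk0 : k.+1%:R^-1 @[k --> \oo] --> (0 : R) by exact: cvg_harmonic.
have e0 (c : R) : expR (c * (k.+1%:R^-1 * b)) * l `^ b @[k --> \oo] --> l `^ b.
  have h : expR (c * (k.+1%:R^-1 * b)) @[k --> \oo] --> expR 0.
    apply: cvg_seq_expR.
    rewrite -[X in _ --> X](mulr0 c); apply: cvgM; first exact: cvg_cst.
    by rewrite -[X in _ --> X](mul0r b); apply: cvgM; [exact: hk0|exact: cvg_cst].
  rewrite expR0 in h; rewrite -[X in _ --> X]mul1r.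
  by apply: cvgM; [exact: h|exact: cvg_cst].
apply: (squeeze_cvgr _ (e0 (-1)) (e0 1)); apply: nearW => k.
rewrite mulN1r mul1r; exact: jump_series_bounds.
Qed.

End power_as_bernstein_limit.

(** * The relativistic exponential as a mixture of Gaussians *)

Section relativistic_mixture.
Context {R : realType} {n : nat}.

(** Two successive limits, the number of nodes to infinity and then the mesh to 0. At the finite
    level the function is a product of Poisson exponentials, one for each node. *)
Lemma gauss_mixture_expR_powR (b M t : R) : 0 < b < 1 -> 0 <= M -> 0 <= t ->
  gauss_mixture (fun v : 'rV[R]_n => expR (- (t * (enorm v ^+ 2 + M) `^ b))).
Proof.
move=> /andP[b0 b1] M0 t0.
have l0 (v : 'rV[R]_n) : 0 <= enorm v ^+ 2 + M by rewrite addr_ge0// sqr_ge0.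
apply: (@gauss_mixture_lim _ _ (fun k v => expR (- (t *
    (jump_series b k.+1%:R^-1 (enorm v ^+ 2 + M) / jump_series b k.+1%:R^-1 1))))); last first.
  move=> v; apply: cvg_seq_expR.
  by apply: cvgN; apply: cvgM; [exact: cvg_cst|exact: cvg_jump_series_ratio].
move=> k; set h := k.+1%:R^-1.
have h0 : 0 < h by rewrite invr_gt0.
have J0 := jump_series1_gt0 b0 b1 h0.
set J := jump_series b h 1 in J0 *.
apply: (@gauss_mixture_lim _ _ (fun K v => expR (- (t *
    (jump_sum b h K (enorm v ^+ 2 + M) / J))))); last first.
  move=> v; apply: cvg_seq_expR.
  apply: cvgN; apply: cvgM; first exact: cvg_cst.
  by apply: cvgM; [exact: cvg_jump_sum|exact: cvg_cst].
have one tau : gauss_mixture (fun v : 'rV[R]_n => expR (- (t * (jump b tau (enorm v ^+ 2 + M) / J)))).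
  have c0 : 0 <= t * (expR (- (tau * b)) / J).
    by rewrite mulr_ge0// divr_ge0 ?expR_ge0// ltW.
  apply: (gauss_mixture_ext (gauss_mixture_poisson M c0 (expR_ge0 tau))) => v.
  by rewrite /jump; congr (expR (- _)); rewrite -!mulrA; congr (_ * (_ * _)); rewrite mulrC.
elim=> [|K IH].
  apply: (gauss_mixture_ext (gauss_mixture_cst ler01)) => v.
  by rewrite /jump_sum big_geq// mul0r mulr0 oppr0 expR0.
have := gauss_mixtureM IH (gauss_mixtureM (one (K%:R * h)) (one (- (K.+1%:R * h)))).
move/gauss_mixture_ext; apply => v; rewrite -!expRD jump_sumS; congr expR.
move: (jump _ _ _) (jump _ _ _) (jump_sum _ _ _ _) => j1 j2 j3.
by ring.
Qed.

End relativistic_mixture.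

Lemma derive_le1_lipschitz (R : realType) (f df : R -> R) :
  (forall x, is_derive x (1 : R) f (df x)) -> (forall x, `|df x| <= 1) ->
  forall a b, `|f a - f b| <= `|a - b|.
Proof.
move=> fd df1; have wlog_ a b : a <= b -> `|f b - f a| <= `|b - a|.
  move=> ab; have cf : {within `[a, b], continuous f}.
    by apply: continuous_subspaceT => x; exact: (is_derive_continuous (fd x)).
  have [c _ ->] := MVT_segment ab (fun x _ => fd x) cf.
  by rewrite normrM ler_piMl.
move=> a b; have [ab|/ltW ba] := leP a b; last exact: wlog_.
by rewrite distrC [leRHS]distrC; exact: wlog_.
Qed.

Lemma cos_lipschitz (R : realType) (a b : R) : `|cos a - cos b| <= `|a - b|.
Proof.
apply: (derive_le1_lipschitz (fun x => is_derive_cos x)) => x.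
by rewrite normrN sin_max.
Qed.

(** The left side is 2 sin(u/2)^2, and |sin| is at most the identity. *)
Lemma one_sub_cos_le (R : realType) (u : R) : 1 - cos u <= u ^+ 2 / 2.
Proof.
have h : `|sin (u / 2)| <= `|u / 2|.
  have := derive_le1_lipschitz (fun x => is_derive_sin x) (@cos_max R) (u / 2) 0.
  by rewrite sin0 !subr0.
have -> : cos u = cos (u / 2 + u / 2) by rewrite -splitr.
rewrite cosD -!expr2 cos2sin2.
have : sin (u / 2) ^+ 2 <= (u / 2) ^+ 2.
  by rewrite -[leLHS]real_normK ?num_real// -[leRHS]real_normK ?num_real// lerXn2r ?nnegrE.
rewrite exprMn; move: (sin _ ^+ 2) (u ^+ 2) => s w; lra.
Qed.

(** * The heat kernel *)

Section heat_multiplier.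
Context {R : realType} {n : nat} (m alpha : R).
Hypotheses (alpha0 : 0 < alpha) (alpha2 : alpha < 2) (m0 : 0 <= m).
Implicit Types v x : 'rV[R]_n.

Definition heat_multiplier (t : R) v : R := expR (- t * symbol m alpha v).

Definition fourier_heat_kernel (t : R) x : R :=
  (2 * pi) ^- n * \int[lebesgue]_v (cos (dotp x v) * heat_multiplier t v).

Local Notation M := (m `^ (2 / alpha)).
Local Notation E := heat_multiplier.

Let M0 : 0 <= M. Proof. exact: powR_ge0. Qed.

Let b01 : 0 < alpha / 2 < 1.
Proof. by rewrite divr_gt0//= ltr_pdivrMr// mul1r. Qed.

Let b_ge0 : 0 <= alpha / 2. Proof. by case/andP: b01 => /ltW. Qed.

Let powM : M `^ (alpha / 2) = m.
Proof.
rewrite -powRrM (_ : 2 / alpha * (alpha / 2) = 1) ?powRr1//.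
by field; rewrite gt_eqF.
Qed.

Let sqr_powR v : (enorm v ^+ 2) `^ (alpha / 2) = enorm v `^ alpha.
Proof.
rewrite -powR_mulrn ?enorm_ge0// -powRrM; congr (_ `^ _).
by rewrite mulrCA divff// mulr1.
Qed.

Lemma symbol_ge0 v : 0 <= symbol m alpha v.
Proof.
rewrite /symbol subr_ge0 -[leLHS]powM.
by rewrite ge0_ler_powR ?nnegrE ?addr_ge0 ?sqr_ge0// lerDr sqr_ge0.
Qed.

Lemma symbol_ge v : enorm v `^ alpha - m <= symbol m alpha v.
Proof.
rewrite /symbol lerD2r -sqr_powR.
by rewrite ge0_ler_powR ?nnegrE ?addr_ge0 ?sqr_ge0// lerDl.
Qed.

Lemma symbol0 : symbol m alpha (0 : 'rV[R]_n) = 0.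
Proof. by rewrite /symbol enorm0 expr0n add0r powM subrr. Qed.

Lemma symbolN v : symbol m alpha (- v) = symbol m alpha v.
Proof. by rewrite /symbol enormN. Qed.

Lemma measurable_heat_multiplier t : measurable_fun setT (E t).
Proof.
apply: (@measurableT_comp _ _ _ _ _ _ (@expR R)); first exact: measurable_expR.
apply: measurable_funM => //; apply: measurable_funB => //.
apply: (@measurableT_comp _ _ _ _ _ _ (@powR R ^~ (alpha / 2))); first exact: measurable_powR.
by apply: measurable_funD => //; apply: measurable_funX; exact: measurable_enorm.
Qed.

Lemma heat_multiplier_gt0 t v : 0 < E t v. Proof. exact: expR_gt0. Qed.

Lemma heat_multiplier_mixture t : 0 <= t -> gauss_mixture (E t).
Proof.
move=> t0; have := @gauss_mixture_expR_powR R n _ _ _ b01 M0 t0.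
move/(gauss_mixtureZ (expR_ge0 (t * m))); move/gauss_mixture_ext; apply => v.
by rewrite -expRD /heat_multiplier /symbol; congr expR; ring.
Qed.

(** By [symbol_ge] the multiplier is at most exp(t m) exp(-t |v|^alpha), and t |v|^alpha = (r
    |v|)^alpha for r = t^(1/alpha), the natural length scale at time t. *)
Lemma heat_multiplier_le_weight : exists2 C : R, 0 < C & forall (t : R) v, 0 < t ->
  (1 + (t `^ alpha^-1 * enorm v) ^+ 2) * E t v <=
  C * expR (t * m) * cauchy_weight (t `^ alpha^-1) v.
Proof.
have [C C0 hC] := @expR_powR_le_cauchy_weight R n _ alpha0.
exists C => // t v t0; set r := t `^ alpha^-1.
have r0 : 0 <= r by exact: powR_ge0.
have hr : (r * enorm v) `^ alpha = t * enorm v `^ alpha.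
  rewrite powRM ?enorm_ge0//; congr (_ * _).
  by rewrite -powRrM mulVf ?gt_eqF// powRr1 ?ltW.
have := hC r v r0; rewrite hr => h.
have hE : E t v <= expR (t * m) * expR (- (t * enorm v `^ alpha)).
  rewrite -expRD ler_expR mulNr -mulrBr -opprB mulrN lerN2 ler_wpM2l ?(ltW t0)//.
  exact: symbol_ge.
have h1 : 0 <= 1 + (r * enorm v) ^+ 2 by rewrite addr_ge0// sqr_ge0.
apply: (le_trans (ler_wpM2l h1 hE)); rewrite mulrCA.
by rewrite [C * _]mulrC -mulrA ler_wpM2l ?expR_ge0.
Qed.

Lemma integrable_sqr_heat_multiplier t : 0 < t ->
  lebesgue.-integrable setT (fun v => ((1 + (t `^ alpha^-1 * enorm v) ^+ 2) * E t v)%:E).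
Proof.
move=> t0; have [C C0 hC] := heat_multiplier_le_weight.
have r0 : 0 < t `^ alpha^-1 by exact: powR_gt0.
have : lebesgue.-integrable setT
    (fun v => ((C * expR (t * m))%:E * (cauchy_weight (t `^ alpha^-1) v)%:E)%E).
  by apply: integrableZl => //; exact: integrable_cauchy_weight.
apply: le_integrable => //.
  apply/measurable_EFinP; apply: measurable_funM; last exact: measurable_heat_multiplier.
  apply: measurable_funD => //; apply: measurable_funX; apply: measurable_funM => //.
  exact: measurable_enorm.
move=> v _; rewrite -EFinM /= lee_fin ger0_norm; last first.
  by rewrite mulr_ge0 ?(ltW (heat_multiplier_gt0 _ _))// addr_ge0// sqr_ge0.
by rewrite (le_trans (hC t v t0))// ler_norm.
Qed.

Lemma integrable_heat_multiplierM t (h : 'rV[R]_n -> R) (B : R) : 0 < t ->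
  measurable_fun setT h ->
  (forall v, `|h v| <= B * (1 + (t `^ alpha^-1 * enorm v) ^+ 2)) ->
  lebesgue.-integrable setT (fun v => (h v * E t v)%:E).
Proof.
move=> t0 mh hB.
have : lebesgue.-integrable setT
   (fun v => (B%:E * ((1 + (t `^ alpha^-1 * enorm v) ^+ 2) * E t v)%:E)%E).
  by apply: integrableZl => //; exact: integrable_sqr_heat_multiplier.
apply: le_integrable => //.
  by apply/measurable_EFinP; apply: measurable_funM => //; exact: measurable_heat_multiplier.
move=> v _; rewrite -EFinM /= lee_fin normrM (ger0_norm (ltW (heat_multiplier_gt0 _ _))).
apply: le_trans (ler_norm _); rewrite mulrA ler_wpM2r ?(ltW (heat_multiplier_gt0 _ _))//.
Qed.

Lemma integrable_bounded_heat_multiplier t (h : 'rV[R]_n -> R) : 0 < t ->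
  measurable_fun setT h -> (forall v, `|h v| <= 1) ->
  lebesgue.-integrable setT (fun v => (h v * E t v)%:E).
Proof.
move=> t0 mh hB; apply: (@integrable_heat_multiplierM _ _ 1) => // v.
by rewrite mul1r (le_trans (hB v))// lerDl sqr_ge0.
Qed.

Lemma integrable_heat_multiplier t : 0 < t ->
  lebesgue.-integrable setT (EFin \o E t).
Proof.
move=> t0; have norm1 v : `|cst (1:R) v| <= 1 by rewrite normr1.
have := @integrable_bounded_heat_multiplier t (cst 1) t0 (measurable_cst _) norm1.
by apply: eq_integrable => // v _; rewrite /= mul1r.
Qed.

Lemma measurable_cosdot x : measurable_fun setT (fun v => cos (dotp x v)).
Proof. by have := @measurable_cos_dotp R n 0 x; under eq_fun do rewrite add0r. Qed.

Lemma measurable_sindot x : measurable_fun setT (fun v => sin (dotp x v)).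
Proof. by have := @measurable_sin_dotp R n 0 x; under eq_fun do rewrite add0r. Qed.

Lemma integrable_cos_heat_multiplier t x : 0 < t ->
  lebesgue.-integrable setT (fun v => (cos (dotp x v) * E t v)%:E).
Proof.
move=> t0; apply: integrable_bounded_heat_multiplier => //; first exact: measurable_cosdot.
by move=> v; exact: cos_max.
Qed.

Let c0 : 0 < (2 * pi) ^- n :> R.
Proof. by rewrite invr_gt0 exprn_gt0// mulr_gt0// pi_gt0. Qed.

(** The regulariser in [gauss_mixture_fourier] is removed by dominated convergence, since the
    multiplier itself is integrable. *)
Lemma fourier_heat_kernel_bound : exists2 C : R, 0 < C & forall t x, 0 < t ->
  0 <= fourier_heat_kernel t x /\ enorm x ^+ n * fourier_heat_kernel t x <= C.
Proof.
have [C C0 hC] := @gauss_mixture_fourier R n.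
exists ((2 * pi) ^- n * C) => [|t x t0]; first by rewrite mulr_gt0.
have mE := heat_multiplier_mixture (ltW t0).
have lim : \int[lebesgue]_v (cos (dotp x v) * E t v * expR (- k.+1%:R^-1 * enorm v ^+ 2)) @[k --> \oo] -->
    \int[lebesgue]_v (cos (dotp x v) * E t v).
  apply: (@Rintegral_dominated_cvg _ _ _ _ _ _ (E t)).
  - move=> k; apply: measurable_funM; last exact: measurable_gauss.
    by apply: measurable_funM; [exact: measurable_cosdot|exact: measurable_heat_multiplier].
  - move=> v; rewrite -[X in _ --> X]mulr1; apply: cvgM; first exact: cvg_cst.
    have h : expR (- k.+1%:R^-1 * enorm v ^+ 2) @[k --> \oo] --> expR (- 0 * enorm v ^+ 2).
      apply: cvg_seq_expR; apply: cvgM; last exact: cvg_cst.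
      by apply: cvgN; exact: cvg_harmonic.
    by rewrite oppr0 mul0r expR0 in h.
  - exact: integrable_heat_multiplier.
  - move=> k v; rewrite !normrM (ger0_norm (expR_ge0 _)).
    rewrite (ger0_norm (ltW (heat_multiplier_gt0 _ _))) -[leRHS]mulr1 ler_pM ?mulr_ge0 ?expR_ge0//.
      by rewrite ler_piMl ?cos_max// (ltW (heat_multiplier_gt0 _ _)).
    by rewrite -expR0 ler_expR mulNr oppr_le0 mulr_ge0 ?sqr_ge0.
(* The symbol vanishes at 0, so the bound by the value at 0 is uniform in t. *)
have E1 : E t 0 = 1 by rewrite /heat_multiplier symbol0 mulr0 expR0.
split.
  rewrite mulr_ge0 ?(ltW c0)// -(cvg_lim (@Rhausdorff R) lim).
  apply: limr_ge; first exact: (cvgP _ lim).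
  by apply: nearW => k; have [] := hC _ mE k.+1%:R^-1 x.
rewrite mulrCA ler_wpM2l ?(ltW c0)//.
have lim1 : enorm x ^+ n * \int[lebesgue]_v (cos (dotp x v) * E t v * expR (- k.+1%:R^-1 * enorm v ^+ 2))
     @[k --> \oo] --> enorm x ^+ n * \int[lebesgue]_v (cos (dotp x v) * E t v).
  by apply: cvgM; [exact: cvg_cst|exact: lim].
rewrite -(cvg_lim (@Rhausdorff R) lim1); apply: limr_le; first exact: (cvgP _ lim1).
apply: nearW => k; have k0 : 0 < k.+1%:R^-1 :> R by [].
by have [_] := hC _ mE _ x k0; rewrite E1 mulr1.
Qed.

Lemma fourier_heat_kernel_le t x : 0 < t ->
  fourier_heat_kernel t x <= (2 * pi) ^- n * \int[lebesgue]_v E t v.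
Proof.
move=> t0; rewrite ler_wpM2l ?(ltW c0)//; apply: le_Rintegral => //.
- exact: integrable_cos_heat_multiplier.
- exact: integrable_heat_multiplier.
- move=> v _; rewrite ler_piMl ?(ltW (heat_multiplier_gt0 _ _))//.
Qed.

Lemma integral_sqr_heat_multiplier_le : exists2 C : R, 0 < C & forall t, 0 < t <= 1 ->
  \int[lebesgue]_v ((1 + (t `^ alpha^-1 * enorm v) ^+ 2) * E t v) <=
  C / (t `^ alpha^-1) ^+ n.
Proof.
have [C C0 hC] := heat_multiplier_le_weight.
have [K K0 hK] := @integral_cauchy_weight R n.
exists (C * expR m * K) => [|t /andP[t0 t1]]; first by rewrite !mulr_gt0// expR_gt0.
have r0 : 0 < t `^ alpha^-1 by exact: powR_gt0.
rewrite -mulrA [K / _](_ : _ = \int[@lebesgue R n]_v cauchy_weight (t `^ alpha^-1) v); last first.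
  by rewrite /Rintegral hK.
rewrite -RintegralZl//; last exact: integrable_cauchy_weight.
apply: le_Rintegral => //.
- exact: integrable_sqr_heat_multiplier.
- rewrite (_ : EFin \o _ = (fun v => ((C * expR m)%:E * (cauchy_weight (t `^ alpha^-1) v)%:E)%E));
    last exact/funext.
  by apply: integrableZl => //; exact: integrable_cauchy_weight.
- move=> v _; apply: (le_trans (hC t v t0)); rewrite ler_wpM2r ?cauchy_weight_ge0//.
  by rewrite ler_wpM2l ?(ltW C0)// ler_expR ler_piMl.
Qed.

Lemma integral_heat_multiplier_le_sqr t : 0 < t ->
  \int[lebesgue]_v E t v <= \int[lebesgue]_v ((1 + (t `^ alpha^-1 * enorm v) ^+ 2) * E t v).
Proof.
move=> t0; apply: le_Rintegral => //.
- exact: integrable_heat_multiplier.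
- exact: integrable_sqr_heat_multiplier.
- by move=> v _; rewrite ler_peMl ?(ltW (heat_multiplier_gt0 _ _))// lerDl sqr_ge0.
Qed.

Lemma fourier_heat_kernel_small_time : exists2 C : R, 0 < C & forall t x, 0 < t <= 1 ->
  fourier_heat_kernel t x <= C / (t `^ alpha^-1) ^+ n.
Proof.
have [C C0 hC] := integral_sqr_heat_multiplier_le.
exists ((2 * pi) ^- n * C) => [|t x t01]; first by rewrite mulr_gt0.
have [t0 _] := andP t01.
apply: (le_trans (fourier_heat_kernel_le x t0)); rewrite -mulrA ler_wpM2l ?(ltW c0)//.
by apply: le_trans (hC t t01); exact: integral_heat_multiplier_le_sqr.
Qed.

(** The symbol is nonnegative, so the multiplier decreases in t and the bound at time 1 persists,
    whereas the factor exp(t m) of the weight bound would grow. *)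
Lemma fourier_heat_kernel_large_time : exists2 C : R, 0 < C & forall t x, 1 <= t ->
  fourier_heat_kernel t x <= C.
Proof.
have [C C0 hC] := integral_sqr_heat_multiplier_le.
exists ((2 * pi) ^- n * C) => [|t x t1]; first by rewrite mulr_gt0.
have t0 : 0 < t by exact: lt_le_trans t1.
apply: (le_trans (fourier_heat_kernel_le x t0)); rewrite ler_wpM2l ?(ltW c0)//.
apply: (@le_trans _ _ (\int[lebesgue]_v E 1 v)).
  apply: le_Rintegral => //; [exact: integrable_heat_multiplier..|].
  by move=> v _; rewrite ler_expR !mulNr mul1r lerN2 ler_peMl ?symbol_ge0.
apply: (le_trans (integral_heat_multiplier_le_sqr ltr01)).
have -> : C = C / (1 `^ alpha^-1) ^+ n by rewrite powR1 /= expr1n divr1.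
by apply: hC; rewrite ltr01 lexx.
Qed.

(** On the cube |v_i| < 1/r, of volume (2/r)^n, t times the symbol is at most (n + M)^(alpha/2),
    because t <= 1 forces r <= 1 and hence M <= M / r^2. *)
Lemma integral_heat_multiplier_ge : exists2 c : R, 0 < c & forall t, 0 < t <= 1 ->
  c / (t `^ alpha^-1) ^+ n <= \int[lebesgue]_v E t v.
Proof.
pose c := expR (- ((n%:R + M) `^ (alpha / 2))).
exists (c * 2 ^+ n) => [|t /andP[t0 t1]]; first by rewrite mulr_gt0 ?expR_gt0// exprn_gt0.
set r := t `^ alpha^-1.
have r0 : 0 < r by exact: powR_gt0.
have r1 : r <= 1.
  have -> : 1 = 1 `^ alpha^-1 :> R by rewrite powR1.
  by rewrite ge0_ler_powR ?nnegrE ?invr_ge0// ltW.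
pose I : set R := `]- r^-1, r^-1[%classic.
have mI (i : 'I_n) : measurable_fun setT (\1_I : R -> R).
  by apply: measurable_indic; exact: measurable_itv.
have I0 (i : 'I_n) (x : R) : 0 <= \1_I x :> R by rewrite indicE.
have intI (i : 'I_n) : (\int[lebesgue_measure]_x (\1_I x)%:E = (2 / r)%:E)%E.
  rewrite integral_indic_itv; first by congr EFin; lra.
  by rewrite (@lt_trans _ _ 0) ?oppr_lt0 ?invr_gt0.
have hI := ge0_integral_prod mI I0 intI.
rewrite prodr_const card_ord expr_div_n in hI.
have intE := integrable_heat_multiplier t0.
rewrite -mulrA -lee_fin EFinM -hI /Rintegral fineK; last exact: integrable_fin_num.
have mprod : measurable_fun setT (fun v : 'rV[R]_n => (\prod_(i < n) \1_I (v ord0 i) : R)).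
  by apply: measurable_prod => i _; exact: (measurableT_comp (mI i) (measurable_coord i)).
have pr0 (v : 'rV[R]_n) : 0 <= \prod_(i < n) \1_I (v ord0 i) :> R by exact: prodr_ge0.
rewrite -ge0_integralZl//; last 3 first.
  exact/measurable_EFinP.
  by move=> v _; rewrite lee_fin.
  by rewrite lee_fin expR_ge0.
apply: ge0_le_integral => //.
- by move=> v _; rewrite mule_ge0// lee_fin ?expR_ge0.
- by apply/measurable_EFinP; apply: measurable_funM.
- exact: measurable_int intE.
move=> v _; rewrite -EFinM lee_fin.
have [vI|] := pselect (forall i, I (v ord0 i)); last first.
  move=> /existsNP[i vi]; rewrite (bigD1 i)//= indicE memNset// mul0r mulr0.
  exact/ltW/heat_multiplier_gt0.
rewrite big1 ?mulr1; last by move=> i _; rewrite indicE mem_set.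
rewrite ler_expR mulNr lerN2.
have hv : enorm v ^+ 2 <= n%:R * r^-1 ^+ 2.
  by apply: enorm_le_sum => i; have := vI i; rewrite /I/= in_itv/= -ltr_norml => /ltW.
apply: (@le_trans _ _ (t * (enorm v ^+ 2 + M) `^ (alpha / 2))).
  by rewrite ler_wpM2l ?(ltW t0)// gerBl.
have rinv : 1 <= r^-1 ^+ 2 by rewrite exprn_ege1// invf_ge1.
apply: (@le_trans _ _ (t * ((n%:R + M) * r^-1 ^+ 2) `^ (alpha / 2))).
  have q1 : 0 <= enorm v ^+ 2 + M by rewrite addr_ge0// sqr_ge0.
  have q2 : 0 <= (n%:R + M) * r^-1 ^+ 2 by rewrite mulr_ge0 ?sqr_ge0// addr_ge0.
  rewrite ler_wpM2l ?(ltW t0)//; apply: ge0_ler_powR; rewrite ?nnegrE//.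
  by rewrite [leRHS]mulrDl; apply: lerD => //; rewrite ler_peMr.
rewrite powRM ?addr_ge0 ?sqr_ge0// mulrCA ler_piMr ?powR_ge0//.
have -> : (r^-1 ^+ 2) `^ (alpha / 2) = t^-1.
  rewrite -powR_mulrn ?invr_ge0 ?(ltW r0)// -powRrM mulrCA divff// mulr1.
  rewrite /r -powRN -powRrM mulNr mulVf ?gt_eqF// powRN powRr1 ?ltW//.
by rewrite divff// gt_eqF.
Qed.

(** Replacing the cosine by 1 costs at most a second moment times |x|^2, which is a small fraction
    of the integral of the multiplier when |x| is small against r. *)
Lemma fourier_heat_kernel_ge : exists A c : R, [/\ 0 < A, 0 < c & forall t x, 0 < t <= 1 ->
  enorm x <= A * t `^ alpha^-1 -> c / (t `^ alpha^-1) ^+ n <= fourier_heat_kernel t x].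
Proof.
have [C C0 hC] := integral_sqr_heat_multiplier_le.
have [c cp hc] := integral_heat_multiplier_ge.
pose D := n%:R ^+ 2 * C + 1.
have D0 : 0 < D by rewrite ltr_wpDl// mulr_ge0 ?sqr_ge0 ?ltW.
(* As A <= 1, A^2 n^2 C <= A D <= c, and the error uses up at most half of the main term. *)
pose A := Num.min 1 (c / D).
have A0 : 0 < A by rewrite lt_min ltr01 divr_gt0.
have AD : A ^+ 2 * (n%:R ^+ 2 * C) <= c.
  apply: (@le_trans _ _ (A * D)).
    rewrite expr2 -mulrA ler_wpM2l ?(ltW A0)//.
    apply: (@le_trans _ _ (1 * (n%:R ^+ 2 * C))).
      by rewrite ler_wpM2r ?mulr_ge0 ?sqr_ge0 ?(ltW C0)// ge_min lexx.
    by rewrite mul1r lerDl.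
  by rewrite -ler_pdivlMr// ge_min lexx orbT.
exists A, ((2 * pi) ^- n * (c / 2)); split => //; first by rewrite mulr_gt0// divr_gt0.
move=> t x t01 xA; have [t0 t1] := andP t01.
have := hC t t01; have := hc t t01; set r := t `^ alpha^-1 in xA *.
have r0 : 0 < r by exact: powR_gt0.
move=> {}hc {}hC; rewrite -mulrA ler_wpM2l ?(ltW c0)//.
(* Chosen so that (n |x| |v|)^2 / 2 = k (r |v|)^2. *)
pose k := n%:R ^+ 2 * enorm x ^+ 2 / (2 * r ^+ 2).
have k0 : 0 <= k.
  by rewrite divr_ge0// mulr_ge0 ?exprn_ge0 ?enorm_ge0// (ltW r0).
have int2 : lebesgue.-integrable setT (fun v => (k * ((1 + (r * enorm v) ^+ 2) * E t v))%:E).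
  under eq_fun do rewrite EFinM.
  by apply: integrableZl => //; exact: integrable_sqr_heat_multiplier.
have intE := integrable_heat_multiplier t0.
apply: (@le_trans _ _ (\int[lebesgue]_v (E t v - k * ((1 + (r * enorm v) ^+ 2) * E t v)))); last first.
  apply: le_Rintegral => //.
  - by apply: eq_integrable (integrableB measurableT intE int2).
  - exact: integrable_cos_heat_multiplier.
  - move=> v _; rewrite mulrA -{1}[E t v]mul1r -mulrBl ler_wpM2r ?(ltW (heat_multiplier_gt0 _ _))//.
    have := one_sub_cos_le (dotp x v).
    have : dotp x v ^+ 2 <= (n%:R * enorm x * enorm v) ^+ 2.
      rewrite -[leLHS]real_normK ?num_real// lerXn2r ?nnegrE ?mulr_ge0 ?enorm_ge0//.
      exact: dotp_le.
    have : (n%:R * enorm x * enorm v) ^+ 2 / 2 <= k * (1 + (r * enorm v) ^+ 2).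
      rewrite mulrDr mulr1 -[leLHS]add0r lerD// /k.
      rewrite (_ : _ / (2 * r ^+ 2) * _ = (n%:R * enorm x * enorm v) ^+ 2 / 2)//.
      by field; rewrite gt_eqF.
    lra.
rewrite RintegralB// RintegralZl//; last exact: integrable_sqr_heat_multiplier.
have hk : k * \int[lebesgue]_v ((1 + (r * enorm v) ^+ 2) * E t v) <= c / 2 / r ^+ n.
  apply: (le_trans (ler_wpM2l k0 hC)); rewrite mulrA ler_wpM2r ?invr_ge0 ?exprn_ge0 ?(ltW r0)//.
  rewrite /k [X in X <= _](_ : _ = (enorm x / r) ^+ 2 * (n%:R ^+ 2 * C) / 2); last first.
    by field; rewrite gt_eqF.
  rewrite ler_wpM2r ?invr_ge0//; apply: le_trans AD.
  rewrite ler_wpM2r ?mulr_ge0 ?sqr_ge0 ?(ltW C0)// lerXn2r ?nnegrE ?divr_ge0 ?enorm_ge0 ?(ltW A0) ?(ltW r0)//.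
  by rewrite ler_pdivrMr.
have : c / 2 / r ^+ n = c / r ^+ n - c / 2 / r ^+ n by field; rewrite gt_eqF// exprn_gt0.
lra.
Qed.

End heat_multiplier.

(** * Identification of the heat kernel with an inverse Fourier transform *)

Section heat_kernel_identification.
Context {R : realType} {n : nat} (m alpha : R).
Hypotheses (alpha0 : 0 < alpha) (alpha2 : alpha < 2) (m0 : 0 <= m).
Implicit Types v x y : 'rV[R]_n.
Local Notation E := (@heat_multiplier R n m alpha).
Local Notation Phi := (@fourier_heat_kernel R n m alpha).

(** The topology is that of the sup norm; this form lets cubes serve as neighbourhoods. *)
Lemma continuous_rowP (f : 'rV[R]_n -> R) : continuous f <->
  forall (x : 'rV[R]_n) (e : R), 0 < e -> exists2 r : R, 0 < r &
    forall y : 'rV[R]_n, (forall i, `|x ord0 i - y ord0 i| < r) -> `|f x - f y| < e.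
Proof.
split=> [cf x e e0|h x s].
  have /nbhs_ballP[r r0 hr] := cf x _ (nbhsx_ballx (f x) e e0).
  exists r => // y xy; apply: hr; split => // i j.
  by rewrite ord1; exact: xy.
move=> /nbhs_ballP[e e0 es]; have [r r0 hr] := h x e e0.
apply/nbhs_ballP; exists r => // y [_ xy]; apply: es; apply: hr => i.
exact: xy.
Qed.

Lemma coord_le_norm v i : `|v ord0 i| <= `|v|.
Proof.
rewrite [leRHS]mx_normrE.
exact: (le_bigmax _ (fun ij : 'I_1 * 'I_n => `|v ij.1 ij.2|) (ord0, i)).
Qed.

Lemma norm_lt_coord v (r : R) : 0 < r -> (forall i, `|v ord0 i| < r) -> `|v| < r.
Proof.
move=> r0 h; rewrite [ltLHS]mx_normrE; apply/bigmax_ltP; split => // -[i j] _ /=.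
by rewrite ord1.
Qed.

Lemma dotp_le_norm x v : `|dotp x v| <= n%:R * `|x| * enorm v.
Proof.
rewrite (le_trans (ler_norm_sum _ _ _))// -mulrA mulr_natl.
have -> : (`|x| * enorm v) *+ n = \sum_(i < n) (`|x| * enorm v).
  by rewrite sumr_const card_ord.
by apply: ler_sum => i _; rewrite normrM ler_pM ?coord_le_norm ?coord_le_enorm.
Qed.

Let c0 : 0 < (2 * pi) ^- n :> R.
Proof. by rewrite invr_gt0 exprn_gt0// mulr_gt0// pi_gt0. Qed.

Let iE t : 0 < t -> lebesgue.-integrable setT (EFin \o E t).
Proof. by move=> t0; exact: integrable_heat_multiplier. Qed.

Let icosE t x : 0 < t -> lebesgue.-integrable setT (fun v => (cos (dotp x v) * E t v)%:E).
Proof. by move=> t0; exact: integrable_cos_heat_multiplier. Qed.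

Let isinE t x : 0 < t -> lebesgue.-integrable setT (fun v => (sin (dotp x v) * E t v)%:E).
Proof.
move=> t0; apply: integrable_bounded_heat_multiplier => //; first exact: measurable_sindot.
by move=> v; exact: sin_max.
Qed.

(** The kernel is Lipschitz: the cosine is, and the resulting first moment is controlled by r |v| <=
    1 + (r |v|)^2. *)
Lemma continuous_fourier_heat_kernel t : 0 < t -> continuous (Phi t).
Proof.
move=> t0; apply/continuous_rowP => x e e0; pose r := t `^ alpha^-1.
have r0 : 0 < r by exact: powR_gt0.
pose I := \int[@lebesgue R n]_v ((1 + (r * enorm v) ^+ 2) * E t v).
have I0 : 0 <= I.
  apply: Rintegral_ge0 => v _.
  by rewrite mulr_ge0 ?(ltW (heat_multiplier_gt0 _ _ _ _))// addr_ge0// sqr_ge0.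
pose L := (2 * pi) ^- n * (n%:R / r * I).
have L0 : 0 <= L by rewrite mulr_ge0 ?(ltW c0)// mulr_ge0// divr_ge0 ?(ltW r0).
have lip y : `|Phi t x - Phi t y| <= L * `|x - y|.
  rewrite /fourier_heat_kernel -mulrBr normrM (ger0_norm (ltW c0)) -mulrA ler_wpM2l ?(ltW c0)//.
  rewrite -RintegralB//; [|exact: integrable_cos_heat_multiplier..].
  have iB : lebesgue.-integrable setT
      (EFin \o (fun v => cos (dotp x v) * E t v - cos (dotp y v) * E t v)).
    by apply: eq_integrable (integrableB measurableT (icosE x t0) (icosE y t0)).
  apply: (le_trans (le_normr_Rintegral _ iB)) => //.
  have -> : n%:R / r * I * `|x - y| = \int[lebesgue]_v (n%:R / r * `|x - y| *
      ((1 + (r * enorm v) ^+ 2) * E t v)).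
    rewrite RintegralZl//; last exact: integrable_sqr_heat_multiplier.
    by rewrite -/I mulrAC.
  apply: le_Rintegral => //.
  - exact: (integrable_norm iB).
  - rewrite (_ : EFin \o _ = (fun v => ((n%:R / r * `|x - y|)%:E * ((1 + (r * enorm v) ^+ 2) * E t v)%:E)%E));
      last exact/funext.
    by apply: integrableZl => //; exact: integrable_sqr_heat_multiplier.
  - move=> v _; rewrite -mulrBl normrM (ger0_norm (ltW (heat_multiplier_gt0 _ _ _ _))).
    rewrite mulrA ler_wpM2r ?(ltW (heat_multiplier_gt0 _ _ _ _))//.
    apply: (le_trans (cos_lipschitz _ _)); rewrite -dotpBl.
    apply: (le_trans (dotp_le_norm _ _)).
    have -> : n%:R * `|x - y| * enorm v = n%:R / r * `|x - y| * (r * enorm v).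
      by field; rewrite gt_eqF.
    rewrite ler_wpM2l ?mulr_ge0 ?invr_ge0 ?(ltW r0)//.
    by have := sqr_ge0 (r * enorm v - 1); nra.
exists (e / (L + 1)) => [|y xy]; first by rewrite divr_gt0// ltr_wpDl.
have {}xy : `|x - y| < e / (L + 1).
  apply: norm_lt_coord => [|i]; first by rewrite divr_gt0// ltr_wpDl.
  by have := xy i; rewrite !mxE.
apply: (le_lt_trans (lip y)); apply: (@le_lt_trans _ _ ((L + 1) * `|x - y|)).
  by rewrite ler_wpM2r// lerDl.
by rewrite mulrC -ltr_pdivlMr ?ltr_wpDl.
Qed.

Lemma measurable_fourier_heat_kernel t : 0 < t -> measurable_fun setT (Phi t).
Proof.
move=> t0.
(* Adding 1 makes the integrand nonnegative, so that Tonelli yields measurability in x; the integral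
   of the multiplier is subtracted afterwards. *)
pose F x := (\int[lebesgue]_v ((1 + cos (dotp x v)) * E t v)%:E)%E.
have mdot : measurable_fun setT (fun p : 'rV[R]_n * 'rV[R]_n => dotp p.1 p.2).
  exact: measurable_dotp measurable_fst measurable_snd.
have mF : measurable_fun setT F.
  apply: (@measurable_fun_fubini_tonelli_F _ _ _ _ R lebesgue
     (fun p : 'rV[R]_n * 'rV[R]_n => ((1 + cos (dotp p.1 p.2)) * E t p.2)%:E)).
    apply/measurable_EFinP; apply: measurable_funM.
      apply: measurable_funD => //; apply: (@measurableT_comp _ _ _ _ _ _ (@cos R)) => //.
      by apply: continuous_measurable_fun; exact: continuous_cos.
    exact: (measurableT_comp (measurable_heat_multiplier _ _ _) measurable_snd).
  move=> p; rewrite lee_fin mulr_ge0 ?(ltW (heat_multiplier_gt0 _ _ _ _))//.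
have -> : Phi t = (fun x => (2 * pi) ^- n * (fine (F x) - \int[lebesgue]_v E t v)).
  apply/funext => x; congr (_ * _).
  have ic := icosE x t0; have iEt := iE t0.
  rewrite -[fine _]/(\int[lebesgue]_v ((1 + cos (dotp x v)) * E t v)).
  under [in RHS]eq_Rintegral do rewrite mulrDl mul1r.
  by rewrite RintegralD// addrAC subrr add0r.
apply: measurable_funM => //; apply: measurable_funB => //.
exact: (measurableT_comp _ mF).
Qed.

Lemma fourier_heat_kernel_norm_le t x : 0 < t ->
  `|Phi t x| <= (2 * pi) ^- n * \int[lebesgue]_v E t v.
Proof.
move=> t0; have [C C0 /(_ t x t0)[h _]] := @fourier_heat_kernel_bound R n _ _ alpha0 alpha2 m0.
by rewrite ger0_norm//; exact: fourier_heat_kernel_le.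
Qed.

Lemma integrable_fourier_heat_kernelM t x (u : 'rV[R]_n -> R) : 0 < t ->
  lebesgue.-integrable setT (EFin \o u) ->
  lebesgue.-integrable setT (fun y => (Phi t (x - y) * u y)%:E).
Proof.
move=> t0 iu; pose B := (2 * pi) ^- n * \int[@lebesgue R n]_v E t v.
have : lebesgue.-integrable setT (fun y => (B%:E * (u y)%:E)%E) by exact: integrableZl.
apply: le_integrable => //.
  apply/measurable_EFinP; apply: measurable_funM; last first.
    by apply/measurable_EFinP; exact: measurable_int iu.
  apply: (measurableT_comp (measurable_fourier_heat_kernel t0)).
  exact: measurable_rowB.
move=> y _; rewrite -EFinM /= lee_fin normrM [leRHS]normrM ler_wpM2r//.
by apply: (le_trans (fourier_heat_kernel_norm_le _ t0)); exact: ler_norm.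
Qed.

(** The sine is odd and the symbol even, which is why the kernel is real. *)
Lemma integral_sin_heat_multiplier t x : 0 < t ->
  \int[lebesgue]_v (sin (dotp x v) * E t v) = 0.
Proof.
move=> t0; have is' := isinE x t0; set S := LHS.
have h := integral_rowN (measurable_int _ is').
have e : S =
    \int[lebesgue]_v (- 1 * (sin (dotp x v) * E t v)).
  rewrite /S /Rintegral -h; congr fine; apply: eq_integral => v _.
  by rewrite dotpNr sinN /heat_multiplier symbolN mulN1r mulNr.
have {}e : S = - 1 * S by rewrite {1}e RintegralZl.
by move: e; move: S => S; lra.
Qed.

(** For u = Re f and w = Im f the left side is, up to (2 pi)^n, the real part of the semigroup
    applied to f. After the exchange the sine terms vanish by oddness in the frequency. *)
Lemma fubini_heat_multiplier t x (u w : 'rV[R]_n -> R) : 0 < t ->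
  lebesgue.-integrable setT (EFin \o u) -> lebesgue.-integrable setT (EFin \o w) ->
  \int[lebesgue]_xi (E t xi * \int[lebesgue]_y
     (cos (dotp (x - y) xi) * u y - sin (dotp (x - y) xi) * w y)) =
  \int[lebesgue]_y ((\int[lebesgue]_v (cos (dotp (x - y) v) * E t v)) * u y).
Proof.
move=> t0 iu iw.
pose K (p : 'rV[R]_n * 'rV[R]_n) : \bar R :=
  (E t p.1 * (cos (dotp (x - p.2) p.1) * u p.2 - sin (dotp (x - p.2) p.1) * w p.2))%:E.
have mu' : measurable_fun setT u by apply/measurable_EFinP; exact: measurable_int iu.
have mw : measurable_fun setT w by apply/measurable_EFinP; exact: measurable_int iw.
have mdot : measurable_fun setT (fun p : 'rV[R]_n * 'rV[R]_n => dotp (x - p.2) p.1).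
  by apply: measurable_dotp => //; apply: measurable_rowB => //; exact: measurable_cst.
have mcos : measurable_fun setT (@cos R).
  by apply: continuous_measurable_fun; exact: continuous_cos.
have msin : measurable_fun setT (@sin R).
  by apply: continuous_measurable_fun; exact: continuous_sin.
have mK : measurable_fun setT K.
  apply/measurable_EFinP; apply: measurable_funM.
    exact: (measurableT_comp (measurable_heat_multiplier _ _ _) measurable_fst).
  apply: measurable_funB; apply: measurable_funM.
  - exact: (measurableT_comp mcos mdot).
  - exact: (measurableT_comp mu' measurable_snd).
  - exact: (measurableT_comp msin mdot).
  - exact: (measurableT_comp mw measurable_snd).
have inn_bd xi y : `|cos (dotp (x - y) xi) * u y - sin (dotp (x - y) xi) * w y| <= `|u y| + `|w y|.
  rewrite (le_trans (ler_normB _ _))// !normrM lerD//.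
    by rewrite ler_piMl// cos_max.
  by rewrite ler_piMl// sin_max.
have iuw : lebesgue.-integrable setT (fun y => (`|u y| + `|w y|)%:E).
  by apply: eq_integrable (integrableD measurableT (integrable_norm iu) (integrable_norm iw)).
have iin xi : lebesgue.-integrable setT (fun y => (cos (dotp (x - y) xi) * u y - sin (dotp (x - y) xi) * w y)%:E).
  apply: le_integrable iuw => //.
    have mdx : measurable_fun setT (fun y => dotp (x - y) xi).
      by apply: measurable_dotp => //; exact: measurable_rowB.
    apply/measurable_EFinP; apply: measurable_funB; apply: measurable_funM => //.
    - exact: (measurableT_comp mcos mdx).
    - exact: (measurableT_comp msin mdx).
  by move=> y _; rewrite /= lee_fin (le_trans (inn_bd xi y))// ler_norm.
pose B := \int[lebesgue]_y (`|u y| + `|w y|).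
have BE : (\int[lebesgue]_y (`|u y| + `|w y|)%:E = B%:E)%E.
  by rewrite /B /Rintegral fineK//; exact: integrable_fin_num.
have iK : (lebesgue \x lebesgue)%E.-integrable setT K.
  apply/integrable12ltyP => //.
  apply: (@le_lt_trans _ _ (\int[lebesgue]_xi (B * E t xi)%:E)%E).
    apply: ge0_le_integral => //.
    - by move=> xi _; exact: integral_ge0.
    - apply: (@measurable_fun_fubini_tonelli_F _ _ _ _ R lebesgue (abse \o K)).
        exact: measurableT_comp.
      by move=> p; exact: abse_ge0.
    - apply/measurable_EFinP; apply: measurable_funM => //.
      exact: measurable_heat_multiplier.
    move=> xi _; rewrite mulrC EFinM -BE -ge0_integralZl//; last 2 first.
      - exact: measurable_int iuw.
      - by rewrite lee_fin (ltW (heat_multiplier_gt0 _ _ _ _)).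
    apply: ge0_le_integral => //.
    - apply: measurableT_comp => //.
      exact: (measurableT_comp mK (@measurable_pair1 _ _ _ _ xi)).
    - apply: emeasurable_funM => //; exact: measurable_int iuw.
    - move=> y _; rewrite /K -EFinM /= lee_fin normrM (ger0_norm (ltW (heat_multiplier_gt0 _ _ _ _))).
      by rewrite ler_wpM2l ?(ltW (heat_multiplier_gt0 _ _ _ _))//.
  have iBE : lebesgue.-integrable setT (fun xi => (B * E t xi)%:E).
    by under eq_fun do rewrite EFinM; apply: integrableZl => //; exact: iE.
  by rewrite ltey_eq (integrable_fin_num measurableT iBE).
have FUB := @Fubini _ _ _ _ R lebesgue lebesgue K iK.
have L : \int[lebesgue]_xi (E t xi * \int[lebesgue]_y
     (cos (dotp (x - y) xi) * u y - sin (dotp (x - y) xi) * w y)) =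
  fine (\int[lebesgue]_xi \int[lebesgue]_y K (xi, y))%E.
  rewrite /Rintegral; congr fine; apply: eq_integral => xi _.
  rewrite EFinM fineK; last by apply: integrable_fin_num => //; exact: iin.
  by rewrite -integralZl//; exact: iin.
have Rt : \int[lebesgue]_y ((\int[lebesgue]_v (cos (dotp (x - y) v) * E t v)) * u y) =
  fine (\int[lebesgue]_y \int[lebesgue]_xi K (xi, y))%E.
  rewrite {1}/Rintegral; congr fine; apply: eq_integral => y _.
  have ic := icosE (x - y) t0.
  have is' := isinE (x - y) t0.
  have iuc : lebesgue.-integrable setT (fun v => ((u y)%:E * (cos (dotp (x - y) v) * E t v)%:E)%E).
    exact: integrableZl.
  have iws : lebesgue.-integrable setT (fun v => ((w y)%:E * (sin (dotp (x - y) v) * E t v)%:E)%E).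
    exact: integrableZl.
  transitivity ((u y)%:E * \int[lebesgue]_v (cos (dotp (x - y) v) * E t v)%:E -
      (w y)%:E * \int[lebesgue]_v (sin (dotp (x - y) v) * E t v)%:E)%E.
    have fs := integrable_fin_num measurableT is'.
    have := integral_sin_heat_multiplier (x - y) t0; rewrite /Rintegral => hs.
    rewrite -[X in (_ - _ * X)%E]fineK// hs mule0 sube0 EFinM muleC fineK//.
    exact: integrable_fin_num.
  rewrite -!integralZl// -integralB//.
  by apply: eq_integral => v _; rewrite /K /= -!EFinM -EFinB; congr EFin; ring.
by rewrite L Rt FUB.
Qed.

(** The multiplier and f are both integrable, so Fubini gives the identity at every x; the rest is
    splitting complex products into real and imaginary parts. *)
Lemma is_heat_kernel_fourier t : 0 < t -> is_heat_kernel m alpha t (Phi t).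
Proof.
move=> t0; split; first exact: continuous_fourier_heat_kernel.
move=> f [[iu iw] _]; apply: nearW => x.
set u := (fun v => complex.Re (f v)) in iu *; set w := (fun v => complex.Im (f v)) in iw *.
have ReM (a : R) (z : R[i]) : complex.Re (a%:C%C * z) = a * complex.Re z.
  by case: z => b c /=; rewrite mul0r subr0.
have ImM (a : R) (z : R[i]) : complex.Im (a%:C%C * z) = a * complex.Im z.
  by case: z => b c /=; rewrite mul0r addr0.
have iPu := integrable_fourier_heat_kernelM x t0 iu.
have iPw := integrable_fourier_heat_kernelM x t0 iw.
split.
  split.
    by under eq_fun do rewrite ReM; exact: iPu.
  by under eq_fun do rewrite ImM; exact: iPw.
have iNu : lebesgue.-integrable setT (EFin \o (fun v => - u v)).
  by apply: eq_integrable (integrableN iu).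
have H1 := fubini_heat_multiplier x t0 iu iw.
(* The imaginary part for f is the real part for -i f, whose real and imaginary parts are Im f and
   -Re f. *)
have H2 := fubini_heat_multiplier x t0 iw iNu.
have val (g : 'rV[R]_n -> R) : lebesgue.-integrable setT (fun y => (Phi t (x - y) * g y)%:E) ->
    lebesgue.-integrable setT (fun y => (\int[lebesgue]_v (cos (dotp (x - y) v) * E t v) * g y)%:E) ->
    \int[lebesgue]_y (Phi t (x - y) * g y) =
    (2 * pi) ^- n * \int[lebesgue]_y ((\int[lebesgue]_v (cos (dotp (x - y) v) * E t v)) * g y).
  move=> _ h2; rewrite -RintegralZl//.
  by apply: eq_Rintegral => y _; rewrite mulrA.
have descale (g : 'rV[R]_n -> R) : lebesgue.-integrable setT (fun y => (Phi t (x - y) * g y)%:E) ->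
    lebesgue.-integrable setT (fun y => (\int[lebesgue]_v (cos (dotp (x - y) v) * E t v) * g y)%:E).
  move=> h; have := integrableZl measurableT ((2 * pi) ^+ n) h.
  apply: eq_integrable => // y _; rewrite -EFinM; congr EFin.
  by rewrite /fourier_heat_kernel mulrA mulVKf// gt_eqF// exprn_gt0// mulr_gt0// pi_gt0.
rewrite /semigroup /fourier_multiplier /inverse_fourier /cintegral.
under eq_Rintegral do rewrite ReM.
under [X in (_ +i* X)%C]eq_Rintegral do rewrite ImM.
rewrite (val _ iPu (descale _ iPu)) (val _ iPw (descale _ iPw)) -H1 -H2.
have dC xi y : dotp xi (x - y) = dotp xi x - dotp xi y by rewrite dotpC dotpBl dotpC [dotp y _]dotpC.
have icos xi (g : 'rV[R]_n -> R) (h : R -> R) : continuous h -> (forall z, `|h z| <= 1) ->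
    lebesgue.-integrable setT (EFin \o g) ->
    lebesgue.-integrable setT (fun y => (h (- dotp xi y) * g y)%:E).
  move=> ch h1 ig; apply: le_integrable (ig) => //.
    apply/measurable_EFinP; apply: measurable_funM.
      apply: (@measurableT_comp _ _ _ _ _ _ h); first exact: continuous_measurable_fun.
      by apply: measurable_funN; exact: measurable_dotp.
    by apply/measurable_EFinP; exact: measurable_int ig.
  by move=> y _; rewrite /= lee_fin normrM ler_piMl.
have Fre xi : complex.Re (fourier f xi) =
    \int[lebesgue]_y (cos (- dotp xi y) * u y) - \int[lebesgue]_y (sin (- dotp xi y) * w y).
  rewrite /= -RintegralB//; last 2 first.
    exact: (icos xi u _ (@continuous_cos R) (@cos_max R) iu).
    exact: (icos xi w _ (@continuous_sin R) (@sin_max R) iw).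
  by apply: eq_Rintegral => y _; rewrite /u /w /cis; case: (f y).
have Fim xi : complex.Im (fourier f xi) =
    \int[lebesgue]_y (cos (- dotp xi y) * w y) + \int[lebesgue]_y (sin (- dotp xi y) * u y).
  rewrite /= -RintegralD//; last 2 first.
    exact: (icos xi w _ (@continuous_cos R) (@cos_max R) iw).
    exact: (icos xi u _ (@continuous_sin R) (@sin_max R) iu).
  by apply: eq_Rintegral => y _; rewrite /u /w /cis; case: (f y).
have comb xi (g h : 'rV[R]_n -> R) : lebesgue.-integrable setT (EFin \o g) ->
   lebesgue.-integrable setT (EFin \o h) ->
   \int[lebesgue]_y (cos (dotp (x - y) xi) * g y - sin (dotp (x - y) xi) * h y) =
   cos (dotp xi x) * (\int[lebesgue]_y (cos (- dotp xi y) * g y) -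
                      \int[lebesgue]_y (sin (- dotp xi y) * h y)) -
   sin (dotp xi x) * (\int[lebesgue]_y (cos (- dotp xi y) * h y) +
                      \int[lebesgue]_y (sin (- dotp xi y) * g y)).
  move=> ig ih.
  have g1 := icos xi g _ (@continuous_cos R) (@cos_max R) ig.
  have g2 := icos xi g _ (@continuous_sin R) (@sin_max R) ig.
  have h1 := icos xi h _ (@continuous_cos R) (@cos_max R) ih.
  have h2 := icos xi h _ (@continuous_sin R) (@sin_max R) ih.
  rewrite -RintegralB// -RintegralD// -!RintegralZl//; last 2 first.
    by apply: eq_integrable (integrableD measurableT h1 g2).
    by apply: eq_integrable (integrableB measurableT g1 h2).
  rewrite -RintegralB//; last 2 first.
    apply: eq_integrable (integrableZl measurableT (cos (dotp xi x)) (integrableB measurableT g1 h2)) => //.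
    apply: eq_integrable (integrableZl measurableT (sin (dotp xi x)) (integrableD measurableT h1 g2)) => //.
  apply: eq_Rintegral => y _.
  have -> : dotp (x - y) xi = dotp xi x + - dotp xi y by rewrite dotpC dC.
  rewrite cosD sinD.
  move: (cos _) (sin _) (cos _) (sin _) => a b c e.
  by ring.
have eqI (F G : 'rV[R]_n -> R) : F =1 G -> \int[lebesgue]_y F y = \int[lebesgue]_y G y.
  by move=> FG; apply: eq_Rintegral => v _.
have ReE xi : complex.Re (cis (dotp xi x) * ((expR (- t * symbol m alpha xi))%:C%C * fourier f xi)) =
   E t xi * \int[lebesgue]_y (cos (dotp (x - y) xi) * u y - sin (dotp (x - y) xi) * w y).
  rewrite (comb xi u w iu iw) -Fre -Fim; case: (fourier f xi) => a b /=.
  by rewrite /heat_multiplier; ring.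
have ImE xi : complex.Im (cis (dotp xi x) * ((expR (- t * symbol m alpha xi))%:C%C * fourier f xi)) =
   E t xi * \int[lebesgue]_y (cos (dotp (x - y) xi) * w y - sin (dotp (x - y) xi) * - u y).
  rewrite (comb xi w (fun y => - u y) iw iNu).
  have s1 : \int[lebesgue]_y (sin (- dotp xi y) * - u y) = - \int[lebesgue]_y (sin (- dotp xi y) * u y).
    rewrite -mulN1r -RintegralZl//; last exact: (icos xi u _ (@continuous_sin R) (@sin_max R) iu).
    by apply: eqI => y; rewrite mulN1r mulrN.
  have s2 : \int[lebesgue]_y (cos (- dotp xi y) * - u y) = - \int[lebesgue]_y (cos (- dotp xi y) * u y).
    rewrite -mulN1r -RintegralZl//; last exact: (icos xi u _ (@continuous_cos R) (@cos_max R) iu).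
    by apply: eqI => y; rewrite mulN1r mulrN.
  have := Fre xi; have := Fim xi; rewrite s1 s2 opprK.
  case: (fourier f xi) => a b /= -> ->.
  by rewrite /heat_multiplier; ring.
rewrite (eqI _ _ ReE) (eqI _ _ ImE).
have realM (a b c : R) : (a * b +i* (a * c))%C = a%:C%C * (b +i* c)%C.
  by apply/eqP; rewrite eq_complex /= !mul0r subr0 addr0 !eqxx.
exact: realM.
Qed.

(** If p > q at x, continuity keeps p - q >= e on a cube around x. Testing both kernels on the
    indicator of a cube centred at 0, at a point y near x outside the exceptional null set, gives
    equal integrals that differ by at least e times the volume. *)
Lemma is_heat_kernel_unique t (p q : 'rV[R]_n -> R) :
  is_heat_kernel m alpha t p -> is_heat_kernel m alpha t q -> forall x, p x <= q x.
Proof.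
move=> [cp hp] [cq hq] x; rewrite leNgt; apply/negP => qp.
pose e := (p x - q x) / 4.
have e0 : 0 < e by rewrite divr_gt0// subr_gt0.
have [r r0 hr] : exists2 r : R, 0 < r & forall y, (forall i, `|(x - y) ord0 i| < r) -> e <= p y - q y.
  have [r1 r10 h1] := (continuous_rowP p).1 cp x e e0.
  have [r2 r20 h2] := (continuous_rowP q).1 cq x e e0.
  exists (Num.min r1 r2) => [|y hy]; first by rewrite lt_min r10.
  have {}h1 : `|p x - p y| < e.
    by apply: h1 => i; have := hy i; rewrite !mxE lt_min => /andP[].
  have {}h2 : `|q x - q y| < e.
    by apply: h2 => i; have := hy i; rewrite !mxE lt_min => /andP[].
  have : p x - q x = 4 * e by rewrite /e mulrC divfK.
  by move: h1 h2; rewrite !ltr_norml => /andP[? ?] /andP[? ?]; lra.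
(* With half-width r/2, if y - x and z lie in the cube then y - z is within r of x in every
   coordinate. *)
pose I0 : set R := `]- (r / 2), r / 2[%classic.
pose Q : set 'rV[R]_n := [set v | forall i, I0 (v ord0 i)].
have mI0 : measurable (I0 : set (measurableTypeR R)) by exact: measurable_itv.
have QE (z v : 'rV[R]_n) : \prod_(i < n) \1_I0 ((v - z) ord0 i) = \1_Q (v - z) :> R.
  rewrite [RHS]indicE; case: (boolP (_ \in Q)) => [/set_mem h|/negP h].
    by rewrite big1// => i _; rewrite indicE mem_set//; exact: h.
  have /existsNP[i hi] : ~ forall i, I0 ((v - z) ord0 i) by move=> h'; apply: h; exact: mem_set.
  by rewrite (bigD1 i)//= indicE memNset// mul0r.
have vol z : (\int[lebesgue]_v (\1_Q (v - z))%:E = (r ^+ n)%:E)%E.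
  under eq_integral do rewrite -QE.
  have := @ge0_integral_prod R n (fun i (y : R) => \1_I0 (y - z ord0 i)) (fun=> r).
  rewrite prodr_const card_ord => <-//.
  - by apply: eq_integral => v _; congr EFin; apply: eq_bigr => i _; rewrite !mxE.
  - move=> i; apply: (@measurableT_comp _ _ _ _ _ _ (\1_I0 : measurableTypeR R -> R)).
      exact: measurable_indic.
    by apply: measurable_funB.
  - move=> i; rewrite -[RHS](_ : (z ord0 i + r / 2 - (z ord0 i - r / 2))%:E = _); last first.
      by congr EFin; lra.
    rewrite -integral_indic_itv; last by lra.
    apply: eq_integral => s _; congr EFin; rewrite !indicE; congr (nat_of_bool _)%:R.
    apply/idP/idP => /set_mem h; apply: mem_set; move: h; rewrite /I0/= !in_itv/= => /andP[h1 h2];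
      apply/andP; split; lra.
have mQ z : measurable_fun setT (fun v : 'rV[R]_n => \1_Q (v - z) : R).
  under eq_fun do rewrite -QE.
  apply: measurable_prod => i _.
  apply: (@measurableT_comp _ _ _ _ _ _ (\1_I0 : measurableTypeR R -> R)).
    exact: measurable_indic.
  apply: (measurableT_comp (measurable_coord i)).
  by apply: measurable_rowB => //; exact: measurable_cst.
have iQ z : lebesgue.-integrable setT (fun v : 'rV[R]_n => (\1_Q (v - z) : R)%:E).
  apply/integrableP; split; first exact/measurable_EFinP.
  under eq_integral do rewrite gee0_abs ?lee_fin ?indicE//.
  under eq_integral do rewrite -indicE.
  by rewrite vol ltry.
have {}iQ0 : lebesgue.-integrable setT (fun v : 'rV[R]_n => (\1_Q v : R)%:E).
  by have := iQ 0; under eq_fun do rewrite subr0.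
pose f (v : 'rV[R]_n) : R[i] := (\1_Q v)%:C%C.
have Lf : L1L2 f.
  split; first split => //=; first exact: integrable0.
  apply: eq_integrable iQ0 => // v _ /=; rewrite expr0n addr0.
  by rewrite indicE; case: (_ \in _); rewrite ?expr1n ?expr0n.
have := hp f Lf; have := hq f Lf => hq' hp'.
have [N [mN N0 hN]] := filterI hp' hq'.
(* The translated cube has positive measure, so the null set cannot contain it. *)
have [y Qy nNy] : exists2 y, Q (y - x) & ~ N y.
  apply: contrapT => h.
  have sub y : Q (y - x) -> N y by move=> Qy; apply: contrapT => Ny; apply: h; exists y.
  have : (\int[lebesgue]_v (\1_Q (v - x))%:E <= \int[lebesgue]_v (\1_N v)%:E)%E.
    apply: ge0_le_integral => //.
    - exact/measurable_EFinP.
    - by apply/measurable_EFinP; exact: measurable_indic.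
    - move=> v _; rewrite lee_fin !indicE ler_nat; case: (boolP (_ \in Q)) => // /set_mem /sub Nv.
      by rewrite mem_set.
  have -> : (\int[lebesgue]_v (\1_N v)%:E = 0 :> \bar R)%E.
    by rewrite integral_indic// setIT; exact: N0.
  by rewrite vol lee_fin leNgt exprn_gt0.
have [[[ip _] Ip] [[iq _] Iq]] := contrapT (contra_not (hN y) nNy).
have ReM (a : R) v : complex.Re (a%:C%C * f v) = a * \1_Q v.
  by rewrite /f/= mul0r subr0.
move: Ip; rewrite -Iq /cintegral => -[+ _].
under eq_Rintegral do rewrite mul0r subr0.
under [in RHS]eq_Rintegral do rewrite mul0r subr0.
have {}ip : lebesgue.-integrable setT (fun z => (p (y - z) * \1_Q z)%:E).
  by apply: eq_integrable ip => // z _; rewrite ReM.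
have {}iq : lebesgue.-integrable setT (fun z => (q (y - z) * \1_Q z)%:E).
  by apply: eq_integrable iq => // z _; rewrite ReM.
move/eqP; rewrite -subr_eq0 -RintegralB// => /eqP h0.
have : e * r ^+ n <= \int[lebesgue]_z (p (y - z) * \1_Q z - q (y - z) * \1_Q z).
  have -> : e * r ^+ n = \int[lebesgue]_z (e * \1_Q (z - 0) : R).
    rewrite RintegralZl//; last exact: iQ.
    by rewrite /Rintegral vol.
  apply: le_Rintegral => //.
  - apply: eq_integrable (integrableZl measurableT e (iQ 0)) => // v _.
  - by apply: eq_integrable (integrableB measurableT ip iq).
  - move=> z _; rewrite -mulrBl subr0 indicE.
    case: (boolP (z \in Q)) => [/set_mem Qz|_]; last by rewrite !mulr0.
    rewrite !mulr1; apply: hr => i.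
    have := Qy i; have := Qz i; rewrite /I0/= !in_itv/= !mxE => /andP[a1 a2] /andP[b1 b2].
    by rewrite ltr_norml; apply/andP; split; lra.
by rewrite h0 leNgt mulr_gt0// exprn_gt0.
Qed.

Lemma heat_kernelE t : 0 < t -> heat_kernel m alpha t = Phi t.
Proof.
move=> t0; apply: xget_unique; first exact: is_heat_kernel_fourier.
move=> p hp; apply/funext => x; apply/eqP; rewrite eq_le.
by rewrite !(@is_heat_kernel_unique t)//; exact: is_heat_kernel_fourier.
Qed.

End heat_kernel_identification.

(** * The resolvent kernel *)

(* The integral of a nonnegative function is a supremum over simple functions,
   hence monotone without any measurability assumption. *)
Lemma ge0_le_integral_nomeasurable d (T : measurableType d) (R : realType)
    (mu : {measure set T -> \bar R}) (D : set T) (f g : T -> \bar R) :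
  (forall x, D x -> 0 <= f x)%E -> (forall x, D x -> f x <= g x)%E ->
  (\int[mu]_(x in D) f x <= \int[mu]_(x in D) g x)%E.
Proof.
move=> f0 fg; rewrite !ge0_integralE//; last first.
  by move=> x Dx; exact: le_trans (f0 x Dx) (fg x Dx).
apply: ereal_sup_le => _ [h hf <-]; exists h => // x.
apply: (le_trans (hf x)); rewrite !patchE; case: ifPn => // /set_mem; exact: fg.
Qed.

Lemma powR_lt1 (R : realType) (r a : R) : 0 <= r < 1 -> 0 < a -> r `^ a < 1.
Proof.
move=> /andP[r0 r1] a0; have := @gt0_ltr_powR R a a0 r 1.
by rewrite !nnegrE r0 ler01 powR1; exact.
Qed.

Lemma powR_le1 (R : realType) (r a : R) : 0 <= r <= 1 -> 0 <= a -> r `^ a <= 1.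
Proof.
move=> /andP[r0 r1] a0; have := @ge0_ler_powR R a a0 r 1.
by rewrite !nnegrE r0 ler01 powR1; exact.
Qed.

Lemma integral_cst_oo (R : realType) (a b c : R) : a < b ->
  (\int[lebesgue_measure]_(t in `]a, b[) c%:E = (c * (b - a))%:E)%E.
Proof.
move=> ab; rewrite integral_cst; last exact: measurable_itv.
have := lebesgue_measure_itv `]a, b[; rewrite /= lte_fin ab -EFinB => h.
by rewrite EFinM; congr (_ * _)%E; exact: h.
Qed.

Section resolvent_kernel_bounds.
Context {R : realType} {n : nat} (m alpha : R).
Hypotheses (alpha0 : 0 < alpha) (alpha2 : alpha < 2) (m0 : 0 <= m).
Local Notation mu := (@lebesgue_measure R).
Local Notation Phi := (@fourier_heat_kernel R n m alpha).
Local Notation Res := (@resolvent_kernel R n m alpha).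
Implicit Types x : 'rV[R]_n.

Lemma resolvent_kernelE x :
  (Res x = \int[mu]_(t in `]0%R, +oo[) (expR (- t) * Phi t x)%:E)%E.
Proof.
apply: eq_integral => t /set_mem; rewrite /= in_itv/= andbT => t0.
by rewrite heat_kernelE.
Qed.

Lemma fourier_heat_kernel_ge0 t x : 0 < t -> 0 <= Phi t x.
Proof.
by move=> t0; have [C C0 /(_ t x t0)[]] := @fourier_heat_kernel_bound R n _ _ alpha0 alpha2 m0.
Qed.

Lemma resolvent_kernel_ge0 x : (0 <= Res x)%E.
Proof.
rewrite resolvent_kernelE; apply: integral_ge0 => t; rewrite /= in_itv/= andbT => t0.
by rewrite lee_fin mulr_ge0 ?expR_ge0// fourier_heat_kernel_ge0.
Qed.

(** The integrand is nonnegative, so the times outside [B] may be discarded, and exp(-t) >= exp(-1)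
    on the remaining ones. *)
Lemma resolvent_kernel_ge x (B : set R) (h : R -> R) :
  (forall t, B t -> 0 < t <= 1) -> (forall t, B t -> 0 <= h t <= Phi t x) ->
  (\int[mu]_(t in B) (expR (- 1) * h t)%:E <= Res x)%E.
Proof.
move=> B01 hB; rewrite resolvent_kernelE integral_mkcond [leRHS]integral_mkcond.
apply: ge0_le_integral_nomeasurable => t _.
  rewrite patchE; case: ifPn => // /set_mem /hB /andP[h0 _].
  by rewrite lee_fin mulr_ge0 ?expR_ge0.
rewrite !patchE; case: ifPn => [/set_mem Bt|_].
  have /andP[t0 t1] := B01 t Bt; have /andP[h0 hPhi] := hB t Bt.
  rewrite mem_set; last by rewrite /= in_itv/= t0.
  by rewrite lee_fin ler_pM ?expR_ge0// ler_expR lerN2.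
case: ifPn => // /set_mem; rewrite /= in_itv/= andbT => t0.
by rewrite lee_fin mulr_ge0 ?expR_ge0// fourier_heat_kernel_ge0.
Qed.

Local Notation gamma := (n%:R / alpha).

Lemma time_powR (t : R) : 0 <= t -> ((t `^ alpha^-1) ^+ n)^-1 = t `^ (- gamma).
Proof.
move=> t0; rewrite -powR_mulrn ?powR_ge0// -powRrM powRN; congr (_ `^ _)^-1.
by rewrite mulrC.
Qed.

Lemma powR_powR_alpha (r : R) : 0 <= r -> (r `^ alpha) `^ alpha^-1 = r.
Proof. by move=> r0; rewrite -powRrM divff ?gt_eqF// powRr1. Qed.

Lemma integral_powR_neq1 (rho : R) : 0 < rho < 1 -> gamma != 1 ->
  (\int[mu]_(t in `[rho, 1%R]) (t `^ (- gamma))%:E =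
   ((1 - rho `^ (1 - gamma)) / (1 - gamma))%:E)%E.
Proof.
move=> /andP[rho0 rho1] g1.
have g0 : 1 - gamma != 0 by rewrite subr_eq0 eq_sym.
have cf t : rho <= t <= 1 -> {for t, continuous (fun t : R => t `^ (- gamma))}.
  move=> /andP[t1 _]; exact: (is_derive_continuous (is_derive1_powR _ (lt_le_trans rho0 t1))).
have dF t : rho <= t <= 1 -> is_derive t 1
    (fun t => (1 - gamma)^-1 * t `^ (1 - gamma)) (t `^ (- gamma)).
  move=> /andP[t1 _]; have t0 := lt_le_trans rho0 t1.
  have := is_derive_cst_mul (1 - gamma)^-1 (is_derive1_powR (1 - gamma) t0).
  move/is_derive_eq; apply; rewrite mulrA mulVf// mul1r; congr (_ `^ _); lra.
rewrite (FTC2_is_derive rho1 cf dF).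
by rewrite powR1 -mulrBr mulrC.
Qed.

Lemma integral_inv (rho : R) : 0 < rho < 1 ->
  (\int[mu]_(t in `[rho, 1%R]) (t `^ (- 1))%:E = (- ln rho)%:E)%E.
Proof.
move=> /andP[rho0 rho1].
have cf t : rho <= t <= 1 -> {for t, continuous (fun t : R => t `^ (- 1))}.
  move=> /andP[t1 _]; exact: (is_derive_continuous (is_derive1_powR _ (lt_le_trans rho0 t1))).
have dF t : rho <= t <= 1 -> is_derive t 1 (@ln R) (t `^ (- 1)).
  move=> /andP[t1 _]; have t0 := lt_le_trans rho0 t1.
  by rewrite powR_inv1 ?(ltW t0)//; exact: is_derive1_ln.
by rewrite (FTC2_is_derive rho1 cf dF) ln1 sub0r.
Qed.

(* The three terms come from the times [t <= r `^ alpha], [r `^ alpha <= t <= 1]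
   and [1 <= t], where r = |x|. *)
Lemma resolvent_kernel_le_split : exists2 C : R, 0 < C & forall x, 0 < enorm x < 1 ->
  (Res x <= C%:E * ((enorm x `^ (alpha - n%:R))%:E +
     \int[mu]_(t in `[(enorm x `^ alpha)%R, 1%R]) (t `^ (- gamma))%:E + 1))%E.
Proof.
have [C1 C10 h1] := @fourier_heat_kernel_bound R n _ _ alpha0 alpha2 m0.
have [C2 C20 h2] := @fourier_heat_kernel_small_time R n _ _ alpha0 alpha2 m0.
have [C3 C30 h3] := @fourier_heat_kernel_large_time R n _ _ alpha0 alpha2 m0.
have [C4 C40 h4] := @pow_expR_le R 2; have [C5 C50 h5] := @integral_cauchy R.
pose K := C3 * C4.
exists (2 * C1 + C2 + K * C5) => [|x /andP[r0 r1]].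
  by rewrite !addr_gt0// !mulr_gt0.
set r := enorm x in r0 r1 *; pose rho := r `^ alpha.
have rho0 : 0 < rho by exact: powR_gt0.
have rho1 : rho < 1.
  by apply: powR_lt1 => //; rewrite (ltW r0) r1.
(* The interval is doubled so as to be open and still contain t = rho, whence the factor 2 on
   [C1]. *)
pose g1 t : R := C1 / r ^+ n * \1_(`]0, 2 * rho[%classic : set R) t.
pose g2 := (fun t => (C2 * t `^ (- gamma))%:E) \_ (`[rho, 1]%classic : set R).
(* For t >= 1 the heat kernel is at most [C3] and exp(-t) at most [C4] / (1 + t^2); [1 * t] matches
   [integral_cauchy] at r = 1. *)
pose g3 t := K * (1 + (1 * t) ^+ 2)^-1.
have g10 t : 0 <= g1 t.
  by rewrite mulr_ge0 ?indicE// divr_ge0 ?(ltW C10)// exprn_ge0// ltW.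
have g20 t : (0 <= g2 t)%E.
  rewrite /g2 patchE; case: ifPn => // _.
  by rewrite lee_fin mulr_ge0 ?(ltW C20)// powR_ge0.
have g30 t : 0 <= g3 t.
  by rewrite !mulr_ge0 ?(ltW C30) ?(ltW C40)// invr_ge0 addr_ge0// sqr_ge0.
have mpow : measurable_fun setT (fun t : R => (C2 * t `^ (- gamma))%:E).
  by apply/measurable_EFinP; apply: measurable_funM => //; exact: measurable_powR.
have mI : measurable (`[rho, 1]%classic : set (measurableTypeR R)) by exact: measurable_itv.
have mi : measurable_fun setT (EFin \o (\1_(`]0, 2 * rho[%classic : set R) : R -> R)).
  by apply/measurable_EFinP.
have mg1 : measurable_fun setT (EFin \o g1).
  by apply/measurable_EFinP; apply: measurable_funM.
have mg2 : measurable_fun setT g2.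
  by apply/(measurable_restrictT _ mI); exact: measurable_funTS.
have mg3 : measurable_fun setT (EFin \o g3).
  apply/measurable_EFinP; apply: measurable_funM => //.
  by apply: continuous_measurable_fun; exact: continuous_cauchy.
have bnd : (Res x <= \int[mu]_t ((g1 t)%:E + g2 t + (g3 t)%:E))%E.
  rewrite resolvent_kernelE integral_mkcond; apply: ge0_le_integral_nomeasurable => t _.
    rewrite patchE; case: ifPn => // /set_mem; rewrite /= in_itv/= andbT => t0.
    by rewrite lee_fin mulr_ge0 ?expR_ge0// fourier_heat_kernel_ge0.
  rewrite patchE; case: ifPn => [/set_mem|_]; last by rewrite !adde_ge0// lee_fin.
  rewrite /= in_itv/= andbT => t0.
  have P0 := @fourier_heat_kernel_ge0 t x t0.
  have eP : expR (- t) * Phi t x <= Phi t x.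
    by rewrite ler_piMl// -[leRHS]expR0 ler_expR oppr_le0 ltW.
  have [trho|rhot] := leP t rho.
    apply: (@le_trans _ _ (g1 t)%:E); last by rewrite -addeA leeDl// adde_ge0// lee_fin.
    rewrite lee_fin (le_trans eP)// /g1 indicE mem_set; last first.
      by rewrite /= in_itv/= t0/=; lra.
    rewrite mulr1 ler_pdivlMr ?exprn_gt0// mulrC.
    by have [] := h1 t x t0.
  have [t1|t1] := leP t 1.
    apply: (@le_trans _ _ (g2 t)).
      rewrite /g2 patchE mem_set; last by rewrite /= in_itv/= t1 ltW.
      rewrite lee_fin (le_trans eP)// -time_powR ?(ltW t0)//.
      by apply: h2; rewrite t0.
    by rewrite addeAC leeDr// adde_ge0// lee_fin.
  apply: (@le_trans _ _ (g3 t)%:E); last by rewrite leeDr// adde_ge0// lee_fin.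
  have e4 : expR (- t) <= C4 * (1 + (1 * t) ^+ 2)^-1.
    rewrite mul1r expRN -div1r ler_pdivrMr ?expR_gt0// mulrAC.
    rewrite ler_pdivlMr ?ltr_pwDl ?sqr_ge0// mul1r.
    by apply: le_trans (h4 t (ltW t0)); nra.
  rewrite lee_fin /g3 /K -mulrA mulrC ler_pM ?expR_ge0//.
  exact/h3/ltW.
apply: (le_trans bnd).
rewrite ge0_integralD//; last 3 first.
- by move=> t _; rewrite adde_ge0// lee_fin.
- exact: emeasurable_funD.
- by move=> t _; rewrite lee_fin.
rewrite ge0_integralD//; last by move=> t _; rewrite lee_fin.
have -> : (\int[mu]_t (g1 t)%:E = (2 * C1 * r `^ (alpha - n%:R))%:E)%E.
  under eq_integral do rewrite EFinM.
  rewrite ge0_integralZl//; last by rewrite lee_fin divr_ge0 ?(ltW C10)// exprn_ge0// ltW.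
  rewrite integral_indic_itv ?mulr_gt0// subr0 -EFinM; congr EFin.
  rewrite powRB; last by rewrite (gt_eqF r0) ?implybT.
  by rewrite powR_mulrn ?(ltW r0)// -/rho; field; rewrite gt_eqF// exprn_gt0.
have -> : (\int[mu]_t g2 t = C2%:E * \int[mu]_(t in `[rho, 1%R]) (t `^ (- gamma))%:E)%E.
  rewrite /g2 -integral_mkcond; under eq_integral do rewrite EFinM.
  rewrite ge0_integralZl//; last 3 first.
    - by apply/measurable_EFinP; apply: measurable_funTS; exact: measurable_powR.
    - by move=> t _; rewrite lee_fin powR_ge0.
    - by rewrite lee_fin ltW.
have -> : (\int[mu]_t (g3 t)%:E = (K * C5)%:E)%E.
  under eq_integral do rewrite EFinM.
  rewrite ge0_integralZl//; last 3 first.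
    - by apply/measurable_EFinP; apply: continuous_measurable_fun; exact: continuous_cauchy.
    - by move=> t _; rewrite lee_fin invr_ge0 addr_ge0// sqr_ge0.
    - by rewrite lee_fin mulr_ge0 ?ltW.
  by rewrite h5// divr1 -EFinM.
set I2 := (\int[mu]_(t in _) _)%E.
have I20 : (0 <= I2)%E by apply: integral_ge0 => t _; rewrite lee_fin powR_ge0.
have pE : (0 <= (r `^ (alpha - n%:R))%:E)%E by rewrite lee_fin powR_ge0.
have pI : (0 <= (r `^ (alpha - n%:R))%:E + I2)%E by exact: adde_ge0.
rewrite (ge0_muleDr _ pI lee01) (ge0_muleDr _ pE I20) mule1.
have p0 : 0 <= r `^ (alpha - n%:R) by exact: powR_ge0.
have K0 : 0 <= K * C5 by rewrite !mulr_ge0 ?ltW.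
apply: leeD; first apply: leeD.
- by rewrite -EFinM lee_fin ler_wpM2r// -addrA lerDl addr_ge0// ltW.
- by rewrite lee_wpmul2r// lee_fin addrAC lerDr addr_ge0// mulr_ge0// ltW.
- by rewrite lee_fin lerDr addr_ge0 ?mulr_ge0 ?ltW.
Qed.

(** Since 0 to a nonzero power is 0 for [powR], the value at r = 0 is 0 in the first two cases. *)
Definition local_kernel (r : R) : R :=
  if alpha < n%:R then r `^ (alpha - n%:R)
  else if alpha == n%:R then ln (1 + r `^ (- 1)) else 1.

Lemma measurable_local_kernel : measurable_fun setT local_kernel.
Proof.
rewrite /local_kernel; case: (alpha < n%:R); first exact: measurable_powR.
case: (alpha == n%:R); last exact: measurable_cst.
apply: (@measurableT_comp _ _ _ _ _ _ (@ln R)); first exact: measurable_ln.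
by apply: measurable_funD => //; exact: measurable_powR.
Qed.

Lemma local_kernel_ge0 r : 0 <= local_kernel r.
Proof.
rewrite /local_kernel; case: ifP => _; first exact: powR_ge0.
by case: ifP => // _; rewrite ln_ge0// lerDl powR_ge0.
Qed.

(** The integral of t^(-n/alpha) from r^alpha to 1 is of order r^(alpha-n), a logarithm or 1
    according to the sign of alpha - n. Since r < 1, this order also dominates the two other
    terms. *)
Lemma resolvent_kernel_le : exists2 C : R, 0 < C & forall x, 0 < enorm x < 1 ->
  (Res x <= (C * local_kernel (enorm x))%:E)%E.
Proof.
have [C C0 hC] := resolvent_kernel_le_split.
suff [D D0 hD] : exists2 D : R, 0 < D & forall r : R, 0 < r < 1 ->
    ((r `^ (alpha - n%:R))%:E + \int[mu]_(t in `[(r `^ alpha)%R, 1%R]) (t `^ (- gamma))%:E + 1 <=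
     (D * local_kernel r)%:E)%E.
  exists (C * D) => [|x x01]; first by rewrite mulr_gt0.
  by rewrite -mulrA EFinM (le_trans (hC x x01))// lee_wpmul2l ?lee_fin ?(ltW C0)// hD.
have rho01 r : 0 < r < 1 -> 0 < r `^ alpha < 1.
  by move=> /andP[r0 r1]; rewrite powR_gt0//= powR_lt1// (ltW r0) r1.
have rhoE r : 0 < r -> (r `^ alpha) `^ (1 - gamma) = r `^ (alpha - n%:R).
  move=> r0; rewrite -powRrM; congr (_ `^ _).
  by field; rewrite gt_eqF.
have [an|an|an] := ltgtP alpha n%:R.
- have g1 : 1 < gamma by rewrite ltr_pdivlMr// mul1r.
  exists (2 + (gamma - 1)^-1) => [|r /[dup] r01 /andP[r0 r1]].
    by rewrite addr_gt0// invr_gt0 subr_gt0.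
  rewrite /local_kernel an integral_powR_neq1; [|exact: rho01|by rewrite gt_eqF].
  rewrite rhoE// -!EFinD lee_fin.
  have p1 : 1 <= r `^ (alpha - n%:R).
    rewrite -opprB powRN invf_ge1 ?powR_gt0// powR_le1//.
      by rewrite (ltW r0) (ltW r1).
    by rewrite subr_ge0 ltW.
  set p := r `^ _ in p1 *.
  have -> : (1 - p) / (1 - gamma) = (p - 1) * (gamma - 1)^-1.
    by rewrite -opprB mulNr -mulrN -invrN opprB.
  have : 0 < (gamma - 1)^-1 by rewrite invr_gt0 subr_gt0.
  by nra.
- have g1 : gamma < 1 by rewrite ltr_pdivrMr// mul1r.
  exists (2 + (1 - gamma)^-1) => [|r /[dup] r01 /andP[r0 r1]].
    by rewrite addr_gt0// invr_gt0 subr_gt0.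
  rewrite /local_kernel (lt_gtF an) (gt_eqF an) integral_powR_neq1; [|exact: rho01|by rewrite lt_eqF].
  rewrite rhoE// -!EFinD lee_fin mulr1.
  have p1 : r `^ (alpha - n%:R) <= 1.
    by rewrite powR_le1// ?subr_ge0 (ltW r0, ltW an)// (ltW r1).
  have p0 : 0 <= r `^ (alpha - n%:R) by exact: powR_ge0.
  set p := r `^ _ in p0 p1 *.
  have : 0 < (1 - gamma)^-1 by rewrite invr_gt0 subr_gt0.
  by nra.
(* Here the outer terms add up to 2, which is at most (2 / ln 2) ln(1 + 1/r) because r < 1; the
   integral contributes -alpha ln r. *)
- have ln2 : 0 < ln 2 :> R by rewrite ln_gt0// ltr1n.
  exists (alpha + 2 / ln 2) => [|r /[dup] r01 /andP[r0 r1]].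
    by rewrite addr_gt0// divr_gt0.
  rewrite /local_kernel an ltxx eqxx -an divff ?gt_eqF// subrr powRr0.
  rewrite integral_inv; last exact: rho01.
  rewrite ln_powR -!EFinD lee_fin powR_inv1 ?(ltW r0)//.
  have l1 : - ln r <= ln (1 + r^-1).
    by rewrite -lnV ?posrE// ler_ln ?posrE ?invr_gt0 ?addr_gt0 ?invr_gt0// lerDr.
  have l2 : ln 2 <= ln (1 + r^-1).
    have : 1 < r^-1 by rewrite invf_gt1.
    by move=> ?; rewrite ler_ln ?posrE//; lra.
  have : 2 <= 2 / ln 2 * ln (1 + r^-1) by rewrite mulrAC ler_pdivlMr// ler_wpM2l.
  by move: alpha0 l1; nra.
Qed.

(** The heat kernel is at least c t^(-n/alpha) from a = (|x|/A)^alpha up to 1. The times used are a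
    to 2a if alpha < n, 1/2 to 1 if alpha > n, and a to 1 if alpha = n, where every scale
    contributes equally to the logarithm. *)
Lemma resolvent_kernel_ge_local : exists c r0 : R, [/\ 0 < c, 0 < r0 & forall x, enorm x < r0 ->
  ((c * local_kernel (enorm x))%:E <= Res x)%E].
Proof.
have [A [c [A0 c0 hc]]] := @fourier_heat_kernel_ge R n _ _ alpha0 alpha2 m0.
pose e := expR (- 1) : R; have e0 : 0 < e by exact: expR_gt0.
have low x t : (enorm x / A) `^ alpha <= t -> 0 < t <= 1 -> c * t `^ (- gamma) <= Phi t x.
  move=> xt t01; have /andP[t0 _] := t01; rewrite -time_powR ?(ltW t0)//; apply: hc => //.
  rewrite mulrC -ler_pdivrMr// -[leLHS]powR_powR_alpha ?divr_ge0 ?enorm_ge0 ?(ltW A0)//.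
  by rewrite ge0_ler_powR ?nnegrE ?powR_ge0 ?invr_ge0 ?(ltW alpha0) ?(ltW t0).
(* The radius at which (|x|/A)^alpha equals 1/2, so that 2a <= 1 below it. *)
pose s := A * 2^-1 `^ alpha^-1.
have s0 : 0 < s by rewrite mulr_gt0// powR_gt0.
have half x : enorm x < s -> (enorm x / A) `^ alpha <= 2^-1.
  move=> xs; have -> : 2^-1 = (2^-1 `^ alpha^-1) `^ alpha :> R by rewrite -powRrM mulVf ?gt_eqF// powRr1// invr_ge0.
  rewrite ge0_ler_powR ?nnegrE ?powR_ge0 ?divr_ge0 ?enorm_ge0 ?(ltW A0) ?(ltW alpha0)//.
  by rewrite ler_pdivrMr// mulrC ltW.
have [an|an|an] := ltgtP alpha n%:R.
- exists (e * (c * (2 `^ (- gamma) * A `^ (n%:R - alpha)))), s.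
  split => //; first by rewrite !mulr_gt0// powR_gt0.
  move=> x xs; rewrite /local_kernel an.
  (* At the origin [local_kernel] is 0 by the convention for powers of 0, and the resolvent kernel
     is nonnegative. *)
  have [->|x0] := eqVneq (enorm x) 0.
    by rewrite powR0 ?mulr0 ?resolvent_kernel_ge0// subr_eq0 lt_eqF.
  have r0 : 0 < enorm x by rewrite lt_neqAle eq_sym x0 enorm_ge0.
  set a := (enorm x / A) `^ alpha.
  have a0 : 0 < a by rewrite powR_gt0// divr_gt0.
  have a2 := half x xs; rewrite -/a in a2.
  have rng (t : R) : `]a, 2 * a[%classic t -> 0 < t <= 1.
    by rewrite /= in_itv/= => /andP[t1 t2]; apply/andP; split; lra.
  have /(resolvent_kernel_ge rng) : forall t, `]a, 2 * a[%classic t ->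
      0 <= c * (2 * a) `^ (- gamma) <= Phi t x.
    move=> t ta; rewrite mulr_ge0 ?powR_ge0 ?(ltW c0)//=.
    have t01 := rng t ta; move: ta; rewrite /= in_itv/= => /andP[t1 t2].
    apply: le_trans (low x t (ltW t1) t01); rewrite ler_wpM2l ?(ltW c0)// !powRN.
    have /andP[t0 _] := t01.
    rewrite lef_pV2 ?posrE ?powR_gt0 ?mulr_gt0// ge0_ler_powR ?nnegrE ?divr_ge0 ?(ltW alpha0) ?(ltW t0) ?(ltW t2)//.
    by rewrite mulr_ge0// ltW.
  apply: le_trans; rewrite integral_cst_oo; last by rewrite ltr_pMl// ltr1n.
  rewrite lee_fin -/e -!mulrA ler_wpM2l ?(ltW e0)// ler_wpM2l ?(ltW c0)//.
  rewrite powRM ?(ltW a0)// -!mulrA ler_wpM2l ?powR_ge0//.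
  rewrite (_ : a `^ (- gamma) * (2 * a - a) = a `^ (1 - gamma)); last first.
    by rewrite (addrC 1) powRD ?powRr1 ?(ltW a0) ?(gt_eqF a0) ?implybT//; congr (_ * _); lra.
  rewrite /a -powRrM (_ : alpha * (1 - gamma) = alpha - n%:R); last by field; rewrite gt_eqF.
  rewrite powRM ?enorm_ge0 ?invr_ge0 ?(ltW A0)// mulrC ler_wpM2l ?powR_ge0//.
  by rewrite -powR_inv1 ?(ltW A0)// -powRrM mulN1r opprB.
- exists (e * c / 2), s; split => //; first by rewrite !mulr_gt0.
  move=> x xs; rewrite /local_kernel (lt_gtF an) (gt_eqF an) mulr1.
  have rng (t : R) : `]2^-1, 1[%classic t -> 0 < t <= 1.
    by rewrite /= in_itv/= => /andP[t1 t2]; apply/andP; split; lra.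
  have /(resolvent_kernel_ge rng) : forall t : R, `]2^-1, 1[%classic t -> 0 <= c <= Phi t x.
    move=> t ta; rewrite (ltW c0)/=.
    have t01 := rng t ta; move: ta; rewrite /= in_itv/= => /andP[t1 t2].
    have ta' : (enorm x / A) `^ alpha <= t by rewrite (le_trans (half x xs))// ltW.
    apply: le_trans (low x t ta' t01); rewrite ler_peMr ?(ltW c0)// powRN.
    have /andP[t0 _] := t01.
    rewrite invf_ge1 ?powR_gt0// powR_le1 ?divr_ge0 ?(ltW alpha0)//.
    by rewrite (ltW t0) (ltW t2).
  apply: le_trans; rewrite integral_cst_oo; last by rewrite invf_lt1// ltr1n.
  rewrite lee_fin -/e; lra.
(* The bounds 1 and A^2/2 on |x| give 1 + 1/|x| <= (A/|x|)^2, which compares the logarithm of the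
   local kernel with the one coming from the time integral. *)
- pose s1 := Num.min s (Num.min 1 (A ^+ 2 / 2)).
  have A2 : 0 < A ^+ 2 / 2 by rewrite divr_gt0// exprn_gt0.
  exists (e * c / 2), s1; split => //; [by rewrite !mulr_gt0|by rewrite !lt_min s0 ltr01|].
  move=> x; rewrite !lt_min => /and3P[xs x1 xA].
  have an1 : (alpha < n%:R) = false by rewrite an ltxx.
  rewrite /local_kernel an1 an eqxx -an.
  have [->|x0] := eqVneq (enorm x) 0.
    by rewrite powR0 ?oppr_eq0 ?oner_eq0// addr0 ln1 mulr0 resolvent_kernel_ge0.
  have r0 : 0 < enorm x by rewrite lt_neqAle eq_sym x0 enorm_ge0.
  set a := (enorm x / A) `^ alpha.
  have a0 : 0 < a by rewrite powR_gt0// divr_gt0.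
  have a2 := half x xs; rewrite -/a in a2.
  have g1 : gamma = 1 by rewrite -an divff// gt_eqF.
  have rng (t : R) : `[a, 1]%classic t -> 0 < t <= 1.
    by rewrite /= in_itv/= => /andP[t1 t2]; apply/andP; split; lra.
  have /(resolvent_kernel_ge rng) : forall t, `[a, 1]%classic t -> 0 <= c * t `^ (- 1) <= Phi t x.
    move=> t ta; rewrite mulr_ge0 ?powR_ge0 ?(ltW c0)//=.
    have t01 := rng t ta; move: ta; rewrite /= in_itv/= => /andP[t1 t2].
    by rewrite -g1; exact: low.
  apply: le_trans; rewrite -/e; under eq_integral do rewrite mulrA EFinM.
  rewrite ge0_integralZl//; last 3 first.
    - by apply/measurable_EFinP; apply: measurable_funTS; exact: measurable_powR.
    - by move=> t _; rewrite lee_fin powR_ge0.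
    - by rewrite lee_fin mulr_ge0 ?ltW.
  rewrite integral_inv; last by apply/andP; split => //; lra.
  rewrite -EFinM lee_fin -!mulrA ler_wpM2l ?(ltW e0)// ler_wpM2l ?(ltW c0)//.
  rewrite powR_inv1 ?(ltW r0)//.
  (* Being equal to a positive integer, alpha is at least 1, which lets the factor alpha in the
     logarithm of (|x|/A)^alpha be dropped. *)
  have alpha1 : 1 <= alpha.
    rewrite an; have : 0 < alpha by [].
    by rewrite an ltr0n => n0; rewrite ler1n.
  have xAA : 1 + (enorm x)^-1 <= (A / enorm x) ^+ 2.
    have xV : enorm x * (enorm x)^-1 = 1 by rewrite divff// gt_eqF.
    have V0 : 0 < (enorm x)^-1 by rewrite invr_gt0.
    rewrite exprMn; move: xA x1 xV V0; set y := (enorm x)^-1 => xA x1 xV V0.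
    have y1 : 1 <= y by nra.
    have : enorm x * y * y * 2 <= A ^+ 2 * y * y by nra.
    by rewrite xV => ?; lra.
  have l1 : ln (1 + (enorm x)^-1) <= 2 * ln (A / enorm x).
    rewrite mulr_natl -lnXn ?divr_gt0// ler_ln ?posrE ?exprn_gt0 ?divr_gt0//.
    by rewrite addr_gt0 ?invr_gt0.
  have l0 : 0 <= ln (1 + (enorm x)^-1) by rewrite ln_ge0// lerDl invr_ge0 ltW.
  rewrite /a ln_powR -mulrN -lnV ?posrE ?divr_gt0// invf_div.
  by move: l0 l1 alpha1; set u := ln (1 + _); set v := ln (A / _); nra.
Qed.

End resolvent_kernel_bounds.

(** * Points are null sets *)

Section singleton.
Context {R : realType}.

Lemma measurable_row_set1 n (x : 'rV[R]_n) : measurable [set x].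
Proof.
have -> : [set x] = (fun y => enorm (x - y)) @^-1` [set 0].
  apply/seteqP; split => y /=; first by move=> ->; rewrite subrr enorm0.
  by move/eqP; rewrite enorm_eq0 subr_eq0 => /eqP ->.
rewrite -[X in measurable X]setTI.
by apply: (measurable_enorm (measurable_rowB (measurable_cst _) _)) => //.
Qed.

(** The point lies in a hyperplane with fixed first coordinate, which is null; in dimension 0 the
    point has mass 1. *)
Lemma lebesgue_set1 n (x : 'rV[R]_n) : (0 < n)%N -> @lebesgue R n [set x] = 0%E.
Proof.
case: n x => // n x _.
change (((@lebesgue_measure R) \x (@lebesgue R n))%E (@row_cons R n @^-1` [set x]) = 0%E).
have mx : measurable ([set (row_uncons x).1] `*` [set: 'rV[R]_n] : set (measurableTypeR R * 'rV[R]_n)).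
  by apply: measurableX => //; exact: measurable_set1.
apply: (subset_measure0 _ mx).
- rewrite -[X in measurable X]setTI; apply: measurable_row_cons => //; exact: measurable_row_set1.
- by move=> p <-; split => //; exact: (congr1 fst (esym (row_consK p))).
- etransitivity; first exact: (product_measure1E (@lebesgue_measure R) (@lebesgue R n) (measurable_set1 _) measurableT).
  by rewrite [X in (X * _)%E](_ : _ = 0%E) ?mul0e//; exact: lebesgue_measure_set1.
Qed.

End singleton.

(** * Comparison of the local integrals *)

Section kato_local_potential.
Context {R : realType} {n : nat} (m alpha : R) (V : 'rV[R]_n -> R).
Hypotheses (n0 : (0 < n)%N) (alpha0 : 0 < alpha) (alpha2 : alpha < 2) (m0 : 0 <= m).
Hypothesis mV : measurable_fun setT V.
Local Notation Res := (@resolvent_kernel R n m alpha).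
Local Notation K := (@local_kernel R n alpha).
Local Notation mu := (@lebesgue R n).

(** The integrands agree even at y = x, where division by 0 and powers of 0 both give 0. *)
Lemma local_potentialE (delta : R) (x : 'rV[R]_n) :
  local_potential alpha delta V x =
  (\int[mu]_(y in eball x delta) (K (enorm (x - y)) * `|V y|)%:E)%E.
Proof.
have e0 y := enorm_ge0 (x - y).
rewrite /local_potential; case: ifPn => [an|nan].
  apply: eq_integral => y _; congr EFin.
  by rewrite /local_kernel an -(opprB n%:R) powRN mulrC.
case: ifPn => [/eqP an|nan1]; apply: eq_integral => y _; congr EFin; rewrite /local_kernel (negbTE nan).
  by rewrite an eqxx powR_inv1// div1r.
by rewrite (negbTE nan1) mul1r.
Qed.

Let measurable_local_integrand (x : 'rV[R]_n) :
  measurable_fun setT (fun y : 'rV[R]_n => (K (enorm (x - y)) * `|V y|)%:E).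
Proof.
apply/measurable_EFinP; apply: measurable_funM; last exact: measurableT_comp.
apply: (@measurableT_comp _ _ _ _ _ _ K); first exact: measurable_local_kernel.
by apply: (measurable_enorm (measurable_rowB (measurable_cst _) _)).
Qed.

Let local_integrand_ge0 (x y : 'rV[R]_n) : (0 <= (K (enorm (x - y)) * `|V y|)%:E)%E.
Proof. by rewrite lee_fin mulr_ge0// local_kernel_ge0. Qed.

Lemma local_potential_ge0 (delta : R) x : (0 <= local_potential alpha delta V x)%E.
Proof. by rewrite local_potentialE; apply: integral_ge0 => y _. Qed.

Definition resolvent_potential (delta : R) (x : 'rV[R]_n) : \bar R :=
  (\int[mu]_(y in eball x delta) (Res (x - y) * `|V y|%:E))%E.

(** The kernel bound fails only at y = x. A measurable majorant that is infinite at that null point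
    allows comparison by monotonicity and has the same integral. *)
Lemma resolvent_potential_ge0 (delta : R) x : (0 <= resolvent_potential delta x)%E.
Proof.
by apply: integral_ge0 => y _; rewrite mule_ge0 ?lee_fin// resolvent_kernel_ge0.
Qed.

Lemma resolvent_potential_le : exists2 C : R, 0 < C & forall delta x, delta <= 1 ->
  (resolvent_potential delta x <= C%:E * local_potential alpha delta V x)%E.
Proof.
have [C C0 hC] := @resolvent_kernel_le R n _ _ alpha0 alpha2 m0.
exists C => // delta x d1.
pose f y := (C%:E * (K (enorm (x - y)) * `|V y|)%:E)%E.
(* the resolvent kernel may be infinite at the single point [y = x] *)
pose h y : \bar R := if enorm (x - y) <= 0 then +oo%E else f y.
have menorm : measurable_fun setT (fun y : 'rV[R]_n => enorm (x - y)).
  by apply: (measurable_enorm (measurable_rowB (measurable_cst _) _)).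
have mf : measurable_fun setT f by exact: measurable_funeM.
have mh : measurable_fun setT h.
  by apply: measurable_fun_ifT => //; exact: measurable_fun_ler.
have f0 y : (0 <= f y)%E by rewrite mule_ge0// lee_fin ltW.
have h0 y : (0 <= h y)%E by rewrite /h; case: ifP.
have mB := measurable_eball x delta.
have mx := measurable_row_set1 x.
have Nx := lebesgue_set1 x n0.
have -> : (C%:E * local_potential alpha delta V x = \int[mu]_(y in eball x delta) h y)%E.
  rewrite local_potentialE -ge0_integralZl//; last 2 first.
  - exact: measurable_funTS.
  - by rewrite lee_fin ltW.
  rewrite (ge0_negligible_integral mx mB _ _ Nx)//; last 2 first.
  - exact: measurable_funTS.
  - by move=> y _; exact: f0.
  rewrite [RHS](ge0_negligible_integral mx mB _ _ Nx)//; last exact: measurable_funTS.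
  apply: eq_integral => y /set_mem /= [_ yx]; rewrite /h leNgt lt_neqAle enorm_ge0 andbT.
  by rewrite eq_sym enorm_eq0 subr_eq0; case: eqVneq => // xy; case: yx.
rewrite /resolvent_potential; apply: ge0_le_integral_nomeasurable => y yB.
  by rewrite mule_ge0 ?lee_fin// resolvent_kernel_ge0.
rewrite /h; case: ifPn => [_|]; first exact: leey.
rewrite -ltNge => xy0; rewrite /f EFinM muleA lee_wpmul2r ?lee_fin//.
by rewrite -EFinM hC// xy0 (lt_le_trans yB).
Qed.

Lemma local_potential_le : exists C r0 : R, [/\ 0 < C, 0 < r0 & forall delta x, delta <= r0 ->
  (local_potential alpha delta V x <= C%:E * resolvent_potential delta x)%E].
Proof.
have [c [r0 [c0 r00 hc]]] := @resolvent_kernel_ge_local R n _ _ alpha0 alpha2 m0.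
exists c^-1, r0; split => //; first by rewrite invr_gt0.
move=> delta x dr; rewrite lee_pdivlMl// local_potentialE -ge0_integralZl//; last 3 first.
- exact: measurable_eball.
- exact: measurable_funTS.
- by rewrite lee_fin ltW.
apply: ge0_le_integral_nomeasurable => y yB; first by rewrite mule_ge0// lee_fin ltW.
by rewrite EFinM muleA lee_wpmul2r ?lee_fin// -EFinM hc// (lt_le_trans yB).
Qed.

End kato_local_potential.

(** Squeezes the supremum of f between 0 and [C] times that of g for small delta. A pointed index
    type makes the supremum run over a nonempty set, so that it is nonnegative. *)
Lemma ereal_sup_domination (R : realType) (T : pointedType) (f g : R -> T -> \bar R) (C r0 : R) :
  0 < C -> 0 < r0 -> (forall delta x, 0 <= f delta x)%E ->
  (forall delta x, delta <= r0 -> (f delta x <= C%:E * g delta x)%E) ->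
  ereal_sup [set g delta x | x in [set: T]] @[delta --> 0^'+] --> 0%E ->
  ereal_sup [set f delta x | x in [set: T]] @[delta --> 0^'+] --> 0%E.
Proof.
move=> C0 r00 f0 fg g_cvg.
apply: (@squeeze_cvge _ _ _ _ (cst 0%E) _
  (fun delta => C%:E * ereal_sup [set g delta x | x in [set: T]])%E).
- near=> delta; apply/andP; split.
    by apply: le_ereal_sup_tmp; exists (f delta point) => //; exists point.
  apply: ge_ereal_sup => _ [x _ <-]; apply: (le_trans (fg delta x _)).
    by near: delta; exact: nbhs_right_le.
  rewrite lee_wpmul2l ?lee_fin ?(ltW C0)//; apply: ereal_sup_ubound; by exists x.
- exact: cvg_cst.
- by rewrite -[X in _ --> X](mule0 C%:E); exact: cvgeZl.
Unshelve. all: by end_near. Qed.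

Theorem proposition3p17 (R : realType) (d : nat) (m alpha : R)
    (V : 'rV[R]_d -> R) :
  (0 < d)%N -> 0 < alpha < 2 -> 0 <= m ->
  measurable_fun [set: 'rV[R]_d] V ->
  kato_class m alpha V <->
  ereal_sup [set local_potential alpha delta V x | x in [set: 'rV[R]_d]]
    @[delta --> 0^'+] --> 0%E.
Proof.
move=> d0 /andP[alpha0 alpha2] m0 mV; split.
  have [C [r0 [C0 r00 h]]] := @local_potential_le R d m alpha V alpha0 alpha2 m0 mV.
  by apply: (ereal_sup_domination C0 r00) => //; exact: local_potential_ge0.
have [C C0 h] := @resolvent_potential_le R d m alpha V d0 alpha0 alpha2 m0 mV.
by apply: (ereal_sup_domination C0 ltr01) => //; exact: resolvent_potential_ge0.
Qed.
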